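(* Let $\widehat{\mathfrak g}$ be an affine Lie algebra with associated simple Lie algebra $\mathfrak g$ and weight $\theta$, and let $i\in\{1,\dots,n\}$ be such that vertex $i$ is connected to vertex $0$ in the Dynkin diagram of $\widehat{\mathfrak g}$ and $\alpha_i\in\Lambda^+$. Then there is an isomorphism of ($U_q(\mathfrak g)$-)crystals $$\mathcal B(\theta)\;\xrightarrow{\ \sim\ }\;\mathcal C(x_\theta\otimes y_i),$$ where $\mathcal C(x_\theta\otimes y_i)$ is the connected component of $\mathcal B(\theta)\otimes\mathcal B(\theta)$ containing $x_\theta\otimes y_i$, connectedness being taken with respect to the arrows of colours $1,\dots,n$ only (the $0$-arrows are omitted).
   Context: Affine data. $\widehat{\mathfrak g}$ is of type $\mathrm{A}_n^{(1)}$, $\mathrm{B}_n^{(1)}$, $\mathrm{C}_n^{(1)}$, $\mathrm{D}_n^{(1)}$, $\mathrm{E}_6^{(1)}$, $\mathrm{E}_7^{(1)}$, $\mathrm{E}_8^{(1)}$, $\mathrm{F}_4^{(1)}$, $\mathrm{G}_2^{(1)}$, $\mathrm{A}_{2n}^{(2)}$, $\mathrm{A}_{2n-1}^{(2)}$, $\mathrm{D}_{n+1}^{(2)}$, $\mathrm{E}_6^{(2)}$ or $\mathrm{D}_4^{(3)}$, with vertex set $\{0,1,\dots,n\}$, simple roots $\alpha_i$, and null root $\delta=d_0\alpha_0+\cdots+d_n\alpha_n$; vertex $0$ is chosen in the standard way, so that the coefficient of $h_0$ in the canonical central element is $1$ and $d_0=1$, except that $d_0=2$ for $\mathrm{A}_{2n}^{(2)}$.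 $\mathfrak g$ is the simple Lie algebra obtained by deleting vertex $0$: type $\mathrm{X}_n$ for $\mathrm{X}_n^{(1)}$, $\mathrm{C}_n$ for $\mathrm{A}_{2n}^{(2)}$ and $\mathrm{A}_{2n-1}^{(2)}$, $\mathrm{B}_n$ for $\mathrm{D}_{n+1}^{(2)}$, $\mathrm{F}_4$ for $\mathrm{E}_6^{(2)}$, $\mathrm{G}_2$ for $\mathrm{D}_4^{(3)}$. $\theta=d_1\alpha_1+\cdots+d_n\alpha_n$ if $\widehat{\mathfrak g}\ne \mathrm{A}_{2n}^{(2)}$, and $\theta=\frac12(d_1\alpha_1+\cdots+d_n\alpha_n)$ if $\widehat{\mathfrak g}=\mathrm{A}_{2n}^{(2)}$. (So $\theta$ is the highest root of $\mathfrak g$ in the untwisted cases and the highest short root of $\mathfrak g$ in the twisted cases other than $\mathrm{A}_{2n}^{(2)}$.) $\mathcal B(\theta)$ is the crystal of the irreducible $U_q(\mathfrak g)$-module of highest weight $\theta$, and $\Lambda$ is its set of weights. $\Lambda^+$ is the set of nonzero elements of $\Lambda$ lying in the nonnegative rational span of $\alpha_1,\dots,\alpha_n$, and $\Lambda^-=-\Lambda^+$. The elements of $\mathcal B(\theta)$ are $x_\alpha$ ($\alpha\in\Lambda^+\cup\Lambda^-$), of weight $\alpha$, and $y_i$ (one for each $i\in\{1,\dots,n\}$ with $\alpha_i\in\Lambda^+$; none for $\mathrm{A}_{2n}^{(2)}$), of weight $0$. The arrows of colour $i\in\{1,\dots,n\}$ are: $x_\alpha\xrightarrow{\,i\,}x_\beta$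 if and only if $\alpha-\alpha_i=\beta$; and $x_{\alpha_i}\xrightarrow{\,i\,}y_i\xrightarrow{\,i\,}x_{-\alpha_i}$ when $\alpha_i\in\Lambda^+$. An arrow $b\xrightarrow{\,i\,}b'$ means $\tilde f_ib=b'$, equivalently $\tilde e_ib'=b$; $\varepsilon_i(b)$ (resp. $\varphi_i(b)$) is the maximal number of times $\tilde e_i$ (resp. $\tilde f_i$) can be applied to $b$ without giving $0$. Tensor product rule: $\mathrm{wt}(b_1\otimes b_2)=\mathrm{wt}\,b_1+\mathrm{wt}\,b_2$; $\tilde e_i(b_1\otimes b_2)=\tilde e_ib_1\otimes b_2$ if $\varphi_i(b_1)\ge\varepsilon_i(b_2)$ and $=b_1\otimes\tilde e_ib_2$ otherwise; $\tilde f_i(b_1\otimes b_2)=\tilde f_ib_1\otimes b_2$ if $\varphi_i(b_1)>\varepsilon_i(b_2)$ and $=b_1\otimes\tilde f_ib_2$ otherwise. A crystal isomorphism is a bijection preserving $\mathrm{wt}$, $\varepsilon_k$, $\varphi_k$ and commuting with $\tilde e_k,\tilde f_k$ for all $k\in\{1,\dots,n\}$. *)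

(* Defs.v *)
From Stdlib Require Import Relation_Operators.
From mathcomp Require Import all_boot all_order all_algebra.
From mathcomp Require Import boolp classical_sets.
From mathcomp Require Import zify ring.

Set Implicit Arguments.
Unset Strict Implicit.
Unset Printing Implicit Defensive.

Import Order.TTheory GRing.Theory Num.Theory.
Local Open Scope ring_scope.

(* In the constructor names the digit is the order of the diagram automorphism:
   Aeven2 n, Aodd2 n and D2 n are A_{2n}^(2), A_{2n-1}^(2) and D_{n+1}^(2). *)
Inductive affine_type : Type :=
| A1 of nat | B1 of nat | C1 of nat | D1 of nat
| E6_1 | E7_1 | E8_1 | F4_1 | G2_1
| Aeven2 of nat | Aodd2 of nat | D2 of nat | E6_2 | D4_3.

Definition rank (X : affine_type) : nat :=
  match X with
  | A1 n | B1 n | C1 n | D1 n | Aeven2 n | Aodd2 n | D2 n => n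
  | E6_1 => 6 | E7_1 => 7 | E8_1 => 8 | F4_1 => 4 | G2_1 => 2
  | E6_2 => 4 | D4_3 => 2
  end%N.

Definition in_range (X : affine_type) : bool :=
  match X with
  | A1 n | Aeven2 n => 1 <= n
  | C1 n | D2 n => 2 <= n
  | B1 n | Aodd2 n => 3 <= n
  | D1 n => 4 <= n
  | _ => true
  end%N.

(* (i, j, p, r) is an edge of the Dynkin diagram with a_ij = -p, a_ji = -r. *)
Definition edge : Type := (nat * nat * nat * nat)%type.

Definition simple_edge (i j : nat) : edge := (i, j, 1, 1)%N.

Definition chain (k m : nat) : seq edge :=
  [seq simple_edge i i.+1 | i <- iota k (m - k)].

(* The vertices are numbered as in Kac's tables, except that E6, E7, E8 are
   numbered as in Bourbaki. *)
Definition edges (X : affine_type) : seq edge :=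
  match X with
  | A1 n => if n == 1 then [:: (0, 1, 2, 2)] else simple_edge n 0 :: chain 0 n
  | B1 n => simple_edge 0 2 :: rcons (chain 1 n.-1) (n.-1, n, 1, 2)
  | C1 n => (0, 1, 1, 2) :: rcons (chain 1 n.-1) (n.-1, n, 2, 1)
  | D1 n => simple_edge 0 2 :: rcons (chain 1 n.-1) (simple_edge n.-2 n)
  | E6_1 => [:: simple_edge 0 2, simple_edge 2 4, simple_edge 1 3
              & chain 3 6]
  | E7_1 => [:: simple_edge 0 1, simple_edge 2 4, simple_edge 1 3
              & chain 3 7]
  | E8_1 => [:: simple_edge 0 8, simple_edge 2 4, simple_edge 1 3
              & chain 3 8]
  | F4_1 => rcons (chain 0 2) (2, 3, 1, 2) ++ chain 3 4
  | G2_1 => rcons (chain 0 1) (1, 2, 1, 3)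
  | Aeven2 n => if n == 1 then [:: (0, 1, 4, 1)]
                else (0, 1, 2, 1) :: rcons (chain 1 n.-1) (n.-1, n, 2, 1)
  | Aodd2 n => simple_edge 0 2 :: rcons (chain 1 n.-1) (n.-1, n, 2, 1)
  | D2 n => (0, 1, 2, 1) :: rcons (chain 1 n.-1) (n.-1, n, 1, 2)
  | E6_2 => rcons (chain 0 2) (2, 3, 2, 1) ++ chain 3 4
  | D4_3 => rcons (chain 0 1) (1, 2, 3, 1)
  end%N.

Definition edge_entry (i j : nat) (e : edge) : nat :=
  let: (a, b, p, r) := e in
  if (a == i) && (b == j) then p else if (b == i) && (a == j) then r else 0%N.

(* a_ij = <h_i, alpha_j> *)
Definition cartan_entry (X : affine_type) (i j : nat) : int :=
  if i == j then 2 else - (\sum_(e <- edges X) edge_entry i j e)%N%:Z.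

Definition affine_cartan (X : affine_type) : 'M[int]_((rank X).+1) :=
  \matrix_(i, j) cartan_entry X i j.

Definition finite_cartan (X : affine_type) : 'M[int]_(rank X) :=
  \matrix_(i, j) affine_cartan X (lift ord0 i) (lift ord0 j).

(* marks X j is the coefficient d_j of the null root. *)
Definition marks (X : affine_type) (j : nat) : nat :=
  match X with
  | A1 _ | D2 _ => 1
  | B1 _ => if j <= 1 then 1 else 2
  | C1 n => if (j == 0) || (j == n) then 1 else 2
  | D1 n => if (j <= 1) || (n.-1 <= j) then 1 else 2
  | E6_1 => nth 1 [:: 1; 1; 2; 2; 3; 2; 1] j
  | E7_1 => nth 1 [:: 1; 2; 2; 3; 4; 3; 2; 1] j
  | E8_1 => nth 1 [:: 1; 2; 3; 4; 6; 5; 4; 3; 2] j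
  | F4_1 => nth 1 [:: 1; 2; 3; 4; 2] j
  | G2_1 => nth 1 [:: 1; 2; 3] j
  | Aeven2 n => if j == n then 1 else 2
  | Aodd2 n => if (j <= 1) || (j == n) then 1 else 2
  | E6_2 => nth 1 [:: 1; 2; 3; 2; 1] j
  | D4_3 => nth 1 [:: 1; 2; 1] j
  end%N.

Lemma marks_gt0 (X : affine_type) (j : nat) : (0 < marks X j)%N.
Proof.
case: X => [n|n|n|n||||||n|n|n||] //=; try by case: ifP.
all: by do 10 (case: j => [//|j]).
Qed.

Definition neighbour_sum (d : nat -> nat) (i : nat) (e : edge) : nat :=
  let: (a, b, p, r) := e in
  ((if a == i then p * d b else 0) + (if b == i then r * d a else 0))%N.

Lemma neighbour_chain (d : nat -> nat) (i k m : nat) :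
  (\sum_(e <- chain k m) neighbour_sum d i e =
   (if k <= i < m then d i.+1 else 0) + (if k < i <= m then d i.-1 else 0))%N.
Proof.
rewrite /chain big_map.
have [lekm|ltmk] := leqP k m; last first.
  have -> : (m - k = 0)%N by lia.
  rewrite big_nil.
  by do 2 (case: ifP => ?; first by lia).
rewrite -{2 3}(subnKC lekm); elim: (m - k)%N => [|l IH].
  rewrite big_nil; by do 2 (case: ifP => ?; first by lia).
rewrite -addn1 iotaD big_cat IH /= big_seq1 /neighbour_sum /= !mul1n.
have [<-|ne1] := eqVneq (k + l)%N i.
  have -> : ((k + l).+1 == k + l)%N = false by lia.
  by do 4 (case: ifP => ?; try lia).
have [<-|ne2] := eqVneq (k + l).+1 i.
  by rewrite /=; do 4 (case: ifP => ?; try lia).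
by do 4 (case: ifP => ?; try lia).
Qed.

Definition edge_ok (n : nat) (e : edge) : bool :=
  let: (a, b, _, _) := e in [&& a != b, a <= n & b <= n]%N.

Lemma all_chain (n k m : nat) : (m <= n)%N -> all (edge_ok n) (chain k m).
Proof.
move=> lemn; apply/allP => e /mapP[i]; rewrite mem_iota => Hi ->.
by rewrite /edge_ok /=; lia.
Qed.

Lemma edges_ok (X : affine_type) : in_range X -> all (edge_ok (rank X)) (edges X).
Proof.
case: X => [n|n|n|n||||||n|n|n||] //= Hn; try case: ifP => //= Hn1;
  rewrite ?all_rcons ?all_chain /= ?andbT; lia.
Qed.

Lemma neighbour_marks (X : affine_type) (i : nat) : in_range X ->
  (i <= rank X)%N ->
  (\sum_(e <- edges X) neighbour_sum (marks X) i e = 2 * marks X i)%N.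
Proof.
case: X => /= [n|n|n|n||||||n|n|n||] Hn Hi.
1: case: (eqVneq n 1%N) => [n1|nn1].
11: case: (eqVneq n 1%N) => [n1|nn1].
all: try by rewrite unlock; do 10 (case: i Hi => [|i] Hi //).
all: try by subst n; rewrite unlock; do 2 (case: i Hi => [|i] Hi //).
all: rewrite -?cats1 !big_cons ?big_cat ?neighbour_chain /= ?big_seq1 /neighbour_sum /=.
all: repeat (case: ifP => ?; try lia).
Qed.

Lemma sum_edge_entry (n i : nat) (d : nat -> nat) (e : edge) : edge_ok n e ->
  (\sum_(j < n.+1 | j != i :> nat) edge_entry i j e * d j = neighbour_sum d i e)%N.
Proof.
case: e => [[[a b] p] r] /= /and3P[ab an bn].
have [ai|nai] := eqVneq a i.
  have nbi : b != i by rewrite -ai eq_sym.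
  rewrite (bigD1 (Ordinal (bn : b < n.+1)%N)) //= eqxx (negbTE nbi) big1 //= => j.
  by move=> /andP[_ /negP jb]; case: eqP => // bj; case: jb; apply/eqP/val_inj.
have [bi|nbi] := eqVneq b i; last by rewrite big1.
rewrite (bigD1 (Ordinal (an : a < n.+1)%N)) //= eqxx big1 ?addn0 //= => j.
by move=> /andP[_ /negP ja]; case: eqP => // aj; case: ja; apply/eqP/val_inj.
Qed.

Lemma null_root (X : affine_type) (i : 'I_((rank X).+1)) : in_range X ->
  \sum_j affine_cartan X i j * (marks X j)%:Z = 0.
Proof.
move=> hX; rewrite (bigD1 i) //= mxE /cartan_entry eqxx.
rewrite (eq_bigr (fun j : 'I_((rank X).+1) =>
   - (\sum_(e <- edges X) edge_entry i j e * marks X j)%N%:Z)); last first.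
  move=> j ji; rewrite mxE /cartan_entry eq_sym (inj_eq val_inj) (negbTE ji).
  by rewrite mulNr -PoszM big_distrl.
rewrite sumrN.
have -> : \sum_(j < (rank X).+1 | j != i)
    (\sum_(e <- edges X) edge_entry i j e * marks X j)%N%:Z =
    (\sum_(e <- edges X) neighbour_sum (marks X) i e)%N%:Z.
  rewrite -[LHS](big_morph Posz PoszD (erefl _)) exchange_big /=; congr Posz.
  rewrite !big_seq; apply: eq_bigr => e /(allP (edges_ok hX)) eok.
  exact: (sum_edge_entry i (marks X) eok).
rewrite neighbour_marks //; last by rewrite -ltnS ltn_ord.
by rewrite PoszM subrr.
Qed.

Lemma marks_coprime (X : affine_type) : in_range X ->
  \big[gcdn/0%N]_(j < (rank X).+1) marks X j = 1%N.
Proof.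
move=> hX.
suff [j dj] : exists j : 'I_((rank X).+1), marks X j = 1%N.
  by rewrite (bigD1 j) //= dj gcd1n.
case: X hX => [n|n|n|n||||||n|n|n||] hX.
all: try by exists ord0.
by exists ord_max; rewrite /= eqxx.
Qed.

Lemma marks0 (X : affine_type) : in_range X ->
  marks X 0 = (if X is Aeven2 _ then 2 else 1)%N.
Proof. by case: X => //= -[]. Qed.

(* Weights are written in the basis of simple roots of the rational span of the
   weight lattice. *)
Definition alpha (n : nat) (i : 'I_n) : 'rV[rat]_n := delta_mx 0 i.

Definition theta (X : affine_type) : 'rV[rat]_(rank X) :=
  (if X is Aeven2 _ then 2^-1 else 1) *:
    \sum_(i < rank X) (marks X i.+1)%:R *: alpha i.

(* <h_i, mu> *)
Definition pairing (n : nat) (A : 'M[int]_n) (i : 'I_n) (mu : 'rV[rat]_n) : rat :=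
  \sum_j (A i j)%:~R * mu 0 j.

Definition symmetrizer (n : nat) (A : 'M[int]_n) (s : 'I_n -> nat) : Prop :=
  (forall i, (0 < s i)%N) /\
  (forall i j, (s i)%:Z * A i j = (s j)%:Z * A j i).

Definition Qq : fieldType := {fraction {poly rat}}.
Definition q : Qq := tofrac 'X.

Definition qint (x : Qq) (m : nat) : Qq := (x ^+ m - x ^- m) / (x - x^-1).
Definition qfact (x : Qq) (m : nat) : Qq := \prod_(k < m) qint x k.+1.
Definition qbinom (x : Qq) (m k : nat) : Qq :=
  qfact x m / (qfact x k * qfact x (m - k)).

Definition q_serre (V : lmodType Qq) (x : Qq) (m : nat) (f g : V -> V) : Prop :=
  forall v, \sum_(k < m.+1)
    ((-1) ^+ k * qbinom x m k) *: iter (m - k) f (g (iter k f v)) = 0.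

(* A U_q(g)-module structure on V, for g with Cartan matrix A:
   opT i and opT' i are the actions of q^{h_i} and q^{-h_i}, so that
   K_i = q^{s_i h_i} acts as the s_i-th power of opT i. *)
Record uq_module (n : nat) (A : 'M[int]_n) (s : 'I_n -> nat) (V : lmodType Qq) :=
  UqModule {
    opE : 'I_n -> {linear V -> V};
    opF : 'I_n -> {linear V -> V};
    opT : 'I_n -> {linear V -> V};
    opT' : 'I_n -> {linear V -> V};
    T_T' : forall i v, opT i (opT' i v) = v;
    T'_T : forall i v, opT' i (opT i v) = v;
    T_T : forall i j v, opT i (opT j v) = opT j (opT i v);
    T_E : forall i j v, opT i (opE j v) = q ^ (A i j) *: opE j (opT i v);
    T_F : forall i j v, opT i (opF j v) = q ^ (- A i j) *: opF j (opT i v);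
    E_F : forall i j v, opE i (opF j v) - opF j (opE i v) =
      if i == j then (q ^+ s i - q ^- s i)^-1 *:
                       (iter (s i) (opT i) v - iter (s i) (opT' i) v)
      else 0;
    serre_E : forall i j, i != j -> q_serre (q ^+ s i) `|1 - A i j|%N (opE i) (opE j);
    serre_F : forall i j, i != j -> q_serre (q ^+ s i) `|1 - A i j|%N (opF i) (opF j)
  }.

Definition submodule (n : nat) (A : 'M[int]_n) (s : 'I_n -> nat)
    (V : lmodType Qq) (M : uq_module A s V) (S : set V) : Prop :=
  [/\ S 0, (forall a u v, S u -> S v -> S (a *: u + v)) &
      forall i v, S v ->
        [/\ S (opE M i v), S (opF M i v), S (opT M i v) & S (opT' M i v)]].

Definition irreducible (n : nat) (A : 'M[int]_n) (s : 'I_n -> nat)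
    (V : lmodType Qq) (M : uq_module A s V) : Prop :=
  (exists v : V, v != 0) /\
  forall S, submodule M S -> S = [set 0]%classic \/ S = [set: V]%classic.

Definition weight_vector (n : nat) (A : 'M[int]_n) (s : 'I_n -> nat)
    (V : lmodType Qq) (M : uq_module A s V) (mu : 'rV[rat]_n) (v : V) : Prop :=
  v != 0 /\
  forall i, exists2 m : int, pairing A i mu = m%:~R & opT M i v = q ^ m *: v.

Definition has_highest_weight (n : nat) (A : 'M[int]_n) (s : 'I_n -> nat)
    (V : lmodType Qq) (M : uq_module A s V) (mu : 'rV[rat]_n) : Prop :=
  exists2 v, weight_vector M mu v & forall i, opE M i v = 0.

(* A crystal base of M has the same weights as M, so for M irreducible of
   highest weight theta this is the set of weights of the crystal B(theta). *)
Definition Lambda (n : nat) (A : 'M[int]_n) (s : 'I_n -> nat)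
    (V : lmodType Qq) (M : uq_module A s V) : set 'rV[rat]_n :=
  [set mu | exists v, weight_vector M mu v]%classic.

Definition Lambda_pos (n : nat) (A : 'M[int]_n) (s : 'I_n -> nat)
    (V : lmodType Qq) (M : uq_module A s V) : set 'rV[rat]_n :=
  [set mu | [/\ Lambda M mu, mu != 0 & forall j, 0 <= mu 0 j]]%classic.

Definition Lambda_neg (n : nat) (A : 'M[int]_n) (s : 'I_n -> nat)
    (V : lmodType Qq) (M : uq_module A s V) : set 'rV[rat]_n :=
  [set - mu | mu in Lambda_pos M]%classic.

(* The crystal axioms are not required; isomorphisms only involve these data.
   None stands for the zero element 0 that is adjoined to a crystal. *)
Record crystal (I P : Type) := Crystal {
  elt :> choiceType;
  wt : elt -> P;
  e_ : I -> elt -> option elt;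
  f_ : I -> elt -> option elt
}.

(* The largest k such that g can be applied k times to b; 0 if there is none. *)
Definition string_length (C : choiceType) (g : C -> option C) (b : C) : nat :=
  let defined k := iter k (obind g) (Some b) <> None in
  xget 0%N [set k | defined k /\ forall m, defined m -> (m <= k)%N]%classic.

Definition eps (I P : Type) (C : crystal I P) (i : I) (b : C) : nat :=
  string_length (e_ i) b.
Definition phi (I P : Type) (C : crystal I P) (i : I) (b : C) : nat :=
  string_length (f_ i) b.

Definition tensor (I : Type) (P : zmodType) (C1 C2 : crystal I P) : crystal I P :=
  {| elt := (C1 * C2)%type;
     wt := fun b => wt b.1 + wt b.2;
     e_ := fun i b =>
       if (eps i b.2 <= phi i b.1)%N then omap (fun c => (c, b.2)) (e_ i b.1)
       else omap (fun c => (b.1, c)) (e_ i b.2);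
     f_ := fun i b =>
       if (eps i b.2 < phi i b.1)%N then omap (fun c => (c, b.2)) (f_ i b.1)
       else omap (fun c => (b.1, c)) (f_ i b.2) |}.

Definition connected (I P : Type) (C : crystal I P) : C -> C -> Prop :=
  clos_refl_sym_trans C (fun b c => exists i, f_ i b = Some c).

Definition subcrystal (I P : Type) (C : crystal I P) (S : set C) : crystal I P :=
  {| elt := set_type S;
     wt := fun b => wt (val b);
     e_ := fun i b => obind insub (e_ i (val b));
     f_ := fun i b => obind insub (f_ i (val b)) |}.

Definition component (I P : Type) (C : crystal I P) (b : C) : crystal I P :=
  subcrystal [set c | connected b c]%classic.

Definition crystal_isomorphism (I P : Type) (C1 C2 : crystal I P)
    (h : C1 -> C2) : Prop :=
  bijective h /\
  forall b, wt (h b) = wt b /\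
    forall i, [/\ eps i (h b) = eps i b, phi i (h b) = phi i b,
                  e_ i (h b) = omap h (e_ i b) & f_ i (h b) = omap h (f_ i b)].

Definition crystal_isomorphic (I P : Type) (C1 C2 : crystal I P) : Prop :=
  exists h : C1 -> C2, crystal_isomorphism h.

Definition B_elt (n : nat) (A : 'M[int]_n) (s : 'I_n -> nat)
    (V : lmodType Qq) (M : uq_module A s V) : choiceType :=
  (set_type (Lambda_pos M `|` Lambda_neg M)%classic +
   set_type [set i | Lambda_pos M (alpha i)]%classic)%type.

Definition x_ (n : nat) (A : 'M[int]_n) (s : 'I_n -> nat)
    (V : lmodType Qq) (M : uq_module A s V) (mu : 'rV[rat]_n)
    (hmu : (Lambda_pos M `|` Lambda_neg M)%classic mu) : B_elt M :=
  inl (exist _ mu (mem_set hmu)).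

Definition y_ (n : nat) (A : 'M[int]_n) (s : 'I_n -> nat)
    (V : lmodType Qq) (M : uq_module A s V) (i : 'I_n)
    (hi : Lambda_pos M (alpha i)) : B_elt M :=
  inr (exist (fun j => j \in [set j | Lambda_pos M (alpha j)]%classic) i
             (mem_set hi)).

Definition B_wt (n : nat) (A : 'M[int]_n) (s : 'I_n -> nat)
    (V : lmodType Qq) (M : uq_module A s V) (b : B_elt M) : 'rV[rat]_n :=
  match b with inl a => val a | inr _ => 0 end.

Inductive arrow (n : nat) (A : 'M[int]_n) (s : 'I_n -> nat)
    (V : lmodType Qq) (M : uq_module A s V) (i : 'I_n) :
    B_elt M -> B_elt M -> Prop :=
| arrow_xx mu nu (hmu : (Lambda_pos M `|` Lambda_neg M)%classic mu)
    (hnu : (Lambda_pos M `|` Lambda_neg M)%classic nu) : mu - alpha i = nu ->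
    arrow i (x_ hmu) (x_ hnu)
| arrow_xy h hi : arrow i (x_ (mu := alpha i) h) (y_ (i := i) hi)
| arrow_yx h hi : arrow i (y_ (i := i) hi) (x_ (mu := - alpha i) h).

(* Each b has at most one outgoing and one incoming arrow of colour i, so xget
   returns Some of the unique neighbour, or None if there is no arrow. *)
Definition B_crystal (n : nat) (A : 'M[int]_n) (s : 'I_n -> nat)
    (V : lmodType Qq) (M : uq_module A s V) : crystal 'I_n 'rV[rat]_n :=
  {| elt := B_elt M;
     wt := @B_wt n A s V M;
     e_ := fun i b => xget None [set Some c | c in [set c | arrow i c b]]%classic;
     f_ := fun i b => xget None [set Some c | c in [set c | arrow i b c]]%classic |}.

Lemma thetaE (X : affine_type) (j : 'I_(rank X)) :
  theta X 0 j = (if X is Aeven2 _ then 2^-1 else 1) * (marks X j.+1)%:R.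
Proof.
rewrite /theta mxE summxE (bigD1 j) //= big1 => [|k kj]; last first.
  by rewrite !mxE eqxx /= eq_sym (negbTE kj) mulr0.
by rewrite !mxE !eqxx /= mulr1 addr0.
Qed.

Lemma theta_gt0 (X : affine_type) (j : 'I_(rank X)) : 0 < theta X 0 j.
Proof.
by rewrite thetaE mulr_gt0 ?ltr0n ?marks_gt0 //; case: X j.
Qed.

Lemma theta_Lambda_pos (X : affine_type) (s : 'I_(rank X) -> nat)
    (V : lmodType Qq) (M : uq_module (finite_cartan X) s V) :
  in_range X -> has_highest_weight M (theta X) -> Lambda_pos M (theta X).
Proof.
move=> hX [v wv _]; split; first by exists v.
  have r0 : (0 < rank X)%N by case: X {s M v wv} hX => //= n; lia.
  apply/eqP => theta0.
  by have := theta_gt0 (Ordinal r0); rewrite theta0 mxE ltxx.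
by move=> j; rewrite ltW // theta_gt0.
Qed.

(* Submission.v *)
(* Normalise the form by (alpha_i,alpha_i) = 2 r_i, short simple roots having
   r_i = 1.  The nonzero weights of B(theta) are the vectors v of the root lattice
   with (v,v) = 2, or with (v,v) = 2m and m | r_i v_i for all i, where
   (theta,theta) = 2m.  The image u_b of b in B(theta) is obtained by following
   from x_theta (x) y_i the colours of a path of f-arrows from x_theta to b.  It
   does not depend on the path by a rank-two argument: for two colours j, k, the
   arrows of these colours at an element depend only on finitely many data of its
   weight v, the products (v,v), (v,alpha_j), (v,alpha_k) and divisibilities by m,
   so a finite computation shows that {j, k}-highest elements of B(theta) and of
   B(theta) (x) B(theta) of the same weight generate isomorphic
   {j, k}-components.  If b has an incoming arrow of colour j, then for every k
   it lies strictly below a {j, k}-highest element, so that induction on the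
   depth of b glues these isomorphisms. *)
From HB Require Import structures.
From Stdlib Require Import ZArith Relation_Operators.
Require Import Defs.
From mathcomp Require Import all_boot all_order all_algebra.
From mathcomp Require Import boolp classical_sets.
From mathcomp Require Import zify ring lra ssrZ.

Set Implicit Arguments.
Unset Strict Implicit.
Unset Printing Implicit Defensive.

Import Order.TTheory GRing.Theory Num.Theory.
Local Open Scope ring_scope.

(** The set Lambda is given only through the module, so the description of its nonzero elements has
    to be derived. Strings for the rank-one subalgebras show that Lambda is stable under simple
    reflections, lies below theta, and that every weight other than theta can be raised; positive
    definiteness of the form then pins it down. A description by norm and divisibility is chosen
    because it turns the question whether v + alpha_j or v - alpha_j is a weight into a question
    about finitely many numbers. Type A_{2n}^(2) cannot occur: there the last coordinate of every
    weight lies in 1/2 + Z, so no alpha_i is a weight. Adjacency of i to 0 enters through <h_i,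
    theta> > 0, hence phi_i(x_theta) >= 1 = eps_i(y_i), which makes x_theta (x) y_i highest. In rank
    one there is no second colour to glue with, and two strings of three elements are compared by
    hand. *)

Lemma q_neq0 : q != 0.
Proof. by rewrite /q tofrac_eq0 polyX_eq0. Qed.

Lemma q_expn_eq1 (k : nat) : q ^+ k = 1 -> k = 0%N.
Proof.
move/eqP; rewrite /q -tofracXn -tofrac1 tofrac_eq => /eqP h.
by have := congr1 (fun p : {poly rat} => size p) h; rewrite size_polyXn size_poly1 => -[].
Qed.

Lemma q_expz_eq1 (k : int) : q ^ k = 1 -> k = 0.
Proof.
case: k => k /=; first by move/q_expn_eq1 ->.
by move/eqP; rewrite NegzE -invr_expz invr_eq1 => /eqP/q_expn_eq1.
Qed.

Lemma q_expz_inj : injective (fun k : int => q ^ k).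
Proof.
move=> a b /= h; apply/eqP; rewrite -subr_eq0; apply/eqP/q_expz_eq1.
by rewrite expfzDr ?q_neq0 // h -expfzDr ?q_neq0 // subrr.
Qed.

(** * Quantum integers, without the denominator x - x^-1 *)

Definition qnum (F : fieldType) (x : F) (k : int) : F := x ^ k - x ^ (- k).

Lemma qnum_eq0 (s : nat) (k : int) : (0 < s)%N -> qnum (q ^+ s) k = 0 -> k = 0.
Proof.
move=> s0 /eqP; rewrite /qnum subr_eq0 !(exprnP q s) !exprz_exp => /eqP.
by move/q_expz_inj => h; nia.
Qed.

(** Quantum analogue of summing p - 2i over i = 0, ..., k to (k + 1)(p - k). The factored form shows
    when the coefficient in E F^(k+1) v vanishes. *)
Lemma qnum_sum (F : fieldType) (x : F) (p : int) (k : nat) : x != 0 ->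
  qnum x 1 * (\sum_(i < k.+1) qnum x (p - 2 * i%:Z)) =
  qnum x k.+1%:Z * qnum x (p - k%:Z).
Proof.
move=> x0; elim: k => [|k IH].
  by rewrite big_ord1 mulr0 subr0.
rewrite big_ord_recr mulrDr IH /qnum /=.
rewrite (_ : k.+2%:Z = k%:Z + 1 + 1); last by lia.
rewrite (_ : k.+1%:Z = k%:Z + 1); last by lia.
rewrite (_ : p - 2 * (k%:Z + 1) = p - k%:Z - k%:Z - 1 - 1); last by lia.
rewrite (_ : p - (k%:Z + 1) = p - k%:Z - 1); last by lia.
rewrite !opprB !opprD !expfzDr // -!invr_expz !expr1z.
have ? : x ^ p != 0 by rewrite expfz_neq0.
have ? : x ^+ k != 0 by rewrite expf_neq0.
rewrite ?invrK -!exprnP; field.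
by rewrite x0; apply/andP; split.
Qed.

Lemma qnumE1 (F : fieldType) (x : F) : qnum x 1 = x - x^-1.
Proof. by []. Qed.

Lemma sum_quantum_eq0 (F : fieldType) (x : F) (p : int) (k : nat) : x != 0 ->
  (forall l : int, l != 0 -> qnum x l != 0) ->
  (\sum_(l < k.+1) (x - x^-1)^-1 * qnum x (p - 2 * l%:Z) == 0) = (p == k%:Z).
Proof.
move=> x0 hx; have h1 : qnum x 1 != 0 by exact: hx.
have hp : (qnum x (p - k%:Z) == 0) = (p == k%:Z).
  rewrite -[RHS]subr_eq0; have [->|/hx/negbTE //] := eqVneq (p - k%:Z) 0.
  by rewrite /qnum oppr0 subrr eqxx.
rewrite -mulr_sumr mulf_eq0 invr_eq0 -qnumE1 (negbTE h1) /= -hp.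
have h (y : F) : (y == 0) = (qnum x 1 * y == 0) by rewrite mulf_eq0 (negbTE h1).
by rewrite (h (\sum_(l < _) _)) qnum_sum // mulf_eq0 (negbTE (hx k.+1%:Z isT)).
Qed.

Lemma exprz_expn (F : fieldType) (x : F) (m : int) (k : nat) : (x ^ m) ^+ k = (x ^+ k) ^ m.
Proof. by rewrite !exprnP !exprz_exp mulrC. Qed.

(** * Weights of irreducible modules *)

Section ModuleTheory.
Variables (n : nat) (A : 'M[int]_n) (s : 'I_n -> nat).
Hypothesis s_gt0 : forall i, (0 < s i)%N.
Hypothesis A_diag : forall i, A i i = 2.
Hypothesis A_nondeg : forall mu : 'rV[rat]_n, (forall i, pairing A i mu = 0) -> mu = 0.
Variables (V : lmodType Qq) (M : uq_module A s V).
Hypothesis irrM : irreducible M.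

Lemma pairingD i (mu nu : 'rV[rat]_n) : pairing A i (mu + nu) = pairing A i mu + pairing A i nu.
Proof. by rewrite /pairing -big_split /=; apply: eq_bigr => j _; rewrite mxE mulrDr. Qed.

Lemma pairingN i (mu : 'rV[rat]_n) : pairing A i (- mu) = - pairing A i mu.
Proof. by rewrite /pairing -sumrN; apply: eq_bigr => j _; rewrite mxE mulrN. Qed.

Lemma pairing_alpha i j : pairing A i (alpha j) = (A i j)%:~R.
Proof.
rewrite /pairing (bigD1 j) //= big1 ?addr0 => [|k kj].
  by rewrite mxE !eqxx mulr1.
by rewrite mxE (negbTE kj) andbF mulr0.
Qed.

(* As [weight_vector], but the zero vector is allowed. *)
Definition in_weight_space (mu : 'rV[rat]_n) (v : V) : Prop :=
  forall i, exists2 m : int, pairing A i mu = m%:~R & opT M i v = q ^ m *: v.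

Lemma in_weight_spaceE mu v i (m : int) : in_weight_space mu v -> pairing A i mu = m%:~R ->
  opT M i v = q ^ m *: v.
Proof.
move=> /(_ i)[m' -> hv] /eqP; rewrite eqr_int => /eqP <-; exact: hv.
Qed.

Lemma in_weight_space_T' mu v i (m : int) : in_weight_space mu v -> pairing A i mu = m%:~R ->
  opT' M i v = q ^ (- m) *: v.
Proof.
move=> wv hm; have := T'_T M i v; rewrite (in_weight_spaceE wv hm) linearZ /= => h.
by rewrite -[in RHS]h scalerA -expfzDr ?q_neq0 // addNr scale1r.
Qed.

Lemma in_weight_space_int mu v i : in_weight_space mu v ->
  {m : int | pairing A i mu = m%:~R}.
Proof. by move=> wv; apply: cid; have [m hm _] := wv i; exists m. Qed.

Lemma weight_F mu v j : in_weight_space mu v -> in_weight_space (mu - alpha j) (opF M j v).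
Proof.
move=> wv i; have [m hm Tv] := wv i; exists (m - A i j).
  by rewrite pairingD pairingN pairing_alpha hm intrB.
by rewrite T_F Tv linearZ /= scalerA -expfzDr ?q_neq0 // addrC.
Qed.

Lemma weight_E mu v j : in_weight_space mu v -> in_weight_space (mu + alpha j) (opE M j v).
Proof.
move=> wv i; have [m hm Tv] := wv i; exists (m + A i j).
  by rewrite pairingD pairing_alpha hm intrD.
by rewrite T_E Tv linearZ /= scalerA -expfzDr ?q_neq0 // addrC.
Qed.

Lemma weight_iter_F mu v j k : in_weight_space mu v ->
  in_weight_space (mu - alpha j *+ k) (iter k (opF M j) v).
Proof.
move=> wv; elim: k => [|k IH]; first by rewrite mulr0n subr0.
by rewrite mulrS opprD addrCA addrC; exact: weight_F.
Qed.

Lemma weight_iter_E mu v j k : in_weight_space mu v ->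
  in_weight_space (mu + alpha j *+ k) (iter k (opE M j) v).
Proof.
move=> wv; elim: k => [|k IH]; first by rewrite mulr0n addr0.
by rewrite mulrS addrCA addrC; exact: weight_E.
Qed.

Lemma iter_scale (f : {linear V -> V}) (c : Qq) v k : f v = c *: v ->
  iter k f v = c ^+ k *: v.
Proof.
move=> fv; elim: k => [|k IH]; first by rewrite scale1r.
by rewrite iterS IH linearZ /= fv scalerA exprSr.
Qed.

Lemma iter_linear0 (f : {linear V -> V}) k : iter k f 0 = 0.
Proof. by elim: k => //= k ->; rewrite linear0. Qed.

Lemma iter_linearP (f : {linear V -> V}) a u v k :
  iter k f (a *: u + v) = a *: iter k f u + iter k f v.
Proof. by elim: k => //= k ->; rewrite linearP. Qed.

(** The quantum integer [m] at q^(s_i): the scalar by which the commutator of E_i and F_i acts on a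
    vector whose weight pairs to m with h_i. *)
Definition K_coef (i : 'I_n) (m : int) : Qq :=
  (q ^+ s i - q ^- s i)^-1 * qnum (q ^+ s i) m.

Lemma E_F_weight mu v i (m : int) : in_weight_space mu v -> pairing A i mu = m%:~R ->
  opE M i (opF M i v) = opF M i (opE M i v) + K_coef i m *: v.
Proof.
move=> wv hm; have := E_F M i i v; rewrite eqxx => /(canRL (subrK _)) ->.
rewrite addrC (iter_scale _ (in_weight_spaceE wv hm)).
rewrite (iter_scale _ (in_weight_space_T' wv hm)) -scalerBl scalerA.
by rewrite /K_coef /qnum !exprz_expn.
Qed.

Lemma qnum_q_neq0 i k : k != 0 -> qnum (q ^+ s i) k != 0.
Proof. by apply: contra => /eqP/(qnum_eq0 (s_gt0 i)) ->. Qed.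

(** Here it matters that q is not a root of unity: the factor [k + 1] never vanishes, so only p = k
    does. *)
Lemma K_coef_sum i (p : int) (k : nat) :
  (\sum_(l < k.+1) K_coef i (p - 2 * l%:Z) == 0) = (p == k%:Z).
Proof.
by apply: sum_quantum_eq0; [rewrite expf_neq0 ?q_neq0 | exact: qnum_q_neq0].
Qed.

Lemma K_coefN i m : K_coef i (- m) = - K_coef i m.
Proof. by rewrite /K_coef /qnum opprK -mulrN opprB. Qed.

Lemma pairing_iter mu i (p : int) k : pairing A i mu = p%:~R ->
  pairing A i (mu - alpha i *+ k) = (p - 2 * k%:Z)%:~R.
Proof.
move=> hp; rewrite pairingD pairingN hp; elim: k => [|k IH].
  by rewrite mulr0n mulr0 /pairing big1 => [|j _]; rewrite ?subr0 // mxE mulr0.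
rewrite mulrS pairingD opprD addrCA IH pairing_alpha A_diag.
by rewrite -intrN -intrD; congr (_%:~R); lia.
Qed.

Lemma pairing_iterE mu i (p : int) k : pairing A i mu = p%:~R ->
  pairing A i (mu + alpha i *+ k) = (p + 2 * k%:Z)%:~R.
Proof.
move=> hp; have := @pairing_iter (- mu) i (- p) k.
rewrite pairingN hp -intrN => /(_ erefl).
rewrite -opprD pairingN => /(canRL opprK) ->; rewrite -intrN; congr (_%:~R); lia.
Qed.

Lemma E_iter_F mu v i (p : int) k : in_weight_space mu v -> pairing A i mu = p%:~R ->
  opE M i v = 0 ->
  opE M i (iter k.+1 (opF M i) v) =
  (\sum_(l < k.+1) K_coef i (p - 2 * l%:Z)) *: iter k (opF M i) v.
Proof.
move=> wv hp Ev; elim: k => [|k IH].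
  by rewrite big_ord1 /= (E_F_weight wv hp) Ev linear0 add0r mulr0 subr0.
rewrite iterS (E_F_weight (weight_iter_F i k.+1 wv) (pairing_iter k.+1 hp)).
by rewrite IH linearZ /= -scalerDl [in RHS]big_ord_recr.
Qed.

(** The mirror image of [E_iter_F]: exchanging E and F negates the pairing. *)
Lemma F_iter_E mu v i (p : int) k : in_weight_space mu v -> pairing A i mu = p%:~R ->
  opF M i v = 0 ->
  opF M i (iter k.+1 (opE M i) v) =
  (\sum_(l < k.+1) K_coef i (- p - 2 * l%:Z)) *: iter k (opE M i) v.
Proof.
have FE mu' u (m : int) : in_weight_space mu' u -> pairing A i mu' = m%:~R ->
    opF M i (opE M i u) = opE M i (opF M i u) + K_coef i (- m) *: u.
  by move=> wu hm; rewrite (E_F_weight wu hm) K_coefN scaleNr addrK.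
move=> wv hp Fv; elim: k => [|k IH].
  by rewrite big_ord1 /= (FE _ _ _ wv hp) Fv linear0 add0r mulr0 subr0.
rewrite iterS (FE _ _ _ (weight_iter_E i k.+1 wv) (pairing_iterE k.+1 hp)).
rewrite IH linearZ /= -scalerDl [in RHS]big_ord_recr /=.
by congr (_ *: _); congr (_ + K_coef i _); lia.
Qed.

(** If F^(k+1) v were zero, applying E would return a multiple of F^k v whose coefficient is nonzero
    for k < p. *)
Lemma iter_F_neq0 mu v i (p k : nat) : in_weight_space mu v -> pairing A i mu = p%:R ->
  opE M i v = 0 -> v != 0 -> (k <= p)%N -> iter k (opF M i) v != 0.
Proof.
move=> wv hp Ev v0; elim: k => [//|k IH] kp.
apply: contra (IH (ltnW kp)) => /eqP Fv0.
have := E_iter_F (p := p%:Z) k wv hp Ev; rewrite Fv0 linear0 => /esym/eqP.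
by rewrite scaler_eq0 K_coef_sum => /orP[/eqP[pk]|//]; lia.
Qed.

Lemma iter_E_neq0 mu v i (p k : nat) : in_weight_space mu v -> pairing A i mu = - p%:R ->
  opF M i v = 0 -> v != 0 -> (k <= p)%N -> iter k (opE M i) v != 0.
Proof.
move=> wv hp Ev v0; elim: k => [//|k IH] kp.
apply: contra (IH (ltnW kp)) => /eqP Fv0.
have hp' : pairing A i mu = (- p%:Z)%:~R by rewrite hp intrN.
have := F_iter_E k wv hp' Ev; rewrite Fv0 linear0 => /esym/eqP.
by rewrite scaler_eq0 opprK K_coef_sum => /orP[/eqP[pk]|//]; lia.
Qed.

(** Monomials in the F_j applied to v0, with their weights recorded, so that every weight of the
    module can be read off a monomial. *)
Inductive F_word (mu0 : 'rV[rat]_n) (v0 : V) : 'rV[rat]_n -> V -> Prop :=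
| F_word_nil : F_word mu0 v0 mu0 v0
| F_word_cons mu v j : F_word mu0 v0 mu v ->
    F_word mu0 v0 (mu - alpha j) (opF M j v).

Inductive F_span (mu0 : 'rV[rat]_n) (v0 : V) : V -> Prop :=
| F_span0 : F_span mu0 v0 0
| F_spanD a mu w u : F_word mu0 v0 mu w -> F_span mu0 v0 u ->
    F_span mu0 v0 (a *: w + u).

Lemma F_word_weight mu0 v0 mu v : in_weight_space mu0 v0 ->
  F_word mu0 v0 mu v -> in_weight_space mu v.
Proof. by move=> w0; elim=> // *; exact: weight_F. Qed.

Lemma F_word_le mu0 v0 mu v : F_word mu0 v0 mu v ->
  exists c : 'I_n -> nat, mu = mu0 - \sum_j alpha j *+ c j.
Proof.
elim=> [|mu' v' j _ [c ->]].
  by exists (fun _ => 0%N); rewrite big1 ?subr0.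
exists (fun k => c k + (k == j))%N.
rewrite [in RHS](eq_bigr (fun k => alpha k *+ c k + alpha k *+ (k == j))); last first.
  by move=> k _; rewrite mulrnDr.
rewrite big_split /= opprD addrA; congr (_ + - _).
rewrite (bigD1 j) //= eqxx mulr1n big1 ?addr0 // => k /negbTE ->.
by rewrite mulr0n.
Qed.

Lemma F_span_lin mu0 v0 a u v : F_span mu0 v0 u -> F_span mu0 v0 v ->
  F_span mu0 v0 (a *: u + v).
Proof.
move=> hu hv; elim: hu => [|b mu w u' hw _ IH]; first by rewrite scaler0 add0r.
by rewrite scalerDr -addrA scalerA; apply: F_spanD hw IH.
Qed.

Lemma F_span_word mu0 v0 mu w a : F_word mu0 v0 mu w -> F_span mu0 v0 (a *: w).
Proof. by move=> hw; rewrite -[_ *: _]addr0; apply: F_spanD hw (F_span0 _ _). Qed.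

Lemma F_span_F mu0 v0 i v : F_span mu0 v0 v -> F_span mu0 v0 (opF M i v).
Proof.
elim=> [|a mu w u hw _ IH]; first by rewrite linear0; exact: F_span0.
by rewrite linearP; apply: F_spanD (F_word_cons i hw) IH.
Qed.

(** E_i is moved to the right through a monomial by its commutator with F_j, whose value on a weight
    vector is a scalar, until it reaches v0 and kills it. *)
Lemma F_span_submodule mu0 v0 : in_weight_space mu0 v0 -> (forall i, opE M i v0 = 0) ->
  submodule M (F_span mu0 v0 : set V).
Proof.
move=> w0 E0; split=> [|a u v|i v hv]; [exact: F_span0|exact: F_span_lin|].
have Ew mu w : F_word mu0 v0 mu w -> F_span mu0 v0 (opE M i w).
  elim=> [|nu w' j hw IH]; first by rewrite E0; exact: F_span0.
  have := E_F M i j w'; case: eqVneq => [<-|_] /(canRL (subrK _)) ->.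
    have [m hm _] := F_word_weight w0 hw i.
    rewrite (iter_scale _ (in_weight_spaceE (F_word_weight w0 hw) hm)).
    rewrite (iter_scale _ (in_weight_space_T' (F_word_weight w0 hw) hm)).
    rewrite -scalerBl scalerA; apply: F_spanD hw _; exact: F_span_F.
  by rewrite add0r; exact: F_span_F.
have lin f : (forall mu w, F_word mu0 v0 mu w -> F_span mu0 v0 (f w)) ->
    linear f -> F_span mu0 v0 (f v).
  move=> hf lf; elim: hv => [|a mu w u hw _ IH].
    have := lf 1 0 0; rewrite !scale1r addr0 => /eqP.
    rewrite -subr_eq subrr => /eqP <-; exact: F_span0.
  by rewrite lf; apply: F_span_lin => //; exact: hf hw.
split; first by apply: (lin (opE M i)) => //; exact: linearP.
- exact: F_span_F.
- apply: (lin (opT M i)) => [mu w hw|]; last exact: linearP.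
  have [m hm ->] := F_word_weight w0 hw i; exact: F_span_word hw.
apply: (lin (opT' M i)) => [mu w hw|]; last exact: linearP.
have [m hm _] := F_word_weight w0 hw i.
rewrite (in_weight_space_T' (F_word_weight w0 hw) hm); exact: F_span_word hw.
Qed.

Lemma F_span_full mu0 v0 : in_weight_space mu0 v0 -> (forall i, opE M i v0 = 0) ->
  v0 != 0 -> forall v, F_span mu0 v0 v.
Proof.
move=> w0 E0 v0N v; have [_ /(_ _ (F_span_submodule w0 E0))[h|h]] := irrM.
  have : (F_span mu0 v0 : set V) v0.
    rewrite -[X in F_span _ _ X](scale1r v0).
    exact: F_span_word (F_word_nil _ _).
  by rewrite h => /eqP; rewrite (negbTE v0N).
by have : (F_span mu0 v0 : set V) v by rewrite h.
Qed.

(** Linear independence of distinct weight spaces: some h_i separates the first weight of the list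
    from mu, and T_i - q^a removes that summand, preserves all weight spaces and rescales v by a
    nonzero factor. *)
Lemma weight_sum_eq0 (l : seq ('rV[rat]_n * V)) mu v :
  in_weight_space mu v ->
  (forall p, p \in l -> p.1 != mu /\ in_weight_space p.1 p.2) ->
  v = \sum_(p <- l) p.2 -> v = 0.
Proof.
have [k] := ubnP (size l); elim: k l v => // k IH [|[nu w] l] v /=.
  by move=> _ _ _ ->; rewrite big_nil.
rewrite ltnS => lk wv hl vE.
have [|nuN wnu] := hl (nu, w); first by rewrite inE eqxx.
have [i iN] : exists i, pairing A i nu != pairing A i mu.
  apply: contrapT => h; case/negP: nuN; rewrite -subr_eq0; apply/eqP/A_nondeg => i.
  rewrite pairingD pairingN; apply/eqP; rewrite subr_eq0.
  by apply: contrapT => /negP hi; apply: h; exists i.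
have [a ha Tw] := wnu i; have [b hb Tv] := wv i.
have qN : q ^ b - q ^ a != 0.
  by apply: contra iN; rewrite subr_eq0 ha hb => /eqP/q_expz_inj ->.
have stab lam (u : V) : in_weight_space lam u -> in_weight_space lam (opT M i u - q ^ a *: u).
  move=> wu j; have [m hm Tu] := wu j; exists m => //.
  by rewrite linearB linearZ /= T_T Tu linearZ /= scalerBr !scalerA mulrC.
pose U u : V := opT M i u - q ^ a *: u.
have : U v = 0.
  apply: (IH [seq (p.1, U p.2) | p <- l]); first by rewrite size_map.
  - exact: stab.
  - move=> _ /mapP[[lam u] pl ->] /=.
    have [|/= h1 h2] := hl (lam, u); first by rewrite inE pl orbT.
    by split=> //; exact: stab.
  rewrite big_map /U vE big_cons linearD Tw /= scalerDr opprD addrACA subrr add0r.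
  by rewrite linear_sum scaler_sumr -sumrB.
by rewrite /U Tv -scalerBl => /eqP; rewrite scaler_eq0 (negbTE qN) => /eqP.
Qed.

Lemma weight_F_word mu0 v0 mu v : in_weight_space mu0 v0 -> (forall i, opE M i v0 = 0) ->
  v0 != 0 -> in_weight_space mu v -> v != 0 -> exists w, F_word mu0 v0 mu w.
Proof.
move=> w0 E0 v0N wv vN; apply: contrapT => hN.
have [l hl vE] : exists2 l : seq ('rV[rat]_n * V),
    (forall p, p \in l -> p.1 != mu /\ in_weight_space p.1 p.2) &
    v = \sum_(p <- l) p.2.
  elim: (F_span_full w0 E0 v0N v) => [|a nu w u hw _ [l hl ->]].
    by exists [::]; rewrite ?big_nil.
  exists ((nu, a *: w) :: l); last by rewrite big_cons.
  move=> p; rewrite inE => /orP[/eqP -> /=|/hl //]; split.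
    by apply/eqP => h; apply: hN; exists w; rewrite -h.
  by move=> i; have [m hm Tw] := F_word_weight w0 hw i; exists m => //;
    rewrite linearZ /= Tw !scalerA mulrC.
by move: vN; rewrite (weight_sum_eq0 wv hl vE) eqxx.
Qed.

Lemma weight_le mu0 v0 mu v : in_weight_space mu0 v0 -> (forall i, opE M i v0 = 0) ->
  v0 != 0 -> in_weight_space mu v -> v != 0 ->
  exists c : 'I_n -> nat, mu = mu0 - \sum_j alpha j *+ c j.
Proof.
by move=> w0 E0 v0N wv vN; have [w /F_word_le] := weight_F_word w0 E0 v0N wv vN.
Qed.

Lemma sum_alpha_coord (c : 'I_n -> nat) k : (\sum_j alpha j *+ c j) 0 k = (c k)%:R.
Proof.
rewrite summxE (bigD1 k) //= big1 ?addr0 => [|j jk].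
  by rewrite mulmxnE mxE !eqxx.
by rewrite mulmxnE mxE eq_sym (negbTE jk) andbF mul0rn.
Qed.

(** Each of the two weights lies below the other. *)
Lemma highest_weight_unique mu0 v0 mu1 v1 :
  in_weight_space mu0 v0 -> (forall i, opE M i v0 = 0) -> v0 != 0 ->
  in_weight_space mu1 v1 -> (forall i, opE M i v1 = 0) -> v1 != 0 -> mu1 = mu0.
Proof.
move=> w0 E0 N0 w1 E1 N1.
have [c0 h0] := weight_le w0 E0 N0 w1 N1.
have [c1 h1] := weight_le w1 E1 N1 w0 N0.
apply/rowP => k; have := congr1 (fun x : 'rV_n => x 0 k) h0.
have := congr1 (fun x : 'rV_n => x 0 k) h1.
rewrite !mxE !sum_alpha_coord => e1 e0.
have : (c0 k + c1 k)%:R = 0 :> rat by rewrite natrD -(addrC (c1 k)%:R) -[RHS](subrr (mu0 0 k)) {2}e1 e0; ring.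
by move/eqP; rewrite pnatr_eq0 addn_eq0 e0 => /andP[/eqP-> _]; rewrite subr0.
Qed.

Definition nilpotent_at (f : V -> V) (v : V) : Prop := exists N, iter N f v = 0.

Lemma nilpotent_at_lin (f : {linear V -> V}) a u v :
  nilpotent_at f u -> nilpotent_at f v -> nilpotent_at f (a *: u + v).
Proof.
move=> [k hk] [l hl]; exists (k + l)%N; rewrite iter_linearP.
by rewrite {1}addnC !iterD hk hl !iter_linear0 scaler0 addr0.
Qed.

Lemma nilpotent_at_sum (f : {linear V -> V}) (I : Type) (r : seq I) (P : pred I) c (F : I -> V) :
  (forall k, P k -> nilpotent_at f (F k)) ->
  nilpotent_at f (\sum_(k <- r | P k) c k *: F k).
Proof.
move=> hF; elim: r => [|k r IH]; first by rewrite big_nil; exists 0%N.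
by rewrite big_cons; case: ifP => // Pk; apply: nilpotent_at_lin => //; exact: hF.
Qed.

Lemma qfact_neq0 i m : qfact (q ^+ s i) m != 0.
Proof.
rewrite /qfact prodf_seq_neq0; apply/allP => k _ /=; rewrite /qint.
rewrite mulf_neq0 ?invr_eq0 //; last by rewrite -qnumE1; exact: qnum_q_neq0.
exact: (qnum_q_neq0 i (k := k.+1)).
Qed.

Lemma qbinom0 i m : qbinom (q ^+ s i) m 0 = 1.
Proof. by rewrite /qbinom subn0 [qfact _ 0]big_ord0 mul1r divff // qfact_neq0. Qed.

(** Induction on the order to which F_i is nilpotent at v, by means of the Serre relation. *)
Lemma nilpotent_at_F i j v : i != j -> nilpotent_at (opF M i) v ->
  nilpotent_at (opF M i) (opF M j v).
Proof.
move=> ij [N]; elim: N v => [|N IH] v /= hv.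
  by exists 0%N; rewrite /= hv linear0.
have {hv} hk k : (0 < k)%N -> iter N (opF M i) (iter k (opF M i) v) = 0.
  by case: k => // k _; rewrite -iterD addnS -addSn addnC iterD iterS hv iter_linear0.
(* The k = 0 term of the relation is F_i^m F_j v with coefficient 1. All other terms contain F_j
   F_i^k v with k > 0, to which the induction hypothesis applies. *)
have := serre_F M ij v; set m := absz _.
rewrite big_ord_recl /= expr0 mul1r qbinom0 scale1r subn0 => /eqP; rewrite addr_eq0 => /eqP hm.
suff [K hK] : nilpotent_at (opF M i) (iter m (opF M i) (opF M j v)).
  by exists (K + m)%N; rewrite iterD.
rewrite hm -scaleN1r -[_ *: _]addr0; apply: nilpotent_at_lin; last by exists 0%N.
apply: nilpotent_at_sum => k _.
have [K hK] := IH _ (hk (bump 0 k) isT).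
exists K; rewrite -iterD addnC iterD hK; exact: iter_linear0.
Qed.

Variables (theta : 'rV[rat]_n) (v0 : V).
Hypothesis wt_v0 : in_weight_space theta v0.
Hypothesis E_v0 : forall i, opE M i v0 = 0.
Hypothesis v0_neq0 : v0 != 0.
Hypothesis theta_dominant : forall i, 0 <= pairing A i theta.

(** The Serre relations reduce this to v0. With p = <h_i, theta>, the vector F_i^(p+1) v0 is killed
    by every E_j, so by uniqueness of the highest weight it must be zero. *)
Lemma nilpotent_F i v : nilpotent_at (opF M i) v.
Proof.
elim: (F_span_full wt_v0 E_v0 v0_neq0 v) => [|a mu w u hw _ IH]; first by exists 0%N.
apply: nilpotent_at_lin IH; elim: hw => [|nu w' j _ hw]; last first.
  case: (eqVneq i j) => [<-|ij]; last exact: nilpotent_at_F.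
  by have [N hN] := hw; exists N; rewrite -iterSr iterS hN linear0.
have [p hp] := in_weight_space_int i wt_v0.
have p0 : 0 <= p by have := theta_dominant i; rewrite hp ler0z.
exists `|p|.+1; apply/eqP; apply: contrapT => /negP hN.
have := highest_weight_unique wt_v0 E_v0 v0_neq0 (weight_iter_F i `|p|.+1 wt_v0) _ hN.
move=> h; suff /h/(congr1 (fun x : 'rV_n => x 0 i)) : forall j, opE M j (iter `|p|.+1 (opF M i) v0) = 0.
  rewrite !mxE mulmxnE mxE !eqxx => /eqP; rewrite -subr_eq0 addrAC subrr add0r oppr_eq0.
  by rewrite pnatr_eq0.
move=> j; case: (eqVneq j i) => [->|ji].
  rewrite (E_iter_F _ wt_v0 hp (E_v0 i)).
  have /eqP -> : \sum_(l < `|p|.+1) K_coef i (p - 2 * l%:Z) == 0.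
    by rewrite K_coef_sum gez0_abs.
  exact: scale0r.
elim: (`|p|.+1) => [|k IH] //=.
have := E_F M j i (iter k (opF M i) v0); rewrite (negbTE ji) => /eqP.
by rewrite subr_eq0 => /eqP ->; rewrite IH linear0.
Qed.

Lemma weight_le_theta mu v : in_weight_space mu v -> v != 0 ->
  exists c : 'I_n -> nat, mu = theta - \sum_j alpha j *+ c j.
Proof. exact: weight_le. Qed.

(** Each application of E_i raises coordinate i by one, and the weights are bounded above by
    theta. *)
Lemma nilpotent_E i mu v : in_weight_space mu v -> nilpotent_at (opE M i) v.
Proof.
move=> wv; apply: contrapT => hN.
have [vN|vN] := eqVneq v 0; first by apply: hN; exists 0%N.
have [c hc] := weight_le_theta wv vN.
have kN : iter (c i).+1 (opE M i) v != 0 by apply/eqP => h; apply: hN; exists (c i).+1.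
have [c' hc'] := weight_le_theta (weight_iter_E i (c i).+1 wv) kN.
have := congr1 (fun x : 'rV_n => x 0 i) hc'.
rewrite hc !mxE !sum_alpha_coord mulmxnE mxE !eqxx /= => e.
have : ((c' i).+1)%:R = 0 :> rat.
  rewrite -(subrr (c' i)%:R) -natr1.
  have -> : (c' i)%:R = theta 0 i - (theta 0 i - (c i)%:R + (c i).+1%:R) by rewrite e; ring.
  by rewrite -(natr1 (c i)); ring.
by move/eqP; rewrite pnatr_eq0.
Qed.

Lemma last_nonzero_iter (f : V -> V) v : nilpotent_at f v -> v != 0 ->
  exists m, iter m f v != 0 /\ f (iter m f v) = 0.
Proof.
move=> [N hN] vN; have ex : exists N, iter N f v == 0 by exists N; apply/eqP.
case: (ex_minnP ex) => -[|m] /eqP h min; first by rewrite /= in h; rewrite h eqxx in vN.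
by exists m; split=> //; apply/negP => /min; rewrite ltnn.
Qed.

(** Climb m steps to the top of the i-string, where the pairing is p + 2m, and descend t + m steps;
    this stays inside the nonzero range since t <= p. *)
Lemma string_down mu v i (p : int) (t : nat) : in_weight_space mu v -> v != 0 ->
  pairing A i mu = p%:~R -> t%:Z <= p ->
  exists2 w, in_weight_space (mu - alpha i *+ t) w & w != 0.
Proof.
move=> wv vN hp tp; have [m [mN Em]] := last_nonzero_iter (nilpotent_E i wv) vN.
have w1 := weight_iter_E i m wv.
have h1 : pairing A i (mu + alpha i *+ m) = (`|p| + 2 * m)%N%:R.
  by rewrite (pairing_iterE m hp) (_ : p + 2 * m%:Z = (`|p| + 2 * m)%N%:Z) //; lia.
exists (iter (t + m) (opF M i) (iter m (opE M i) v)).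
  have := weight_iter_F i (t + m) w1.
  by rewrite mulrnDr opprD addrACA subrr addr0.
by apply: (iter_F_neq0 w1 h1 Em mN); lia.
Qed.

Lemma string_up mu v i (p : int) (t : nat) : in_weight_space mu v -> v != 0 ->
  pairing A i mu = p%:~R -> p <= - t%:Z ->
  exists2 w, in_weight_space (mu + alpha i *+ t) w & w != 0.
Proof.
move=> wv vN hp tp; have [m [mN Em]] := last_nonzero_iter (nilpotent_F i v) vN.
have w1 := weight_iter_F i m wv.
have h1 : pairing A i (mu - alpha i *+ m) = - (`|p| + 2 * m)%N%:R.
  by rewrite (pairing_iter m hp) (_ : p - 2 * m%:Z = - (`|p| + 2 * m)%N%:Z) ?mulrNz //; lia.
exists (iter (t + m) (opE M i) (iter m (opF M i) v)).
  have := weight_iter_E i (t + m) w1.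
  by rewrite mulrnDr addrACA addNr addr0.
by apply: (iter_E_neq0 w1 h1 Em mN); lia.
Qed.

Lemma raise_weight mu v : in_weight_space mu v -> v != 0 -> mu != theta ->
  exists i w, in_weight_space (mu + alpha i) w /\ w != 0.
Proof.
move=> wv vN muN; apply: contrapT => hN; case/negP: muN; apply/eqP.
apply: (highest_weight_unique wt_v0 E_v0 v0_neq0 (wv) _ vN) => i.
apply: contrapT => /eqP EN; apply: hN; exists i, (opE M i v); split=> //.
exact: weight_E.
Qed.

End ModuleTheory.

(** * Root lengths and tree structure of the affine diagrams *)

Definition sqlen (X : affine_type) (j : nat) : nat :=
  match X with
  | A1 _ | D1 _ | E6_1 | E7_1 | E8_1 => 1
  | B1 n => if j == n then 1 else 2
  | C1 n => if (j == 0) || (j == n) then 2 else 1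
  | F4_1 => nth 1 [:: 2; 2; 2] j
  | G2_1 => nth 1 [:: 3; 3] j
  | Aeven2 n => if j == 0 then 1 else if j == n then 4 else 2
  | Aodd2 n => if j == n then 2 else 1
  | D2 n => if (j == 0) || (j == n) then 1 else 2
  | E6_2 => nth 2 [:: 1; 1; 1] j
  | D4_3 => nth 3 [:: 1; 1] j
  end%N.

(* The Dynkin diagram is a tree rooted at vertex 0, except that one edge at 0
   is dropped for A_n^(1). *)
Definition parent (X : affine_type) (k : nat) : nat :=
  match X with
  | B1 _ | Aodd2 _ => if k == 1 then 2 else if k == 2 then 0 else k.-1
  | D1 n => if k == 1 then 2 else if k == 2 then 0 else if k == n then n.-2 else k.-1
  | E6_1 => nth 0 [:: 0; 3; 0; 4; 2; 4; 5] k
  | E7_1 => nth 0 [:: 0; 0; 4; 1; 3; 4; 5; 6] k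
  | E8_1 => nth 0 [:: 0; 3; 4; 4; 5; 6; 7; 8; 0] k
  | _ => k.-1
  end%N.

Definition depth (X : affine_type) (k : nat) : nat :=
  match X with
  | B1 _ | Aodd2 _ | D1 _ => if k == 1 then 3 else k
  | E6_1 => nth 0 [:: 0; 4; 1; 3; 2; 3; 4] k
  | E7_1 => nth 0 [:: 0; 1; 4; 2; 3; 4; 5; 6] k
  | E8_1 => nth 0 [:: 0; 7; 6; 6; 5; 4; 3; 2; 1] k
  | _ => k
  end%N.

Definition balanced (r : nat -> nat) (e : edge) : bool :=
  let: (a, b, p, t) := e in r a * p == r b * t.

Lemma all_chainP (P : pred edge) k m :
  reflect (forall i, k <= i < m -> P (simple_edge i i.+1))%N (all P (chain k m)).
Proof.
apply: (iffP allP) => h.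
  move=> i hi; apply/h/(map_f (fun i => simple_edge i i.+1)); rewrite mem_iota; lia.
by move=> e /mapP[i]; rewrite mem_iota => hi ->; apply: h; lia.
Qed.

(** This is r_a a_ab = r_b a_ba on every edge, so [sqlen] is half the squared length of a simple
    root. Vertex 0 is included because its value is half the squared length of theta. *)
Lemma edges_balanced X : in_range X -> all (balanced (sqlen X)) (edges X).
Proof.
have ch r k m : (forall i, k <= i < m -> r i = r i.+1)%N -> all (balanced r) (chain k m).
  by move=> h; apply/all_chainP => i /h; rewrite /= => ->.
case: X => [n|n|n|n||||||n|n|n||] hX; try by vm_compute.
all: move: hX => /= hX.
1: by case: ifP => // _; rewrite /= ch.
4: case: eqP => [-> //|n1].
all: by rewrite /= all_rcons ch /= ?andbT => [|i hi]; repeat (case: ifP => ?); lia.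
Qed.

Lemma edge_entry_balanced (r : nat -> nat) e i j : i != j -> balanced r e ->
  (r i * edge_entry i j e = r j * edge_entry j i e)%N.
Proof.
case: e => [[[a b] p] t] /= /eqP ij /eqP h.
case: (eqVneq a i) => [ai|_]; case: (eqVneq b j) => [bj|_];
  case: (eqVneq b i) => [bi|_]; case: (eqVneq a j) => [aj|_] //=;
  rewrite ?muln0 //; try (by case: ij; congruence).
all: by subst.
Qed.

Lemma cartan_sym X i j : in_range X ->
  (sqlen X i)%:Z * cartan_entry X i j = (sqlen X j)%:Z * cartan_entry X j i.
Proof.
move=> hX; rewrite /cartan_entry [j == i]eq_sym; case: eqVneq => [-> //|ij].
rewrite !mulrN -!PoszM !big_distrr /= !big_seq; congr (- Posz _).
by apply: eq_bigr => e /(allP (edges_balanced hX)); exact: edge_entry_balanced.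
Qed.

Lemma cartan_offdiag X i j : i != j -> cartan_entry X i j <= 0.
Proof. by rewrite /cartan_entry => /negbTE->; rewrite oppr_le0. Qed.

Lemma edge_cartan_neq0 X i j p t : in_range X -> i != j -> (0 < p)%N -> (0 < t)%N ->
  ((i, j, p, t) \in edges X) || ((j, i, p, t) \in edges X) -> cartan_entry X i j < 0.
Proof.
move=> hX ij p0 t0 he; rewrite /cartan_entry (negbTE ij) oppr_lt0 ltz_nat.
have [e hin hpos] : exists2 e, e \in edges X & (0 < edge_entry i j e)%N.
  case/orP: he => he; [exists (i, j, p, t) => // | exists (j, i, p, t) => //].
    by rewrite /= !eqxx.
  by rewrite /= !eqxx eq_sym (negbTE ij).
by rewrite (big_rem e) //= addn_gt0 hpos.
Qed.

Lemma mem_chain i k m : (k <= i < m)%N -> (i, i.+1, 1, 1)%N \in chain k m.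
Proof. by move=> hi; apply/(map_f (fun i => simple_edge i i.+1)); rewrite mem_iota; lia. Qed.

Lemma parent_edge X k : in_range X -> (1 <= k <= rank X)%N ->
  exists p t, [/\ (0 < p)%N, (0 < t)%N &
    ((k, parent X k, p, t) \in edges X) || ((parent X k, k, p, t) \in edges X)].
Proof.
have up a b m : (a <= b < m)%N -> forall k', k' = b.+1 -> (k'.-1, k', 1, 1)%N \in chain a m.
  by move=> h k' ->; exact: mem_chain.
case: X => [n|n|n|n||||||n|n|n||] hX hk.
all: try by move: hk; rewrite /=; do 9 (try case: k => [|k]); move=> // _;
  first [by exists 1%N, 1%N | by exists 1%N, 2%N | by exists 2%N, 1%N
        | by exists 1%N, 3%N | by exists 3%N, 1%N].
all: move: hX hk => /= hX hk.
- case: (eqVneq n 1%N) => [n1|n1]; first by exists 2%N, 2%N; rewrite (_ : k = 1%N) //; lia.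
  by exists 1%N, 1%N; rewrite !inE (up 0 k.-1)%N ?orbT //; lia.
- case: (eqVneq k 1%N) => [->|k1].
    by exists 1%N, 1%N; rewrite !inE !mem_rcons !inE (@mem_chain 1) ?orbT //; lia.
  case: (eqVneq k 2%N) => [->|k2]; first by exists 1%N, 1%N; rewrite /= !inE ?eqxx ?orbT.
  case: (eqVneq k n) => [->|kn]; first by exists 1%N, 2%N; rewrite !inE !mem_rcons !inE ?eqxx ?orbT.
  by exists 1%N, 1%N; rewrite !inE !mem_rcons !inE (up 1 k.-1)%N ?orbT //; lia.
- case: (eqVneq k 1%N) => [->|k1]; first by exists 1%N, 2%N; rewrite !inE ?eqxx ?orbT.
  case: (eqVneq k n) => [->|kn]; first by exists 2%N, 1%N; rewrite !inE !mem_rcons !inE ?eqxx ?orbT.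
  by exists 1%N, 1%N; rewrite !inE !mem_rcons !inE (up 1 k.-1)%N ?orbT //; lia.
- case: (eqVneq k 1%N) => [->|k1].
    by exists 1%N, 1%N; rewrite !inE !mem_rcons !inE (@mem_chain 1) ?orbT //; lia.
  case: (eqVneq k 2%N) => [->|k2]; first by exists 1%N, 1%N; rewrite /= !inE ?eqxx ?orbT.
  case: (eqVneq k n) => [->|kn].
    by exists 1%N, 1%N; rewrite !inE !mem_rcons !inE ?eqxx ?orbT.
  by exists 1%N, 1%N; rewrite !inE !mem_rcons !inE (up 1 k.-1)%N ?orbT //; lia.
- case: (eqVneq n 1%N) => [n1|n1]; first by exists 4%N, 1%N; rewrite (_ : k = 1%N) //; lia.
  case: (eqVneq k 1%N) => [->|k1]; first by exists 2%N, 1%N; rewrite !inE ?eqxx ?orbT.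
  case: (eqVneq k n) => [->|kn]; first by exists 2%N, 1%N; rewrite !inE !mem_rcons !inE ?eqxx ?orbT.
  by exists 1%N, 1%N; rewrite !inE !mem_rcons !inE (up 1 k.-1)%N ?orbT //; lia.
- case: (eqVneq k 1%N) => [->|k1].
    by exists 1%N, 1%N; rewrite !inE !mem_rcons !inE (@mem_chain 1) ?orbT //; lia.
  case: (eqVneq k 2%N) => [->|k2]; first by exists 1%N, 1%N; rewrite /= !inE ?eqxx ?orbT.
  case: (eqVneq k n) => [->|kn]; first by exists 2%N, 1%N; rewrite !inE !mem_rcons !inE ?eqxx ?orbT.
  by exists 1%N, 1%N; rewrite !inE !mem_rcons !inE (up 1 k.-1)%N ?orbT //; lia.
- case: (eqVneq k 1%N) => [->|k1]; first by exists 2%N, 1%N; rewrite !inE ?eqxx ?orbT.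
  case: (eqVneq k n) => [->|kn]; first by exists 1%N, 2%N; rewrite !inE !mem_rcons !inE ?eqxx ?orbT.
  by exists 1%N, 1%N; rewrite !inE !mem_rcons !inE (up 1 k.-1)%N ?orbT //; lia.
Qed.

Lemma depth_parent X k : in_range X -> (1 <= k <= rank X)%N ->
  (parent X k <= rank X)%N /\ (depth X (parent X k) < depth X k)%N.
Proof.
case: X => [n|n|n|n||||||n|n|n||] hX hk.
all: try by move: hk; rewrite /=; do 9 (try case: k => [|k]).
all: by move: hX hk => /= hX hk; repeat case: ifP => ?; rewrite /=; lia.
Qed.

Lemma parent_cartan X k : in_range X -> (1 <= k <= rank X)%N ->
  cartan_entry X k (parent X k) < 0.
Proof.
move=> hX hk; have [p [t [p0 t0 he]]] := parent_edge hX hk.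
apply: (edge_cartan_neq0 hX _ p0 t0 he).
by apply/eqP => h; have [_] := depth_parent hX hk; rewrite -h ltnn.
Qed.

(** * A positivity criterion for symmetric forms with nonpositive off-diagonal entries *)

Section PositiveForm.
Variables (n : nat) (B : 'I_n -> 'I_n -> rat) (d : 'I_n -> rat).
Hypothesis B_sym : forall i j, B i j = B j i.
Hypothesis B_offdiag : forall i j, i != j -> B i j <= 0.
Hypothesis d_gt0 : forall i, 0 < d i.
Hypothesis Bd_ge0 : forall i, 0 <= \sum_j B i j * d j.

(** Rescaling the variables by a positive vector d with B d >= 0 exhibits the form as a sum of
    squares with nonnegative coefficients. In the application d consists of the marks, and B d >= 0
    comes from the null root. *)
Lemma form_sum_squares (y : 'I_n -> rat) :
  2 * (\sum_i \sum_j B i j * (d i * y i) * (d j * y j)) =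
  2 * (\sum_i d i * (\sum_j B i j * d j) * y i ^+ 2) +
  \sum_i \sum_j (- B i j * d i * d j) * (y i - y j) ^+ 2.
Proof.
pose S (f : rat -> rat -> rat) := \sum_i \sum_j B i j * d i * d j * f (y i) (y j).
have SE f : S f = S (fun a b => f b a).
  rewrite /S exchange_big /=; apply: eq_bigr => i _; apply: eq_bigr => j _.
  by rewrite B_sym; ring.
have -> : \sum_i \sum_j B i j * (d i * y i) * (d j * y j) = S (fun a b => a * b).
  by apply: eq_bigr => i _; apply: eq_bigr => j _; ring.
have -> : \sum_i d i * (\sum_j B i j * d j) * y i ^+ 2 = S (fun a b => a ^+ 2).
  apply: eq_bigr => i _; rewrite mulr_sumr mulr_suml.
  by apply: eq_bigr => j _; ring.
have -> : \sum_i \sum_j (- B i j * d i * d j) * (y i - y j) ^+ 2 =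
    2 * S (fun a b => a * b) - S (fun a b => a ^+ 2) - S (fun a b => b ^+ 2).
  rewrite /S mulr_sumr -!sumrB; apply: eq_bigr => i _.
  by rewrite mulr_sumr -!sumrB; apply: eq_bigr => j _; ring.
rewrite -[S (fun a b => b ^+ 2)](SE (fun a b => a ^+ 2)).
by move: (S _) (S _) => u v; ring.
Qed.

Lemma form_terms_ge0 (y : 'I_n -> rat) i j :
  0 <= (- B i j * d i * d j) * (y i - y j) ^+ 2.
Proof.
have [->|ij] := eqVneq i j; first by rewrite subrr expr0n mulr0.
apply: mulr_ge0 (sqr_ge0 _); apply: mulr_ge0 (ltW (d_gt0 j)).
by apply: mulr_ge0 (ltW (d_gt0 i)); rewrite oppr_ge0 B_offdiag.
Qed.

Lemma form_diag_ge0 (y : 'I_n -> rat) i : 0 <= d i * (\sum_j B i j * d j) * y i ^+ 2.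
Proof. by rewrite mulr_ge0 ?sqr_ge0 // mulr_ge0 // ltW. Qed.

Lemma form_ge0 (x : 'I_n -> rat) : 0 <= \sum_i \sum_j B i j * x i * x j.
Proof.
pose y i := x i / d i; have xE i : x i = d i * y i by rewrite mulrC divfK ?gt_eqF.
under eq_bigr => i _ do under eq_bigr => j _ do rewrite (xE i) (xE j).
rewrite -(pmulr_rge0 _ (ltr0n rat 2)) form_sum_squares.
apply: addr_ge0; first apply: mulr_ge0 => //.
  by apply: sumr_ge0 => i _; exact: form_diag_ge0.
by do 2 (apply: sumr_ge0 => ? _); exact: form_terms_ge0.
Qed.

Variables (par : 'I_n -> option 'I_n) (dep : 'I_n -> nat).
Hypothesis par_edge : forall i j, par i = Some j -> B i j < 0 /\ (dep j < dep i)%N.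
Hypothesis par_root : forall i, par i = None -> 0 < \sum_j B i j * d j.

(** All squares vanish, so y is constant along the tree edges and zero at the tree roots, where B d
    is positive. Induction on the depth spreads the zero over the whole tree. *)
Lemma form_eq0 (x : 'I_n -> rat) : \sum_i \sum_j B i j * x i * x j = 0 -> forall i, x i = 0.
Proof.
pose y i := x i / d i; have xE i : x i = d i * y i by rewrite mulrC divfK ?gt_eqF.
move=> h; have := form_sum_squares y.
have -> : \sum_i \sum_j B i j * (d i * y i) * (d j * y j) = \sum_i \sum_j B i j * x i * x j.
  by apply: eq_bigr => i _; apply: eq_bigr => j _; rewrite -!xE.
rewrite h mulr0 => /esym/eqP.
have s1 : 0 <= \sum_i d i * (\sum_j B i j * d j) * y i ^+ 2.
  by apply: sumr_ge0 => i _; exact: form_diag_ge0.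
have s2 : 0 <= \sum_i \sum_j (- B i j * d i * d j) * (y i - y j) ^+ 2.
  by do 2 (apply: sumr_ge0 => ? _); exact: form_terms_ge0.
rewrite paddr_eq0 ?mulr_ge0 // mulf_eq0 pnatr_eq0 /= => /andP[h1 h2].
have {h1} e1 i : d i * (\sum_j B i j * d j) * y i ^+ 2 = 0.
  exact: (psumr_eq0P (fun i _ => form_diag_ge0 y i) (eqP h1)).
have {h2} e2 i j : (- B i j * d i * d j) * (y i - y j) ^+ 2 = 0.
  have : \sum_j (- B i j * d i * d j) * (y i - y j) ^+ 2 = 0.
    have ge0 k : true -> 0 <= \sum_j (- B k j * d k * d j) * (y k - y j) ^+ 2.
      by move=> _; apply: sumr_ge0 => l _; exact: form_terms_ge0.
    exact: (psumr_eq0P ge0 (eqP h2)).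
  by move=> e; exact: (psumr_eq0P (fun j _ => form_terms_ge0 y i j) e).
suff y0 i : y i = 0 by move=> i; rewrite xE y0 mulr0.
have [k] := ubnP (dep i); elim: k i => // k IH i; rewrite ltnS => ik.
case hp: (par i) => [j|].
  have [Bij dji] := par_edge hp.
  have /eqP := e2 i j; rewrite mulf_eq0 sqrf_eq0 subr_eq0.
  have /gt_eqF-> : 0 < - B i j * d i * d j by rewrite !mulr_gt0 ?oppr_gt0.
  by move=> /eqP ->; apply: IH; apply: leq_trans ik.
have /eqP := e1 i; rewrite mulf_eq0 sqrf_eq0.
have /gt_eqF-> : 0 < d i * (\sum_j B i j * d j) by rewrite mulr_gt0 ?par_root.
by move/eqP.
Qed.

End PositiveForm.

(** * Roots *)

Definition simple (n : nat) (i : 'I_n) : 'rV[int]_n := delta_mx 0 i.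

Definition pairz (n : nat) (A : 'M[int]_n) (i : 'I_n) (v : 'rV[int]_n) : int :=
  \sum_j A i j * v 0 j.

Definition gram (n : nat) (A : 'M[int]_n) (r : 'I_n -> nat) (u v : 'rV[int]_n) : int :=
  \sum_i u 0 i * ((r i)%:Z * pairz A i v).

(** For (v,v) = 2m this says that the coroot 2v/(v,v) is integral: since alpha_i is r_i times its
    coroot, the coordinates of v/m in the simple coroots are r_i v_i / m. *)
Definition long_div (n : nat) (r : 'I_n -> nat) (m : nat) (v : 'rV[int]_n) : Prop :=
  forall i, (m%:Z %| (r i)%:Z * v 0%R i)%Z.

(* Squared lengths are normalised so that short simple roots have length 2; the
   weights of the crystal have length 2 or [2 * m]. *)
Record root_datum (n : nat) (A : 'M[int]_n) (r : 'I_n -> nat) (m : nat)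
    (th : 'rV[int]_n) : Prop := RootDatum {
  rd_diag : forall i, A i i = 2;
  rd_off : forall i j, i != j -> A i j <= 0;
  rd_sym : forall i j, (r i)%:Z * A i j = (r j)%:Z * A j i;
  rd_pos : forall v, v != 0 -> 0 < gram A r v v;
  rd_r : forall i, (0 < r i <= 3)%N;
  rd_m : (0 < m <= 3)%N;
  rd_pair : forall i j, i != j -> (maxn (r i) (maxn (r j) m) <= 2)%N \/
    [/\ ((r i == 1) && (r j == 3)) || ((r i == 3) && (r j == 1)), m != 2 & A i j != 0]%N;
  rd_norm : gram A r th th = 2 * m%:Z;
  rd_div : long_div r m th;
  rd_dom : forall i, 0 <= pairz A i th;
  rd_thpos : forall i, 0 < th 0 i;
  rd_m3 : m = 3%N -> forall v, gram A r v v != 4;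
  rd_conn : forall Q : 'I_n -> Prop, (exists2 j, r j = m & Q j) ->
    (forall j k, Q j -> j != k -> A j k != 0 -> (r k <= r j)%N -> Q k) ->
    forall k, (r k == 1) || (r k == m)%N -> Q k
}.

Record weight_set (n : nat) (A : 'M[int]_n) (th : 'rV[int]_n) (L : 'rV[int]_n -> Prop) : Prop :=
  WeightSet {
  ws_th : L th;
  ws_le : forall v, L v -> forall i, v 0 i <= th 0 i;
  ws_down : forall v i (t : nat), L v -> t%:Z <= pairz A i v -> L (v - t%:Z *: simple i);
  ws_up : forall v i (t : nat), L v -> pairz A i v <= - t%:Z -> L (v + t%:Z *: simple i);
  ws_raise : forall v, L v -> v != th -> exists i, L (v + simple i)
}.

(** By symmetry the off-diagonal entries come in equal pairs, which supplies the factor 2. *)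
Lemma dvdz_sum_sym (n : nat) (C : 'I_n -> 'I_n -> int) (d : int) :
  (forall i j, C i j = C j i) -> (forall i j, (d %| C i j)%Z) ->
  (forall i, (2 * d %| C i i)%Z) -> (2 * d %| \sum_i \sum_j C i j)%Z.
Proof.
move=> Cs Cd Cdd; pose S := \sum_(i < n) \sum_(j < n | (j < i)%N) C i j.
have SE : S = \sum_(i < n) \sum_(j < n | (i < j)%N) C i j.
  rewrite /S (exchange_big_dep xpredT) //=; apply: eq_bigr => i _.
  by apply: eq_bigr => j _; exact: Cs.
have -> : \sum_i \sum_j C i j = \sum_i C i i + 2 * S.
  rewrite mulrDl !mul1r {2}SE -!big_split /=.
  apply: eq_bigr => i _; rewrite (bigD1 i) //=; congr (_ + _).
  rewrite (bigID (fun j : 'I_n => j < i)%N) /=; congr (_ + _); apply: eq_bigl => j;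
    by rewrite -(inj_eq val_inj) /=; case: ltngtP.
apply: rpredD.
  by apply: rpred_sum => i _; exact: Cdd.
rewrite dvdz_mul2l //=; apply: rpred_sum => i _; apply: rpred_sum => j _; exact: Cd.
Qed.

(** * The invariant form and the simple reflections *)

Section Form.
Variables (n : nat) (A : 'M[int]_n) (r : 'I_n -> nat).
Hypothesis A_diag : forall i, A i i = 2.
Hypothesis A_sym : forall i j, (r i)%:Z * A i j = (r j)%:Z * A j i.
Local Notation gram := (gram A r).
Local Notation pairz := (pairz A).

Lemma pairzD i u v : pairz i (u + v) = pairz i u + pairz i v.
Proof. by rewrite /pairz -big_split; apply: eq_bigr => j _; rewrite mxE mulrDr. Qed.

Lemma pairzZ i a v : pairz i (a *: v) = a * pairz i v.
Proof. by rewrite /pairz mulr_sumr; apply: eq_bigr => j _; rewrite mxE mulrCA. Qed.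

Lemma pairz0 i : pairz i 0 = 0.
Proof. by rewrite -(scale0r 0) pairzZ mul0r. Qed.

Lemma pairzN i v : pairz i (- v) = - pairz i v.
Proof. by rewrite -scaleN1r pairzZ mulN1r. Qed.

Lemma pairz_simple i j : pairz i (simple j) = A i j.
Proof.
rewrite /pairz (bigD1 j) //= big1 ?addr0 => [|k kj].
  by rewrite mxE !eqxx mulr1.
by rewrite mxE (negbTE kj) andbF mulr0.
Qed.

Lemma gramDr u v w : gram u (v + w) = gram u v + gram u w.
Proof. by rewrite /gram -big_split; apply: eq_bigr => i _; rewrite pairzD !mulrDr. Qed.

Lemma gramZr u a v : gram u (a *: v) = a * gram u v.
Proof. by rewrite /gram mulr_sumr; apply: eq_bigr => i _; rewrite pairzZ; ring. Qed.

Lemma gram_sym u v : gram u v = gram v u.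
Proof.
rewrite /gram /pairz.
under eq_bigr => i _ do rewrite mulr_sumr mulr_sumr.
under [RHS]eq_bigr => i _ do rewrite mulr_sumr mulr_sumr.
rewrite exchange_big; apply: eq_bigr => i _; apply: eq_bigr => j _.
rewrite (_ : _ * _ = (r j)%:Z * A j i * (u 0 j * v 0 i)); last by ring.
by rewrite A_sym; ring.
Qed.

Lemma gramDl u v w : gram (u + v) w = gram u w + gram v w.
Proof. by rewrite ![gram _ w]gram_sym gramDr. Qed.

Lemma gramZl a u v : gram (a *: u) v = a * gram u v.
Proof. by rewrite ![gram _ v]gram_sym gramZr. Qed.

Lemma gramNr u v : gram u (- v) = - gram u v.
Proof. by rewrite -scaleN1r gramZr mulN1r. Qed.

Lemma gramNl u v : gram (- u) v = - gram u v.
Proof. by rewrite -scaleN1r gramZl mulN1r. Qed.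

Lemma gram_simple i v : gram (simple i) v = (r i)%:Z * pairz i v.
Proof.
rewrite /gram (bigD1 i) //= big1 ?addr0 => [|k ki].
  by rewrite mxE !eqxx mul1r.
by rewrite mxE (negbTE ki) andbF mul0r.
Qed.

Lemma gram_simple_simple i : gram (simple i) (simple i) = 2 * (r i)%:Z.
Proof. by rewrite gram_simple pairz_simple A_diag mulrC. Qed.

Definition refl i (v : 'rV[int]_n) := v - pairz i v *: simple i.

Lemma gram_refl i v : gram (refl i v) (refl i v) = gram v v.
Proof.
rewrite /refl gramDl !gramDr !gramNl !gramNr gramZl !gramZr gramZl gram_simple_simple.
by rewrite [gram v (simple i)]gram_sym gram_simple; ring.
Qed.

Lemma reflK i : involutive (refl i).
Proof.
move=> v; rewrite /refl pairzD pairzN pairzZ pairz_simple A_diag.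
by rewrite (_ : _ - _ * 2 = - pairz i v) ?scaleNr ?opprK ?subrK //; ring.
Qed.

Lemma reflN i v : refl i (- v) = - refl i v.
Proof. by rewrite /refl pairzN scaleNr opprD. Qed.

(** The summands r_i v_i A_ij v_j are symmetric in i and j and divisible by m, and A_ii = 2. Hence
    2m is the least possible norm of a nonzero vector satisfying [long_div]. *)
Lemma gram_div m v : (0 < m)%N -> long_div r m v -> (2 * m%:Z %| gram v v)%Z.
Proof.
move=> m0 hv.
have -> : gram v v = \sum_i \sum_j ((r i)%:Z * v 0 i) * A i j * v 0 j.
  apply: eq_bigr => i _; rewrite /pairz !mulr_sumr; apply: eq_bigr => j _; ring.
apply: dvdz_sum_sym => [i j|i j|i].
- have := A_sym i j; move: (v 0 i) (v 0 j) (A i j) (A j i) (r i)%:Z (r j)%:Z => a b c d e f h.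
  by have -> : e * a * c * b = (e * c) * (a * b); [ring | rewrite h; ring].
- by rewrite -mulrA dvdz_mulr // hv.
by rewrite A_diag mulrAC -mulrA [_ * 2]mulrC mulrA dvdz_mulr // mulrC dvdz_mul2l //= hv.
Qed.

Lemma gram_even v : (2 %| gram v v)%Z.
Proof. by rewrite -[2]mulr1; apply: (@gram_div 1) => // i; rewrite dvd1z. Qed.

Lemma long_div_refl m i v : long_div r m v -> long_div r m (refl i v).
Proof.
move=> hv j; rewrite !mxE /= mulrBr; apply: rpredB; first exact: hv.
have [ji|ji] := eqVneq j i; last by rewrite !mulr0 dvdz0.
rewrite mulr1 ji /pairz mulr_sumr; apply: rpred_sum => k _.
by rewrite mulrA A_sym mulrAC; apply: dvdz_mulr; exact: hv.
Qed.

End Form.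

(** * Identification of the nonzero weights with the roots *)

Section Roots.
Variables (n : nat) (A : 'M[int]_n) (r : 'I_n -> nat) (m : nat) (th : 'rV[int]_n).
Hypothesis D : root_datum A r m th.
Local Notation gram := (gram A r).
Local Notation pairz := (pairz A).
Local Notation refl := (refl A).

Let A_diag := rd_diag D.
Let A_sym := rd_sym D.

Definition is_root (v : 'rV[int]_n) : Prop :=
  gram v v = 2 \/ (gram v v = 2 * m%:Z /\ long_div r m v).

Lemma gram_ge0z v : 0 <= gram v v.
Proof.
have [->|/(rd_pos D)/ltW //] := eqVneq v 0.
by rewrite /Submission.gram big1 // => i _; rewrite mxE mul0r.
Qed.

Lemma gram00 : gram 0 0 = 0.
Proof. by rewrite /Submission.gram big1 // => i _; rewrite mxE mul0r. Qed.

Lemma gram_eq0z v : gram v v = 0 -> v = 0.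
Proof. by move=> h; apply/eqP; apply: contrapT => /negP/(rd_pos D); rewrite h ltxx. Qed.

Lemma m_gt0 : (0 < m)%N. Proof. by case/andP: (rd_m D). Qed.

Lemma root_neq0 v : is_root v -> v != 0.
Proof.
move=> h; apply/eqP => v0; move: h; rewrite v0 /is_root gram00.
by have := m_gt0; move=> ? [|[]]; lia.
Qed.

Lemma root_refl i v : is_root v -> is_root (refl i v).
Proof.
move=> [h|[h h']]; [left|right; split]; rewrite ?gram_refl //.
exact: long_div_refl.
Qed.

Lemma root_opp v : is_root v -> is_root (- v).
Proof.
have e : gram (- v) (- v) = gram v v by rewrite (gramNl A_sym) gramNr opprK.
by rewrite /is_root e => -[|[h h']]; [left|right; split=> // i; rewrite mxE mulrN rpredN].
Qed.

Lemma gram_ge2 v : v != 0 -> 2 <= gram v v.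
Proof. by move=> /(rd_pos D); have /dvdzP[k ->] := gram_even A_diag A_sym v; lia. Qed.

Lemma gram_ge_div v : v != 0 -> long_div r m v -> 2 * m%:Z <= gram v v.
Proof.
move=> /(rd_pos D) h hv; have /dvdzP[k hk] := gram_div A_diag A_sym m_gt0 hv.
have m2 : 0 < 2 * m%:Z by have := m_gt0; lia.
move: h; rewrite hk pmulr_lgt0 // => k0; apply: ler_peMl; [exact: ltW | lia].
Qed.

Definition pos_part (v : 'rV[int]_n) : 'rV[int]_n := \row_i Num.max (v 0 i) 0.

Lemma pos_partE v : v = pos_part v - pos_part (- v).
Proof.
apply/rowP => i; rewrite !mxE; move: (v 0 i) => a.
by rewrite /Num.max /Order.max; case: ifP => ?; case: ifP => ?; lia.
Qed.

Lemma gram_parts v : gram (pos_part v) (pos_part (- v)) <= 0.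
Proof.
rewrite /Submission.gram; apply: sumr_le0 => i _; rewrite /Submission.pairz !mulr_sumr.
apply: sumr_le0 => j _; rewrite !mxE.
have [<-|ij] := eqVneq i j.
  have e : Num.max (v 0 i) 0 * Num.max (- v 0 i) 0 = 0.
    by rewrite /Num.max /Order.max; case: ifP => h1; case: ifP => h2; rewrite ?mul0r ?mulr0 //; lia.
  by rewrite mulrCA [_ * (A i i * _)]mulrCA e !mulr0.
have := rd_off D ij; have h1 : 0 <= Num.max (v 0 i) 0 by rewrite le_max lexx orbT.
have h2 : 0 <= Num.max (- v 0 j) 0 by rewrite le_max lexx orbT.
move: (Num.max _ _) (Num.max _ _) h1 h2 => x y x0 y0 a0.
apply: mulr_ge0_le0 => //; apply: mulr_ge0_le0 => //; exact: mulr_le0_ge0.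
Qed.

(** Write v = p - q with p, q the positive and negative parts. As (p,q) <= 0, the norm of v is at
    least (p,p) + (q,q). If both parts were nonzero, each would reach the minimal norm of the
    lattice in question (2, or 2m under [long_div], which p and q inherit), so (v,v) would be at
    least twice that. *)
Lemma root_sign v : is_root v -> (forall i, 0 <= v 0 i) \/ (forall i, v 0 i <= 0).
Proof.
move=> hv.
have [p0|pN] := eqVneq (pos_part v) 0.
  right=> i; have := congr1 (fun x : 'rV[int]_n => x 0 i) p0; rewrite !mxE => <-.
  by rewrite le_max lexx.
have [q0|qN] := eqVneq (pos_part (- v)) 0.
  left=> i; have := congr1 (fun x : 'rV[int]_n => x 0 i) q0; rewrite !mxE => e.
  by rewrite -oppr_le0 -e le_max lexx.
have e : gram v v = gram (pos_part v) (pos_part v) + gram (pos_part (- v)) (pos_part (- v))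
    - 2 * gram (pos_part v) (pos_part (- v)).
  rewrite {1 2}(pos_partE v) (gramDl A_sym) !gramDr !(gramNl A_sym) !gramNr.
  by rewrite [gram (pos_part (- v)) (pos_part v)](gram_sym A_sym); ring.
have h := gram_parts v; have m0 := m_gt0.
case: hv => [h2|[h2 dv]]; first by have := gram_ge2 pN; have := gram_ge2 qN; lia.
have d1 : long_div r m (pos_part v).
  by move=> i; rewrite mxE /Num.max /Order.max; case: ifP; rewrite ?mulr0 ?dvdz0.
have d2 : long_div r m (pos_part (- v)).
  by move=> i; rewrite !mxE /Num.max /Order.max; case: ifP; rewrite ?mulr0 ?dvdz0 ?mulrN ?rpredN.
by have := gram_ge_div pN d1; have := gram_ge_div qN d2; lia.
Qed.

Definition height (v : 'rV[int]_n) : int := \sum_i v 0 i.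

(** Since (v,v) > 0, some i has v_i > 0 and a positive pairing. The reflection changes coordinate i
    only and is a root, hence has one sign; if it is not nonnegative, then v is a multiple of
    alpha_i. *)
Lemma root_descent v : is_root v -> (forall i, 0 <= v 0 i) ->
  exists2 i, 0 < pairz i v & v = simple i \/
    (forall j, 0 <= refl i v 0 j) /\ height (refl i v) < height v.
Proof.
move=> hv v0; have [i [vi pi]] : exists i, 0 < v 0 i /\ 0 < pairz i v.
  apply: contrapT => h; have := rd_pos D (root_neq0 hv); rewrite ltNge => /negP; apply.
  rewrite {1}/Submission.gram; apply: sumr_le0 => i _.
  have := v0 i; rewrite le_eqVlt => /orP[/eqP <-|vi]; first by rewrite mul0r.
  apply: mulr_ge0_le0 => //; apply: mulr_ge0_le0 => //.
  by rewrite leNgt; apply/negP => pi; apply: h; exists i.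
have hs j : refl i v 0 j = v 0 j - pairz i v * (j == i)%:R by rewrite !mxE.
exists i => //; have [hr|hr] := root_sign (root_refl i hv).
  right; split=> //; rewrite /height -subr_gt0 -sumrB (bigD1 i) //= big1 => [|j ji].
    by rewrite hs eqxx mulr1 addr0; lia.
  by rewrite hs (negbTE ji) mulr0 subr0 subrr.
left; have vE : v = v 0 i *: simple i.
  apply/rowP => j; rewrite !mxE /=; have [->|ji] := eqVneq j i; first by rewrite mulr1.
  by have := hr j; have := v0 j; rewrite hs (negbTE ji) mulr0 subr0; lia.
have e : gram v v = v 0 i ^+ 2 * (2 * (r i)%:Z).
  by rewrite {1 2}vE (gramZl A_sym) gramZr (gram_simple_simple _ A_diag); ring.
suff h : v 0 i = 1 by rewrite vE h scale1r.
move: (rd_r D i) (rd_m D) vi hv e; rewrite /is_root; move: (gram v v) => g.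
move: (v 0 i) (r i) => c ri hri hm c0 hv e.
(* The norm 2 c^2 r_i is 2 or 2m with m <= 3, which excludes c >= 2. *)
have {}hv : c ^+ 2 * ri%:Z <= 3.
  by case: hv => [|[+ _]]; lia.
have [//|c2] : c = 1 \/ 2 <= c by lia.
by rewrite expr2 in hv; nia.
Qed.

Variable L : 'rV[int]_n -> Prop.
Hypothesis W : weight_set A th L.

Lemma L_refl i v : L v -> L (refl i v).
Proof.
move=> Lv; have [p0|p0] := lerP 0 (pairz i v).
  have := ws_down W (i := i) (t := `|pairz i v|%N) Lv.
  by rewrite gez0_abs //; apply.
have := ws_up W (i := i) (t := `|pairz i v|%N) Lv.
by rewrite ltz0_abs // opprK lexx scaleNr; apply.
Qed.

(** The difference of the norms of theta and v is (theta - v, theta) + (theta - v, v); both terms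
    are nonnegative because theta - v has nonnegative coordinates and both vectors are dominant. *)
Lemma L_dominant v : L v -> (forall i, 0 <= pairz i v) ->
  gram v v <= gram th th /\ (gram v v = gram th th -> v = th).
Proof.
move=> Lv dv; have ge0 u : (forall i, 0 <= pairz i u) -> 0 <= gram (th - v) u.
  move=> hu; apply: sumr_ge0 => i _; rewrite !mulr_ge0 // !mxE subr_ge0.
  exact: (ws_le W).
have h1 := ge0 _ (rd_dom D); have h2 := ge0 _ dv.
have e : gram th th - gram v v = gram (th - v) th + gram (th - v) v.
  rewrite !(gramDl A_sym) !(gramNl A_sym) [gram v th](gram_sym A_sym); ring.
split=> [|e']; first by lia.
apply/eqP; rewrite eq_sym -subr_eq0; apply/eqP/gram_eq0z.
rewrite gramDr gramNr; move: h1 h2 e; rewrite e' subrr.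
by move: (gram (th - v) th) (gram (th - v) v) => a b; lia.
Qed.

(** Reflecting at a negative pairing brings v closer to theta, keeping norm and divisibility, until
    v is dominant. *)
Lemma L_bound v : L v -> gram v v <= 2 * m%:Z /\ (gram v v = 2 * m%:Z -> long_div r m v).
Proof.
have [k] := ubnP `|height (th - v)|%N; elim: k v => // k IH v; rewrite ltnS => hk Lv.
have [dv|[i pi]] : (forall i, 0 <= pairz i v) \/ exists i, pairz i v < 0.
- apply: contrapT => h; apply: (h); left=> i; rewrite leNgt; apply/negP => pi.
  by apply: h; right; exists i.
- have [h1 h2] := L_dominant Lv dv; rewrite -(rd_norm D); split=> // /h2 ->; exact: rd_div D.
have [||h1 h2] := IH (refl i v); last first.
- rewrite gram_refl // in h1 h2; split=> // /h2 /(long_div_refl A_sym i).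
  by rewrite reflK.
- exact: L_refl.
apply: leq_trans hk.
have hge u : L u -> 0 <= height (th - u).
  by move=> Lu; apply: sumr_ge0 => j _; rewrite !mxE subr_ge0; exact: (ws_le W).
have := hge _ Lv; have := hge _ (L_refl i Lv).
suff : height (th - refl i v) < height (th - v) by lia.
rewrite /height -subr_gt0 -sumrB (bigD1 i) //= big1 => [|j ji].
  by rewrite !mxE /= !eqxx; lia.
by rewrite !mxE /= (negbTE ji); lia.
Qed.

Lemma L_root v : L v -> v != 0 -> is_root v.
Proof.
move=> /L_bound[h1 h2] v0; have := gram_ge2 v0; have /dvdzP[k hk] := gram_even A_diag A_sym v.
have [e|ne] := eqVneq (gram v v) (2 * m%:Z); first by right; split=> //; exact: h2.
move=> h3; left; have := rd_m D.
(* The norm is even, at least 2 and below 2m, hence equal to 2 unless m = 3. There the value 4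
   remains, and [rd_m3] excludes it. *)
have [m3|m3] := eqVneq m 3%N; last by lia.
by have := rd_m3 D m3 v; lia.
Qed.

Lemma L_simple_of_norm v : L v -> v != 0 -> (forall i, 0 <= v 0 i) ->
  exists2 j, L (simple j) & gram v v = 2 * (r j)%:Z.
Proof.
have [k] := ubnP `|height v|%N; elim: k v => // k IH v; rewrite ltnS => hk Lv vN v0.
have [i pi [vE|[h1 h2]]] := root_descent (L_root Lv vN) v0.
  by exists i; rewrite ?vE ?(gram_simple_simple _ A_diag) -?vE.
have h0 : 0 <= height (refl i v) by apply: sumr_ge0.
have [|||//|j Lj] := IH (refl i v); first by apply: leq_trans hk; lia.
- exact: L_refl.
- apply: contra vN => /eqP h; rewrite -(reflK A_diag i v) h.
  by rewrite /Submission.refl pairz0 scale0r subr0.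
by rewrite gram_refl // => e; exists j.
Qed.

Lemma L_long_simple : exists2 j, r j = m & L (simple j).
Proof.
have thN : th != 0 by apply/root_neq0; right; split; [exact: rd_norm D | exact: rd_div D].
have [j Lj] := L_simple_of_norm (ws_th W) thN (fun i => ltW (rd_thpos D i)).
by rewrite (rd_norm D) => e; exists j => //; lia.
Qed.

(** Here A_jk = -1. The pairing of alpha_j with h_k is negative, so alpha_j + alpha_k is in L, and
    its pairing with h_j is 1, so alpha_j can be subtracted. *)
Lemma L_simple_adjacent j k : L (simple j) -> j != k -> A j k != 0 -> (r k <= r j)%N ->
  L (simple k).
Proof.
move=> Lj jk a0 rkj; have rj := rd_r D j; have rk := rd_r D k.
have h1 := rd_off D jk; have h2 := A_sym j k.
have h3 : 0 < gram (simple j + simple k) (simple j + simple k).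
  apply: (rd_pos D); apply/eqP => /(congr1 (fun x : 'rV[int]_n => x 0 j)).
  by rewrite !mxE !eqxx /= (negbTE jk).
have {h3} ajk : A j k = -1.
  move: h3; rewrite (gramDl A_sym) !gramDr !gram_simple !pairz_simple !A_diag.
  by move: h1 h2 a0; move: (A j k) (A k j) => a b; nia.
have akj : A k j < 0 by rewrite ajk in h2; nia.
have L2 : L (simple j + simple k).
  have := ws_up W (i := k) (t := 1) Lj; rewrite scale1r pairz_simple; apply; lia.
have := ws_down W (i := j) (t := 1) L2; rewrite scale1r [simple j + _]addrC addrK; apply.
by rewrite pairzD !pairz_simple A_diag ajk.
Qed.

Lemma L_simple k : (r k == 1) || (r k == m)%N -> L (simple k).
Proof.
by apply: (rd_conn D (Q := fun k => L (simple k)) L_long_simple) => j l; exact: L_simple_adjacent.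
Qed.

(** Descend to a simple root and reflect back. Treating v and - v together lets the same descent
    serve the negative roots. *)
Lemma root_L_pos v : is_root v -> (forall i, 0 <= v 0 i) -> L v /\ L (- v).
Proof.
have [k] := ubnP `|height v|%N; elim: k v => // k IH v; rewrite ltnS => hk rv v0.
have [i pi [vE|[h1 h2]]] := root_descent rv v0.
  have Li : L (simple i).
    apply: L_simple; move: rv; rewrite vE /is_root (gram_simple_simple _ A_diag).
    by case=> [|[]]; lia.
  rewrite vE; split=> //; have := L_refl i Li; rewrite /Submission.refl pairz_simple A_diag.
  by rewrite scaler_nat mulr2n opprD addrA subrr sub0r.
have [|||L1 L2] := IH (refl i v).
- have h0 : 0 <= height (refl i v) by apply: sumr_ge0.
  by apply: leq_trans hk; lia.
- exact: root_refl.
- by [].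
have := L_refl i L1; have := L_refl i L2.
by rewrite (reflN A) !reflK.
Qed.

Lemma L_iff v : v != 0 -> L v <-> is_root v.
Proof.
move=> vN; split=> [Lv|rv]; first exact: L_root.
case: (root_sign rv) => hv; first by case: (root_L_pos rv hv).
have [|_] := root_L_pos (root_opp rv); last by rewrite opprK.
by move=> i; rewrite mxE oppr_ge0.
Qed.

Lemma root_raise v : is_root v -> v != th -> exists i, v = - simple i \/ is_root (v + simple i).
Proof.
move=> rv vth; have [i Li] := ws_raise W (proj2 (L_iff (root_neq0 rv)) rv) vth.
exists i; have [e|vN] := eqVneq (v + simple i) 0.
  by left; apply/eqP; rewrite -addr_eq0 e.
by right; apply/L_iff.
Qed.

End Roots.

(** * The root datum of each affine type other than A_{2n}^(2) *)

Definition is_Aeven2 (X : affine_type) : bool := if X is Aeven2 _ then true else false.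
Definition is_C1 (X : affine_type) : bool := if X is C1 _ then true else false.
Definition is_D2 (X : affine_type) : bool := if X is D2 _ then true else false.

Lemma finite_cartanE X i j : finite_cartan X i j = cartan_entry X i.+1 j.+1.
Proof. by rewrite !mxE !lift0. Qed.

Definition theta_z (X : affine_type) : 'rV[int]_(rank X) := \row_j (marks X j.+1)%:Z.

Definition sqlen_ord (X : affine_type) (i : 'I_(rank X)) : nat := sqlen X i.+1.

Lemma cartan_diag X i : cartan_entry X i i = 2.
Proof. by rewrite /cartan_entry eqxx. Qed.

Lemma null_row X (i : nat) : in_range X -> (i <= rank X)%N ->
  cartan_entry X i 0 * (marks X 0)%:Z +
  \sum_(j < rank X) cartan_entry X i j.+1 * (marks X j.+1)%:Z = 0.
Proof.
move=> hX hi; have := null_root (Ordinal (hi : i < (rank X).+1)%N) hX.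
rewrite big_ord_recl mxE /= => h; rewrite -[RHS]h; congr (_ + _).
by apply: eq_bigr => j _; rewrite mxE lift0.
Qed.

(** The marks in [theta_z] are those of delta minus d_0 alpha_0, and delta pairs to zero with
    h_i. *)
Lemma pairz_theta X (i : 'I_(rank X)) : in_range X ->
  pairz (finite_cartan X) i (theta_z X) = - cartan_entry X i.+1 0 * (marks X 0)%:Z.
Proof.
move=> hX; have /eqP := null_row hX (ltn_ord i : i.+1 <= rank X)%N.
rewrite addrC addr_eq0 => /eqP h; rewrite mulNr -h /pairz.
by apply: eq_bigr => j _; rewrite finite_cartanE mxE.
Qed.

Lemma sqlen_gt0 X j : (0 < sqlen X j)%N.
Proof.
case: X => [n|n|n|n||||||n|n|n||] //=; repeat case: ifP => //.
all: by do 5 (case: j => [//|j]).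
Qed.

Definition parent_ord X (i : 'I_(rank X)) : option 'I_(rank X) :=
  if parent X i.+1 is p.+1 then insub p else None.

Arguments parent_ord : clear implicits.
Arguments sqlen_ord : clear implicits.

Section Positive.
Variables (X : affine_type) (hX : in_range X).
Let B (i j : 'I_(rank X)) : rat := ((sqlen X i.+1)%:Z * cartan_entry X i.+1 j.+1)%:~R.
Let d (j : 'I_(rank X)) : rat := (marks X j.+1)%:R.

Let B_sym i j : B i j = B j i. Proof. by rewrite /B cartan_sym. Qed.

Let B_offdiag i j : i != j -> B i j <= 0.
Proof.
move=> ij; rewrite /B -[0]/(0%:~R) ler_int mulr_ge0_le0 //; apply: cartan_offdiag.
by rewrite eqSS.
Qed.

Let d_gt0 i : 0 < d i. Proof. by rewrite ltr0n marks_gt0. Qed.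

Let BdE i : \sum_j B i j * d j =
  ((sqlen X i.+1)%:Z * (- cartan_entry X i.+1 0) * (marks X 0)%:Z)%:~R.
Proof.
rewrite -mulrA -pairz_theta // /pairz mulr_sumr rmorph_sum /=; apply: eq_bigr => j _.
by rewrite /B /d finite_cartanE mxE -[(marks _ _)%:R]/((marks X j.+1)%:Z%:~R) -intrM mulrA.
Qed.

Let Bd_ge0 i : 0 <= \sum_j B i j * d j.
Proof. by rewrite BdE ler0z !mulr_ge0 // oppr_ge0 cartan_offdiag. Qed.

Let range i : (1 <= (i : 'I_(rank X)).+1 <= rank X)%N. Proof. by rewrite /= ltn_ord. Qed.

Let parent_ordE i : match parent_ord X i with
  | Some j => parent X i.+1 = j.+1 | None => parent X i.+1 = 0%N end.
Proof.
rewrite /parent_ord; have [hp _] := depth_parent hX (range i).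
case e: (parent X i.+1) => [//|p]; rewrite e in hp.
by rewrite insubT.
Qed.

Let par_edge i j : parent_ord X i = Some j ->
  B i j < 0 /\ (depth X j.+1 < depth X i.+1)%N.
Proof.
have := parent_ordE i => /[swap] -> e.
have [_] := depth_parent hX (range i); rewrite e => hd; split=> //.
have := parent_cartan hX (range i); rewrite e => hc.
by rewrite /B ltrz0 pmulr_rlt0 // ltz_nat sqlen_gt0.
Qed.

Let par_root i : parent_ord X i = None -> 0 < \sum_j B i j * d j.
Proof.
have := parent_ordE i => /[swap] -> e; rewrite BdE ltr0z.
have := parent_cartan hX (range i); rewrite e => hc.
by rewrite !mulr_gt0 ?oppr_gt0 // ltz_nat ?sqlen_gt0 ?marks_gt0.
Qed.

Lemma cartan_nondeg (mu : 'rV[rat]_(rank X)) :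
  (forall i, pairing (finite_cartan X) i mu = 0) -> mu = 0.
Proof.
move=> h; apply/rowP => i; rewrite mxE.
apply: (form_eq0 B_sym B_offdiag d_gt0 Bd_ge0 (@par_edge) (@par_root) (x := fun i => mu 0 i)).
rewrite big1 // => k _.
rewrite (eq_bigr (fun j => (sqlen X k.+1)%:R * mu 0 k * ((finite_cartan X k j)%:~R * mu 0 j))).
  by rewrite -mulr_sumr [X in _ * X]h mulr0.
by move=> j _; rewrite /B finite_cartanE intrM; ring.
Qed.

Lemma gram_pos (v : 'rV[int]_(rank X)) : v != 0 ->
  0 < gram (finite_cartan X) (sqlen_ord X) v v.
Proof.
have e : \sum_i \sum_j B i j * (v 0 i)%:~R * (v 0 j)%:~R =
    (gram (finite_cartan X) (sqlen_ord X) v v)%:~R :> rat.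
  rewrite /gram rmorph_sum; apply: eq_bigr => i _ /=.
  rewrite /pairz !mulr_sumr rmorph_sum; apply: eq_bigr => j _ /=.
  by rewrite /B finite_cartanE /sqlen_ord !intrM; ring.
have ge0 : 0 <= gram (finite_cartan X) (sqlen_ord X) v v.
  rewrite -(ler0z rat) -e; exact: form_ge0.
rewrite lt_neqAle ge0 andbT eq_sym; apply: contra => /eqP h.
apply/eqP/rowP => i; rewrite mxE.
have := form_eq0 B_sym B_offdiag d_gt0 Bd_ge0 (@par_edge) (@par_root)
  (x := fun i => (v 0 i)%:~R).
by rewrite e -h => /(_ erefl i)/eqP; rewrite intr_eq0 => /eqP.
Qed.

End Positive.

Lemma sqlen_le3 X j : ~~ is_Aeven2 X -> (sqlen X j <= 3)%N.
Proof.
case: X => [n|n|n|n||||||n|n|n||] //= _; repeat case: ifP => //.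
all: by do 5 (case: j => [//|j]).
Qed.

Lemma sqlen_div_marks X j : in_range X -> ~~ is_Aeven2 X -> (1 <= j <= rank X)%N ->
  (sqlen X 0 %| sqlen X j * marks X j)%N.
Proof.
case: X => [n|n|n|n||||||n|n|n||] //= hX _ hj; rewrite ?dvd1n //.
all: try by repeat case: ifP => //; lia.
all: by move: hj; do 5 (try case: j => [|j]).
Qed.

(* For D_{n+1}^(2) the parent of the only short simple root is long. *)
Lemma sqlen_parent X k : in_range X -> ~~ is_Aeven2 X -> ~~ is_D2 X -> (1 <= k <= rank X)%N ->
  (sqlen X k == sqlen X 0) || is_C1 X -> parent X k != 0%N ->
  (sqlen X (parent X k) <= sqlen X k)%N && ((sqlen X (parent X k) == sqlen X 0) || is_C1 X).
Proof.
case: X => [n|n|n|n||||||n|n|n||] //= hX _ _ hk.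
all: try by repeat case: ifP => ?; lia.
all: by move: hk; do 9 (try case: k => [|k]).
Qed.

Lemma sqlen_parent_down X k : in_range X -> ~~ is_Aeven2 X -> ~~ is_D2 X ->
  (1 <= k <= rank X)%N -> ~~ (is_C1 X && (sqlen X k == 2)) ->
  (sqlen X k == 1) || (sqlen X k == sqlen X 0) -> parent X k != 0%N ->
  (sqlen X k <= sqlen X (parent X k))%N &&
  ((sqlen X (parent X k) == 1) || (sqlen X (parent X k) == sqlen X 0)) &&
  ~~ (is_C1 X && (sqlen X (parent X k) == 2)).
Proof.
case: X => [n|n|n|n||||||n|n|n||] //= hX _ _ hk.
all: try by repeat case: ifP => ?; lia.
all: by move: hk; do 9 (try case: k => [|k]).
Qed.

Definition neighbour0 (X : affine_type) : nat :=
  match X with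
  | B1 _ | D1 _ | Aodd2 _ | E6_1 => 2 | E8_1 => 8 | _ => 1
  end%N.

Lemma parent_eq0 X k : in_range X -> (1 <= k <= rank X)%N -> parent X k = 0%N ->
  k = neighbour0 X.
Proof.
case: X => [n|n|n|n||||||n|n|n||] //= hX hk.
all: try by repeat case: ifP => ?; lia.
all: by move: hk; do 9 (try case: k => [|k]).
Qed.

(** These are the cases in which the length condition singles out vertex n, so that nothing has to
    be propagated. *)
Lemma sqlen_unique X k l : in_range X -> is_D2 X || is_C1 X && (sqlen X k == 2) ->
  (1 <= k <= rank X)%N -> (1 <= l <= rank X)%N ->
  (sqlen X k == 1) || (sqlen X k == sqlen X 0) ->
  sqlen X l = sqlen X 0 -> k = l.
Proof.
case: X => [n|n|n|n||||||n|n|n||] //= hX; try by rewrite ?andbF.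
all: by repeat case: ifP => ?; lia.
Qed.

(** Q passes to a neighbour whose root is not longer. In the tree rooted at 0 it climbs from the
    given vertex to the child of the root through which all paths go, and descends from there to k;
    the lengths along the way allow this outside the cases of [sqlen_unique]. *)
Lemma simple_propagation X (Q : nat -> Prop) : in_range X -> ~~ is_Aeven2 X ->
  (exists j, [/\ (1 <= j <= rank X)%N, sqlen X j = sqlen X 0 & Q j]) ->
  (forall j k, (1 <= j <= rank X)%N -> (1 <= k <= rank X)%N -> Q j -> j != k ->
    cartan_entry X j k != 0 -> (sqlen X k <= sqlen X j)%N -> Q k) ->
  forall k, (1 <= k <= rank X)%N -> (sqlen X k == 1) || (sqlen X k == sqlen X 0) -> Q k.
Proof.
move=> hX hA [j0 [hj0 sj0 Qj0]] prop k hk ok.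
have [sp|] := boolP (is_D2 X || is_C1 X && (sqlen X k == 2)).
  by rewrite (sqlen_unique hX sp hk hj0 ok sj0).
rewrite negb_or => /andP[nD nC].
have rng l : (1 <= l <= rank X)%N -> parent X l != 0%N -> (1 <= parent X l <= rank X)%N.
  by move=> hl h0; have [h1 _] := depth_parent hX hl; rewrite lt0n h0.
have ne l : (1 <= l <= rank X)%N -> l != parent X l.
  by move=> hl; apply/eqP => e; have [_] := depth_parent hX hl; rewrite -e ltnn.
have sym_neq0 a b : cartan_entry X a b != 0 -> cartan_entry X b a != 0.
  have := cartan_sym a b hX; have := sqlen_gt0 X a; have := sqlen_gt0 X b.
  by move: (cartan_entry X a b) (cartan_entry X b a) => x y; nia.
have up : Q (neighbour0 X).
  have {k hk ok nC} [k [hk okk Qk]] : exists k, [/\ (1 <= k <= rank X)%N,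
      (sqlen X k == sqlen X 0) || is_C1 X & Q k].
    by exists j0; rewrite sj0 eqxx.
  have [d] := ubnP (depth X k); elim: d k hk okk Qk => // d IH k hk okk Qk; rewrite ltnS => hd.
  have [p0|p0] := eqVneq (parent X k) 0%N; first by rewrite -(parent_eq0 hX hk p0).
  have /andP[h1 h2] := sqlen_parent hX hA nD hk okk p0.
  have [_ hdp] := depth_parent hX hk.
  apply: (IH (parent X k)) => //; [exact: rng| |exact: leq_trans hd].
  apply: (prop k) => //; [exact: rng|exact: ne|].
  by rewrite lt_eqF // parent_cartan.
have [d] := ubnP (depth X k); elim: d k hk ok nC => // d IH k hk ok nC; rewrite ltnS => hd.
have [p0|p0] := eqVneq (parent X k) 0%N; first by rewrite (parent_eq0 hX hk p0).
have /andP[/andP[h1 h2] h3] := sqlen_parent_down hX hA nD hk nC ok p0.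
have [_ hdp] := depth_parent hX hk.
apply: (prop (parent X k)) => //; [exact: rng| | |].
- by apply: IH => //; [exact: rng|exact: leq_trans hd].
- by rewrite eq_sym ne.
by apply: sym_neq0; rewrite lt_eqF // parent_cartan.
Qed.

(** For d_0 = 1, theta is - alpha_0 modulo the null root, so it has the length of alpha_0. *)
Lemma gram_theta X : in_range X -> ~~ is_Aeven2 X ->
  gram (finite_cartan X) (sqlen_ord X) (theta_z X) (theta_z X) = 2 * (sqlen X 0)%:Z.
Proof.
move=> hX hA; have m0 : (marks X 0)%:Z = 1 by rewrite marks0 //; case: X hA {hX}.
have := null_row hX (leq0n _); rewrite m0 mulr1 cartan_diag => /eqP.
rewrite addrC addr_eq0 => /eqP h.
rewrite mulrC -[2]opprK -h mulrN mulr_sumr -sumrN; apply: eq_bigr => i _.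
rewrite pairz_theta // m0 mulr1 mxE /sqlen_ord [_%:Z * - _]mulrN cartan_sym //.
by ring.
Qed.

Definition is_G2_type (X : affine_type) : bool :=
  match X with G2_1 | D4_3 => true | _ => false end.

Lemma sqlen_le2 X j : ~~ is_Aeven2 X -> ~~ is_G2_type X -> (sqlen X j <= 2)%N.
Proof.
case: X => [n|n|n|n||||||n|n|n||] //= _ _; repeat case: ifP => //.
all: by do 5 (try case: j => [|j]).
Qed.

Lemma affine_root_datum X : in_range X -> ~~ is_Aeven2 X ->
  root_datum (finite_cartan X) (sqlen_ord X) (sqlen X 0) (theta_z X).
Proof.
move=> hX hA; split.
- by move=> i; rewrite finite_cartanE cartan_diag.
- by move=> i j ij; rewrite finite_cartanE cartan_offdiag // eqSS.
- by move=> i j; rewrite !finite_cartanE cartan_sym.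
- by move=> v; exact: gram_pos.
- by move=> i; rewrite sqlen_gt0 sqlen_le3.
- by rewrite sqlen_gt0 sqlen_le3.
- move=> i j ij.
  have [X3|X3] := boolP (is_G2_type X); last first.
    left; rewrite /sqlen_ord.
    by rewrite !geq_max !sqlen_le2.
  right; rewrite !finite_cartanE /sqlen_ord.
  by case: X hX hA i j ij X3 => //= _ _ [[|[|//]] ?] [[|[|//]] ?] //= _ _; split;
    rewrite // /cartan_entry /= unlock.
- exact: (gram_theta hX hA).
- move=> i; rewrite mxE -PoszM.
  by apply: (sqlen_div_marks hX hA); rewrite ltn_ord.
- by move=> i; rewrite pairz_theta // mulr_ge0 // oppr_ge0 cartan_offdiag.
- by move=> i; rewrite mxE ltz_nat marks_gt0.
- move=> m3.
  have XG : X = G2_1.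
    case: X hA m3 {hX} => //= n _; case: ifP => //.
  subst X => v; rewrite /gram /pairz /sqlen_ord /= !big_ord_recl !big_ord0.
  have cE (i j : 'I_2) : (finite_cartan G2_1 : 'M_2) i j = cartan_entry G2_1 i.+1 j.+1.
    exact: finite_cartanE.
  rewrite !cE /cartan_entry /= unlock /=.
  move: (v _ _) (v _ _) => b a; apply/eqP => e.
  have [k [c [hb hc]]] : exists k c : int, b = 3 * k + c /\ (c = 0 \/ c = 1 \/ c = 2).
    by exists (b %/ 3)%Z, (b %% 3)%Z; lia.
  (* Modulo 3 the norm of the G_2 lattice is 2 c^2, with c the residue of the second coordinate, and
     2 c^2 is never congruent to 4. *)
  have : 3 * (2 * a * a - 6 * a * k - 2 * a * c + 6 * k * k + 4 * k * c) + 2 * c * c = 4.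
    by rewrite -[RHS]e hb; ring.
  by move: (_ + 4 * k * c) hc => t [->|[->|->]]; lia.
move=> Q [j hj Qj] prop k ok.
have lift (l : nat) : (1 <= l <= rank X)%N -> exists i : 'I_(rank X), l = i.+1.
  by case: l => // l hl; exists (Ordinal (hl : l < rank X)%N).
have := @simple_propagation X (fun l => forall i : 'I_(rank X), l = i.+1 -> Q i) hX hA.
move=> /(_ _ _ k.+1 (ltn_ord k) ok k erefl); apply.
  by exists j.+1; split=> //; [exact: ltn_ord | move=> i [] /val_inj <-].
move=> a b ha hb Qa ab cab sab i bi.
have [i' ai'] := lift _ ha.
apply: (prop i' i (Qa _ ai')).
- by apply: contra ab => /eqP e; rewrite ai' bi e.
- by rewrite finite_cartanE -ai' -bi.
by rewrite /sqlen_ord -ai' -bi.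
Qed.

(** * Weights of the module as integral vectors *)

Definition ratv (n : nat) (v : 'rV[int]_n) : 'rV[rat]_n := map_mx intr v.

Lemma ratv_inj n : injective (@ratv n).
Proof.
move=> u v h; apply/rowP => i; have := congr1 (fun x : 'rV[rat]_n => x 0 i) h.
by rewrite !mxE => /eqP; rewrite eqr_int => /eqP.
Qed.

Lemma ratvD n (u v : 'rV[int]_n) : ratv (u + v) = ratv u + ratv v.
Proof. by apply/rowP => i; rewrite !mxE intrD. Qed.

Lemma ratvN n (v : 'rV[int]_n) : ratv (- v) = - ratv v.
Proof. by apply/rowP => i; rewrite !mxE intrN. Qed.

Lemma ratv0 n : ratv (0 : 'rV[int]_n) = 0.
Proof. by apply/rowP => i; rewrite !mxE. Qed.

Lemma ratv_simple n (i : 'I_n) : ratv (simple i) = alpha i.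
Proof. by apply/rowP => j; rewrite !mxE; case: (_ && _). Qed.

Lemma ratv_simpleM n (i : 'I_n) (t : nat) : ratv (t%:Z *: simple i) = alpha i *+ t.
Proof.
apply/rowP => j; rewrite mulmxnE !mxE /=.
by case: eqP => _ /=; rewrite ?mulr1 ?mulr0 ?mul0rn.
Qed.

Lemma pairing_ratv n (A : 'M[int]_n) i (v : 'rV[int]_n) :
  pairing A i (ratv v) = (pairz A i v)%:~R.
Proof. by rewrite /pairing /pairz rmorph_sum; apply: eq_bigr => j _; rewrite rmorphM mxE. Qed.

Lemma theta_ratv X : ~~ is_Aeven2 X -> theta X = ratv (theta_z X).
Proof.
move=> hA; apply/rowP => j; rewrite thetaE !mxE.
have -> : (if X is Aeven2 _ then 2^-1 else 1) = 1 :> rat by case: X hA j.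
by rewrite mul1r.
Qed.

Lemma coordB n (u v : 'rV[rat]_n) j : (u - v) 0 j = u 0 j - v 0 j.
Proof. by rewrite mxE [X in _ + X]mxE. Qed.

Lemma theta_last X (j : 'I_(rank X)) : is_Aeven2 X -> j.+1 = rank X -> theta X 0 j = 2^-1.
Proof.
by move=> hA hj; rewrite thetaE hj; case: X hA {j hj} => //= n _; rewrite eqxx mulr1.
Qed.

Section ModuleWeights.
Variables (X : affine_type) (hX : in_range X).
Variables (s : 'I_(rank X) -> nat) (hs : symmetrizer (finite_cartan X) s).
Variables (V : lmodType Qq) (M : uq_module (finite_cartan X) s V).
Hypotheses (irrM : irreducible M) (hwM : has_highest_weight M (theta X)).

Let A := finite_cartan X.
Let s_gt0 : forall i, (0 < s i)%N. Proof. by case: hs. Qed.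
Let A_diag i : A i i = 2. Proof. by rewrite /A finite_cartanE cartan_diag. Qed.

Lemma Lambda_le_theta mu : Lambda M mu ->
  exists c : 'I_(rank X) -> nat, mu = theta X - \sum_j alpha j *+ c j.
Proof.
have [v0 [v0N w0] E0] := hwM; case=> v [vN wv].
exact: (weight_le (@cartan_nondeg X hX) irrM w0 E0 v0N wv vN).
Qed.

(** In type A_{2n}^(2) the last coordinate of theta is 1/2, and weights differ from theta by
    integral vectors. *)
Lemma Lambda_not_Aeven2 (i : 'I_(rank X)) : Lambda M (alpha i) -> ~~ is_Aeven2 X.
Proof.
move=> /Lambda_le_theta[c hc]; apply/negP => hA.
have n0 : (0 < rank X)%N by case: (rank X) i {hc} => [[]|].
have hj : ((rank X).-1 < rank X)%N by rewrite prednK.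
have := congr1 (fun x : 'rV[rat]_(rank X) => x 0 (Ordinal hj)) hc.
rewrite coordB sum_alpha_coord theta_last ?prednK // mxE /= => e.
have : (1 : rat) = (2 * (c (Ordinal hj) + (Ordinal hj == i))%N)%:R.
  rewrite natrM natrD; move: e; case: (_ == i) => /=; lra.
by rewrite -[1]/(1%:R) => /eqP; rewrite eqr_nat; lia.
Qed.

Hypothesis hA : ~~ is_Aeven2 X.

Lemma Lambda_integral mu : Lambda M mu -> exists v, mu = ratv v.
Proof.
move=> /Lambda_le_theta[c ->]; exists (theta_z X - \row_j (c j)%:Z).
apply/rowP => j; rewrite ratvD theta_ratv // mxE [RHS]mxE; congr (_ + _).
by rewrite ratvN !mxE sum_alpha_coord.
Qed.

Lemma module_weight_set :
  weight_set A (theta_z X) (fun v => Lambda M (ratv v)).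
Proof.
have [v0 [v0N w0] E0] := hwM.
have dom i : 0 <= pairing A i (theta X).
  by rewrite theta_ratv // pairing_ratv ler0z; exact: (rd_dom (affine_root_datum hX hA)).
have nd := @cartan_nondeg X hX.
split.
- by rewrite -theta_ratv //; exists v0.
- move=> v /Lambda_le_theta[c hc] i.
  have := congr1 (fun x : 'rV[rat]_(rank X) => x 0 i) hc.
  rewrite theta_ratv // coordB sum_alpha_coord ![ratv _ 0 _]mxE => e.
  by rewrite -(ler_int rat) e lerBlDr lerDl ler0n.
- move=> v i t [w [wN ww]] ht.
  have [u wu uN] := string_down s_gt0 A_diag nd irrM w0 E0 v0N ww wN (pairing_ratv A i v) ht.
  by exists u; split=> //; rewrite ratvD ratvN ratv_simpleM.
- move=> v i t [w [wN ww]] ht.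
  have [u wu uN] := string_up s_gt0 A_diag nd irrM w0 E0 v0N dom ww wN (pairing_ratv A i v) ht.
  by exists u; split=> //; rewrite ratvD ratv_simpleM.
move=> v [w [wN ww]] vN.
have [|i [u [wu uN]]] := raise_weight nd irrM w0 E0 v0N ww wN.
  by rewrite theta_ratv //; apply: contra vN => /eqP/ratv_inj ->.
by exists i, u; split=> //; rewrite ratvD ratv_simple.
Qed.

End ModuleWeights.

(* A vertex is encoded by its weight in the basis of simple roots together with
   [None] for x_alpha and [Some j] for y_j. *)
Definition node_arrow (n : nat) (i : 'I_n) (b c : 'rV[int]_n * option 'I_n) : Prop :=
  [\/ [/\ b.2 = None, c.2 = None & c.1 = b.1 - simple i],
      [/\ b.2 = None, b.1 = simple i & c = (0, Some i)] |
      [/\ b = (0, Some i), c.2 = None & c.1 = - simple i]].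

Record root_crystal (n : nat) (A : 'M[int]_n) (r : 'I_n -> nat) (m : nat)
    (B : crystal 'I_n 'rV[rat]_n) (node : B -> 'rV[int]_n * option 'I_n) : Prop :=
  RootCrystal {
  rc_inj : injective node;
  rc_wt : forall b, wt b = ratv (node b).1;
  rc_root : forall b, (node b).2 = None -> is_root A r m (node b).1;
  rc_simple : forall b j, (node b).2 = Some j -> (node b).1 = 0 /\ is_root A r m (simple j);
  rc_x : forall v, is_root A r m v -> exists b, node b = (v, None);
  rc_y : forall j, is_root A r m (simple j) -> exists b, node b = (0, Some j);
  rc_f : forall i b c, f_ i b = Some c <-> node_arrow i (node b) (node c);
  rc_e : forall i b c, e_ i c = Some b <-> node_arrow i (node b) (node c)
}.

(** * The crystal B(theta) in root coordinates *)

Section BCrystal.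
Variables (X : affine_type) (hX : in_range X).
Variables (s : 'I_(rank X) -> nat) (hs : symmetrizer (finite_cartan X) s).
Variables (V : lmodType Qq) (M : uq_module (finite_cartan X) s V).
Hypotheses (irrM : irreducible M) (hwM : has_highest_weight M (theta X)).
Hypothesis hA : ~~ is_Aeven2 X.

Let A := finite_cartan X.
Let D := affine_root_datum hX hA.
Let W := module_weight_set hX hs irrM hwM hA.
Local Notation rootX := (is_root A (sqlen_ord X) (sqlen X 0)).

Lemma Lambda_root v : v != 0 -> Lambda M (ratv v) <-> rootX v.
Proof. exact: (L_iff D W). Qed.

Lemma ratv_eq0 n (v : 'rV[int]_n) : (ratv v == 0) = (v == 0).
Proof. by rewrite -(ratv0 n) (inj_eq (@ratv_inj n)). Qed.

Lemma Lambda_posE mu : Lambda_pos M mu <->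
  exists v, [/\ mu = ratv v, rootX v & forall i, 0 <= v 0 i].
Proof.
split=> [[Lmu mu0 pos]|[v [-> rv pos]]].
  have [v muE] := Lambda_integral hX irrM hwM hA Lmu; exists v; split=> //.
    by apply/Lambda_root; rewrite -?ratv_eq0 -muE.
  by move=> i; have := pos i; rewrite muE mxE ler0z.
have v0 := root_neq0 D rv; split; rewrite ?ratv_eq0 //; first exact/Lambda_root.
by move=> i; rewrite mxE ler0z.
Qed.

Lemma Lambda_pos_neg mu : (Lambda_pos M `|` Lambda_neg M)%classic mu <->
  exists2 v, mu = ratv v & rootX v.
Proof.
split=> [[/Lambda_posE[v [-> rv _]]|[nu /Lambda_posE[v [-> rv _]] <-]]|[v -> rv]].
- by exists v.
- by exists (- v); rewrite ?ratvN //; exact: (root_opp D).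
case: (root_sign D rv) => hv; [left|right]; first by apply/Lambda_posE; exists v.
exists (ratv (- v)); last by rewrite ratvN opprK.
apply/Lambda_posE; exists (- v); split=> //; first exact: (root_opp D).
by move=> i; rewrite mxE oppr_ge0.
Qed.

Lemma Lambda_pos_alpha j : Lambda_pos M (alpha j) <-> rootX (simple j).
Proof.
rewrite -ratv_simple; split=> [/Lambda_posE[v [/ratv_inj -> //]]|rj].
by apply/Lambda_posE; exists (simple j); split=> // i; rewrite mxE; case: (_ && _).
Qed.

(** All weights are integral here, so taking numerators loses nothing. *)
Definition B_node (b : B_elt M) : 'rV[int]_(rank X) * option 'I_(rank X) :=
  match b with
  | inl a => (map_mx numq (val a), None)
  | inr j => (0, Some (val j))
  end.

Lemma numq_ratv n (v : 'rV[int]_n) : map_mx numq (ratv v) = v.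
Proof. by apply/rowP => i; rewrite !mxE numq_int. Qed.

Lemma B_node_x mu hmu v : mu = ratv v -> B_node (@x_ _ _ _ _ M mu hmu) = (v, None).
Proof. by move=> e; rewrite /= /x_ e numq_ratv. Qed.

Lemma B_elt_cases (b : B_elt M) :
  (exists v hv, [/\ b = @x_ _ _ _ _ M (ratv v) hv, rootX v & B_node b = (v, None)]) \/
  (exists j hj, [/\ b = @y_ _ _ _ _ M j hj, rootX (simple j) & B_node b = (0, Some j)]).
Proof.
case: b => [[mu hmu]|[j hj]]; [left|right].
  have h := set_mem hmu; have [v e rv] := proj1 (Lambda_pos_neg mu) h.
  subst mu; exists v, h; split=> //; last exact: (B_node_x h).
  by rewrite /x_; congr (inl (exist _ _ _)); exact: bool_irrelevance.
have h := set_mem hj; exists j, h; split=> //; last exact/Lambda_pos_alpha.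
by rewrite /y_; congr (inr (exist _ _ _)); exact: bool_irrelevance.
Qed.

Lemma B_node_inj : injective B_node.
Proof.
move=> b c; case: (B_elt_cases b) => [[v [hv [-> rv ->]]]|[j [hj [-> rj ->]]]];
  case: (B_elt_cases c) => [[w [hw [-> rw ->]]]|[k [hk [-> rk ->]]]] // -[e].
  by subst w; congr x_; exact: Prop_irrelevance.
by subst k; congr y_; exact: Prop_irrelevance.
Qed.

Lemma B_arrowE i b c : arrow (M := M) i b c <-> node_arrow i (B_node b) (B_node c).
Proof.
split.
  case=> [mu nu hmu hnu e|h hi|h hi].
  - have [v ev _] := proj1 (Lambda_pos_neg mu) hmu.
    have [w ew _] := proj1 (Lambda_pos_neg nu) hnu.
    rewrite (B_node_x _ ev) (B_node_x _ ew); apply: Or31; split=> //=.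
    by apply: ratv_inj; rewrite -ew -e ev ratvD ratvN ratv_simple.
  - by apply: Or32; rewrite (B_node_x _ (esym (ratv_simple i))).
  apply: Or33; rewrite (@B_node_x _ _ (- simple i)) //.
  by rewrite ratvN ratv_simple.
have inj := B_node_inj.
case: (B_elt_cases b) => [[v [hv [-> rv ->]]]|[j [hj [-> rj ->]]]];
  case: (B_elt_cases c) => [[w [hw [-> rw ->]]]|[k [hk [-> rk ->]]]]; case=> -[] //=.
- by move=> _ _ e; apply: arrow_xx; rewrite e ratvD ratvN ratv_simple.
- move=> _ e [ki]; subst v k.
  have h : (Lambda_pos M `|` Lambda_neg M)%classic (alpha i) by rewrite -ratv_simple.
  have -> : x_ hv = x_ h by apply: inj; rewrite !(@B_node_x _ _ (simple i)) ?ratv_simple.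
  exact: arrow_xy.
move=> [ji] _ e; subst w j.
have h : (Lambda_pos M `|` Lambda_neg M)%classic (- alpha i).
  by rewrite -ratv_simple -ratvN.
have -> : x_ hw = x_ h.
  by apply: inj; rewrite !(@B_node_x _ _ (- simple i)) ?ratvN ?ratv_simple.
exact: arrow_yx.
Qed.

Lemma B_node_root b : (B_node b).2 = None -> rootX (B_node b).1.
Proof. by case: (B_elt_cases b) => [[v [hv [_ rv ->]]]|[j [hj [_ _ ->]]]]. Qed.

Lemma B_node_neq0 b : B_node b <> (0, None).
Proof.
move=> e; have := B_node_root (b := b); rewrite e => /(_ erefl)/(root_neq0 D).
by rewrite eqxx.
Qed.

(** Two kinds of arrow could compete only at x_{alpha_i}, where the rule for two x's would lead to
    weight 0; but 0 is not a root. *)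
Lemma node_arrow_out i b c c' : node_arrow i (B_node b) (B_node c) ->
  node_arrow i (B_node b) (B_node c') -> c = c'.
Proof.
have N d : B_node d = ((B_node d).1, (B_node d).2) by case: (B_node d).
have bad d : (B_node b).1 = simple i -> (B_node d).1 = (B_node b).1 - simple i ->
    (B_node d).2 = None -> False.
  by move=> -> e1 e2; apply: (@B_node_neq0 d); rewrite N e1 e2 subrr.
move=> h h'; apply: B_node_inj.
case: h => [[b2 c2 c1]|[b2 b1 ce]|[be c2 c1]]; case: h' => [[b2' c2' c1']|[b2' b1' ce']|[be' c2' c1']].
- by rewrite (N c) (N c') c1 c2 c1' c2'.
- by case: (bad c).
- by rewrite be' in b2.
- by case: (bad c').
- by rewrite ce ce'.
- by rewrite be' in b2.
- by rewrite be in b2'.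
- by rewrite be in b2'.
by rewrite (N c) (N c') c1 c2 c1' c2'.
Qed.

Lemma node_arrow_in i b b' c : node_arrow i (B_node b) (B_node c) ->
  node_arrow i (B_node b') (B_node c) -> b = b'.
Proof.
have N d : B_node d = ((B_node d).1, (B_node d).2) by case: (B_node d).
have bad d : (B_node c).1 = - simple i -> (B_node c).1 = (B_node d).1 - simple i ->
    (B_node d).2 = None -> False.
  move=> -> /(canLR (subrK _)); rewrite addNr => e1 e2.
  by apply: (@B_node_neq0 d); rewrite N -e1 e2.
move=> h h'; apply: B_node_inj.
case: h => [[b2 c2 c1]|[b2 b1 ce]|[be c2 c1]]; case: h' => [[b2' c2' c1']|[b2' b1' ce']|[be' c2' c1']].
- rewrite (N b) (N b') b2 b2'; congr (_, _).
  by apply: (addIr (- simple i)); rewrite -c1 -c1'.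
- by rewrite ce' in c2.
- by case: (bad b).
- by rewrite ce in c2'.
- by rewrite (N b) (N b') b1 b1' b2 b2'.
- by rewrite ce in c2'.
- by case: (bad b').
- by rewrite ce' in c2.
by rewrite be be'.
Qed.

Lemma xget_Some (T : choiceType) (P : set T) (c : T) :
  (forall x y, P x -> P y -> x = y) ->
  xget None [set Some c | c in P]%classic = Some c <-> P c.
Proof.
move=> uniq; split=> [|Pc].
  by case: xgetP => [_ -> [d Pd <-] [<-] //|_ //].
apply: xget_unique; first by exists c.
by move=> _ [d Pd <-]; rewrite (uniq d c).
Qed.

Lemma B_root_crystal : root_crystal A (sqlen_ord X) (sqlen X 0) (B := B_crystal M) B_node.
Proof.
split.
- exact: B_node_inj.
- by move=> b; case: (B_elt_cases b) => [[v [hv [-> rv ->]]]|[j [hj [-> rj ->]]]] //=; rewrite ratv0.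
- exact: B_node_root.
- by move=> b j; case: (B_elt_cases b) => [[v [hv [_ _ ->]]]|[k [hk [_ rk ->]]]] //= [<-].
- move=> v rv; have hv : (Lambda_pos M `|` Lambda_neg M)%classic (ratv v).
    by apply/Lambda_pos_neg; exists v.
  by exists (x_ hv); exact: B_node_x.
- by move=> j /Lambda_pos_alpha hj; exists (y_ hj).
- move=> i b c; rewrite -B_arrowE; apply: xget_Some => x y /B_arrowE hx /B_arrowE.
  exact: node_arrow_out.
move=> i b c; rewrite -B_arrowE.
apply: (xget_Some (P := [set b | arrow i b c]%classic)) => x y /B_arrowE hx /B_arrowE.
exact: node_arrow_in.
Qed.

End BCrystal.

(** * The rank-two computation *)

(* Rank-two local model: [SX N P Q z p q] records, for a root v, the products
   N = (v,v), P = (v,alpha_j), Q = (v,alpha_k), whether m divides r_l v_l for all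
   l other than j, k, and the residues of r_j v_j and r_k v_k modulo m.  [SY true]
   and [SY false] stand for y_j and y_k, [SO] for all other y_l. *)
Inductive state : Type :=
| SX of Z & Z & Z & bool & Z & Z
| SY of bool
| SO.

Definition state_eqb (s t : state) : bool :=
  match s, t with
  | SX N P Q z p q, SX N' P' Q' z' p' q' =>
      [&& Z.eqb N N', Z.eqb P P', Z.eqb Q Q', Bool.eqb z z', Z.eqb p p' & Z.eqb q q']
  | SY l, SY l' => Bool.eqb l l'
  | SO, SO => true
  | _, _ => false
  end.

Lemma state_eqP : Equality.axiom state_eqb.
Proof.
move=> s t; apply: (iffP idP) => [|->]; last first.
  by case: t => [N P Q z p q|l|] //=; rewrite ?Z.eqb_refl ?Bool.eqb_reflx.
case: s t => [N P Q z p q|l|] [N' P' Q' z' p' q'|l'|] //=; last by move/Bool.eqb_prop->.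
by case/and5P=> /Z.eqb_eq-> /Z.eqb_eq-> /Z.eqb_eq-> /Bool.eqb_prop-> /andP[/Z.eqb_eq-> /Z.eqb_eq->].
Qed.

HB.instance Definition _ := hasDecEq.Build state state_eqP.

Section Model.
Variables (m rj rk B : Z).
Local Open Scope Z_scope.

Definition norm_at (N P Q a b : Z) : Z :=
  N - 2 * a * P - 2 * b * Q + 2 * rj * (a * a) + 2 * rk * (b * b) + 2 * B * (a * b).

Definition shift (N P Q : Z) (z : bool) (p q a b : Z) : state :=
  SX (norm_at N P Q a b) (P - 2 * rj * a - B * b) (Q - B * a - 2 * rk * b) z
     ((p - rj * a) mod m) ((q - rk * b) mod m).

Definition root_state (a b : Z) : state :=
  SX (2 * rj * (a * a) + 2 * rk * (b * b) + 2 * B * (a * b))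
     (2 * rj * a + B * b) (B * a + 2 * rk * b) true ((rj * a) mod m) ((rk * b) mod m).

Definition state_is_root (s : state) : bool :=
  if s is SX N _ _ z p q then
    (N =? 2) || [&& N =? 2 * m, z, p =? 0 & q =? 0]
  else false.

(* [d] is 1 for f and -1 for e. *)
Definition step (d : Z) (l : bool) (s : state) : option state :=
  match s with
  | SX N P Q z p q =>
      let a := if l then d else 0 in
      let b := if l then 0 else d in
      if norm_at N P Q a b =? 0 then Some (SY l)
      else let t := shift N P Q z p q a b in
           if state_is_root t then Some t else None
  | SY l' =>
      if Bool.eqb l l' then Some (if l then root_state (- d) 0 else root_state 0 (- d))
      else None
  | SO => None
  end.

(** Models eps and phi. [check] verifies that the count stays below the fuel 6, so that it is not
    truncated. *)
Fixpoint count (fuel : nat) (d : Z) (l : bool) (s : state) : nat :=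
  if fuel is fuel'.+1 then
    if step d l s is Some t then (count fuel' d l t).+1 else 0%N
  else 0%N.

Definition tensor_step (d : Z) (l : bool) (u : state * state) : option (state * state) :=
  let ef := count 6 (-1) l u.2 in
  let ph := count 6 1 l u.1 in
  if (if d =? 1 then (ef < ph)%N else (ef <= ph)%N) then omap (fun s => (s, u.2)) (step d l u.1)
  else omap (fun s => (u.1, s)) (step d l u.2).

Definition signs : seq Z := [:: -2; -1; 0; 1; 2].

(* Properties of the states of actual roots; they cut [box] down to a short list. *)
Definition valid (s : state) : bool :=
  match s with
  | SX N P Q z p q =>
      if [&& p <? m, q <? m, state_is_root s, P mod rj =? 0, Q mod rk =? 0,
          (rj =? m) ==> (p =? 0), (rk =? m) ==> (q =? 0),
          z ==> ((P - 2 * p - B / rk * q) mod m =? 0) && ((Q - 2 * q - B / rj * p) mod m =? 0) &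
          [&& z, p =? 0 & q =? 0] ==> (N =? 2 * m)] then
          all (fun a => all (fun b =>
            let n := norm_at N P Q a b in
            (0 <=? n) && ((n =? 0) ==> ((0 <=? a * b) && (s == root_state a b)))) signs) signs
      else false
  | SY l => let r := if l then rj else rk in (r =? 1) || (r =? m)
  | SO => true
  end.

(** N is one of the two root norms, |P| and |Q| are at most 6 by [pair_bound], and residues are
    taken modulo m <= 3. *)
Definition box : seq state :=
  let zs := [:: -6; -5; -4; -3; -2; -1; 0; 1; 2; 3; 4; 5; 6] in
  let res := [:: 0; 1; 2] in
  SO :: SY true :: SY false ::
  flatten [seq flatten [seq flatten [seq flatten [seq flatten [seq
    [seq SX N P Q z p q | q <- res] | p <- res] | z <- [:: true; false]] | Q <- zs] | P <- zs]
    | N <- [:: 2; 2 * m]].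

Definition states : seq state := undup [seq s <- box | valid s].

Definition highest (s : state) : bool :=
  ~~ isSome (step (-1) true s) && ~~ isSome (step (-1) false s).

Definition PQ (s : state) : Z * Z := if s is SX _ P Q _ _ _ then (P, Q) else (0, 0).

(* A word in the colours, read from right to left, and the vertices of B and of
   B (x) B to which it leads. *)
Definition entry : Type := (seq bool * state * (state * state))%type.

(** A parallel search through the components of c and of u. It only proposes a list; its correctness
    is established afterwards by [certificate]. *)
Fixpoint explore (fuel : nat) (todo acc : seq entry) : seq entry :=
  match fuel, todo with
  | fuel'.+1, t :: todo' =>
      let next l :=
        match step 1 l t.1.2, tensor_step 1 l t.2 with
        | Some s, Some u =>
            if has (fun e : entry => e.1.2 == s) acc then [::] else [:: (l :: t.1.1, s, u)]
        | _, _ => [::]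
        end in
      let n1 := next true in
      let n2 := [seq e <- next false | ~~ has (fun e' : entry => e'.1.2 == e.1.2) n1] in
      explore fuel' (todo' ++ n1 ++ n2) (acc ++ n1 ++ n2)
  | _, _ => acc
  end.

Definition run (c : state) (w : seq bool) : option state :=
  foldr (fun l o => obind (step 1 l) o) (Some c) w.

Definition tensor_run (u : state * state) (w : seq bool) : option (state * state) :=
  foldr (fun l o => obind (tensor_step 1 l) o) (Some u) w.

Definition matched (L : seq entry) (o : option state) (o' : option (state * state)) : bool :=
  match o, o' with
  | None, None => true
  | Some s, Some u => has (fun e : entry => (e.1.2 == s) && (e.2 == u)) L
  | _, _ => false
  end.

(** The list is a bisimulation: it contains the starting pair, each entry is reached on both sides
    by one and the same word, and it is closed under all steps in both directions. *)
Definition certificate (L : seq entry) (c : state) (u : state * state) : bool :=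
  has (fun e : entry => (e.1.2 == c) && (e.2 == u)) L &&
  all (fun e : entry =>
    [&& run c e.1.1 == Some e.1.2, tensor_run u e.1.1 == Some e.2 &
        all (fun l => matched L (step 1 l e.1.2) (tensor_step 1 l e.2) &&
                      matched L (step (-1) l e.1.2) (tensor_step (-1) l e.2)) [:: true; false]]) L.

Definition check_pair (c : state) (u : state * state) : bool :=
  certificate (explore 20 [:: ([::], c, u)] [:: ([::], c, u)]) c u.

(** The nested conditionals keep [vm_compute] from running the search where the weights differ or u
    is not highest. *)
Definition pair_ok (c : state) (u : state * state) : bool :=
  if ((PQ u.1).1 + (PQ u.2).1 =? (PQ c).1) && ((PQ u.1).2 + (PQ u.2).2 =? (PQ c).2) then
    if isSome (tensor_step (-1) true u) then true
    else if isSome (tensor_step (-1) false u) then true else check_pair c u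
  else true.

(** Only s1 in [top] is tried, because the first factor of a highest element of the tensor product
    is itself highest ([tensE_left]). *)
Definition check : bool :=
  let G := states in
  let top := [seq s <- G | highest s] in
  all (fun l => all (fun s => ((count 6 1 l s < 6) && (count 6 (-1) l s < 6))%N) G) [:: true; false] &&
  all (fun c => all (fun s1 => all (fun s2 => pair_ok c (s1, s2)) G) top) top.

Lemma pair_ok_certificate c u : pair_ok c u ->
  (PQ u.1).1 + (PQ u.2).1 = (PQ c).1 -> (PQ u.1).2 + (PQ u.2).2 = (PQ c).2 ->
  (forall l, tensor_step (-1) l u = None) -> exists L, certificate L c u.
Proof.
rewrite /pair_ok => + e1 e2 e3; case: ifP => [_|]; last by rewrite e1 e2 !Z.eqb_refl.
case: ifP => [|_]; first by rewrite e3.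
case: ifP => [|_]; first by rewrite e3.
rewrite /check_pair => h; exists (explore 20 [:: ([::], c, u)] [:: ([::], c, u)]).
exact: h.
Qed.

Lemma check_pair_ok c s1 s2 : check -> c \in states -> highest c -> s1 \in states ->
  highest s1 -> s2 \in states -> pair_ok c (s1, s2).
Proof.
rewrite /check => /andP[_ /allP h] hc tc h1 t1 h2.
have := h c; rewrite mem_filter hc tc => /(_ isT)/allP/(_ s1).
by rewrite mem_filter h1 t1 => /(_ isT)/allP/(_ s2 h2).
Qed.

Lemma check_count l s : check -> s \in states ->
  (count 6 1 l s < 6)%N /\ (count 6 (-1) l s < 6)%N.
Proof.
rewrite /check => /andP[/allP h _] hs; apply/andP.
have : l \in [:: true; false] by case: l.
by move/h/allP/(_ s hs).
Qed.

(* All values of (m, r_j, r_k, (alpha_j, alpha_k)) that occur. *)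
Definition good_pairs : seq (Z * Z * Z * Z) :=
  [:: (1, 1, 1, 0); (1, 1, 1, -1); (1, 1, 2, 0); (1, 1, 2, -2); (1, 2, 1, 0); (1, 2, 1, -2);
      (1, 2, 2, 0); (1, 2, 2, -2); (1, 1, 3, -3); (1, 3, 1, -3);
      (2, 1, 1, 0); (2, 1, 1, -1); (2, 1, 2, 0); (2, 1, 2, -2); (2, 2, 1, 0); (2, 2, 1, -2);
      (2, 2, 2, 0); (2, 2, 2, -2); (3, 1, 3, -3); (3, 3, 1, -3)].

End Model.

Lemma good_pairs_check :
  all (fun x => let: (m, rj, rk, B) := x in check m rj rk B) good_pairs.
Proof. by vm_compute. Qed.

Lemma check_good (m rj rk B : Z) : (m, rj, rk, B) \in good_pairs -> check m rj rk B.
Proof. exact: (allP good_pairs_check (m, rj, rk, B)). Qed.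

(** * From states back to crystal elements *)

Section LocalTransport.
Variables (m rj rk B : Z).
Hypothesis checked : check m rj rk B.
Local Notation step := (step m rj rk B).
Local Notation tensor_step := (tensor_step m rj rk B).
Local Notation count := (count m rj rk B).
Local Notation states := (states m rj rk B).
Local Notation run := (run m rj rk B).
Local Notation tensor_run := (tensor_run m rj rk B).

Variables (T : Type) (F E : bool -> T -> option T) (st : T -> state).
Variables (eps phi : bool -> T -> nat).
Hypothesis stF : forall l x, omap st (F l x) = step (Zpos xH) l (st x).
Hypothesis stE : forall l x, omap st (E l x) = step (Zneg xH) l (st x).
Hypothesis st_states : forall x, st x \in states.
Hypothesis epsE : forall l x, eps l x = count 6 (Zneg xH) l (st x).
Hypothesis phiE : forall l x, phi l x = count 6 (Zpos xH) l (st x).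

Inductive linked (c : T) : T -> Prop :=
| linked_refl : linked c c
| linked_F l x y : linked c x -> F l x = Some y -> linked c y
| linked_E l x y : linked c x -> E l x = Some y -> linked c y.

Hypothesis st_inj : forall c x x', linked c x -> linked c x' -> st x = st x' -> x = x'.

Definition tensF (l : bool) (u : T * T) : option (T * T) :=
  if (eps l u.2 < phi l u.1)%N then omap (fun x => (x, u.2)) (F l u.1)
  else omap (fun x => (u.1, x)) (F l u.2).

Definition tensE (l : bool) (u : T * T) : option (T * T) :=
  if (eps l u.2 <= phi l u.1)%N then omap (fun x => (x, u.2)) (E l u.1)
  else omap (fun x => (u.1, x)) (E l u.2).

Definition st2 (u : T * T) := (st u.1, st u.2).

Lemma st2F l u : omap st2 (tensF l u) = tensor_step (Zpos xH) l (st2 u).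
Proof.
have -> : tensor_step (Zpos xH) l (st2 u) =
    if (count 6 (Zneg xH) l (st u.2) < count 6 (Zpos xH) l (st u.1))%N
    then omap (fun s => (s, st u.2)) (step (Zpos xH) l (st u.1))
    else omap (fun s => (st u.1, s)) (step (Zpos xH) l (st u.2)) by [].
rewrite -epsE -phiE /tensF; case: ifP => _.
  by rewrite -stF; case: (F l u.1).
by rewrite -stF; case: (F l u.2).
Qed.

Lemma st2E l u : omap st2 (tensE l u) = tensor_step (Zneg xH) l (st2 u).
Proof.
have -> : tensor_step (Zneg xH) l (st2 u) =
    if (count 6 (Zneg xH) l (st u.2) <= count 6 (Zpos xH) l (st u.1))%N
    then omap (fun s => (s, st u.2)) (step (Zneg xH) l (st u.1))
    else omap (fun s => (st u.1, s)) (step (Zneg xH) l (st u.2)) by [].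
rewrite -epsE -phiE /tensE; case: ifP => _.
  by rewrite -stE; case: (E l u.1).
by rewrite -stE; case: (E l u.2).
Qed.

Definition Frun (c : T) (w : seq bool) : option T :=
  foldr (fun l o => obind (F l) o) (Some c) w.

Definition tensFrun (u : T * T) (w : seq bool) : option (T * T) :=
  foldr (fun l o => obind (tensF l) o) (Some u) w.

Lemma st_Frun c w : omap st (Frun c w) = run (st c) w.
Proof. by elim: w => //= l w <-; case: (Frun c w) => //= x; rewrite stF. Qed.

Lemma st2_Frun u w : omap st2 (tensFrun u w) = tensor_run (st2 u) w.
Proof. by elim: w => //= l w <-; case: (tensFrun u w) => //= x; rewrite st2F. Qed.

Lemma Frun_linked c w x : Frun c w = Some x -> linked c x.
Proof.
elim: w x => [|l w IH] x /=; first by case=> <-; exact: linked_refl.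
by case e: (Frun c w) => [y|//] /= h; apply: linked_F (IH _ e) h.
Qed.

Definition linked2 (u y : T * T) := linked u.1 y.1 /\ linked u.2 y.2.

Lemma tensF_linked l u y z : linked2 u y -> tensF l y = Some z -> linked2 u z.
Proof.
case=> h1 h2; rewrite /tensF; case: ifP => _.
  by case e: (F l y.1) => [x|//] /= [<-]; split=> //; apply: linked_F h1 e.
by case e: (F l y.2) => [x|//] /= [<-]; split=> //; apply: linked_F h2 e.
Qed.

Lemma tensE_linked l u y z : linked2 u y -> tensE l y = Some z -> linked2 u z.
Proof.
case=> h1 h2; rewrite /tensE; case: ifP => _.
  by case e: (E l y.1) => [x|//] /= [<-]; split=> //; apply: linked_E h1 e.
by case e: (E l y.2) => [x|//] /= [<-]; split=> //; apply: linked_E h2 e.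
Qed.

Lemma tensFrun_linked u w y : tensFrun u w = Some y -> linked2 u y.
Proof.
elim: w y => [|l w IH] y /=; first by case=> <-; split; exact: linked_refl.
by case e: (tensFrun u w) => [z|//] /= h; apply: tensF_linked (IH _ e) h.
Qed.

Lemma st2_inj u y y' : linked2 u y -> linked2 u y' -> st2 y = st2 y' -> y = y'.
Proof.
case: y => y1 y2; case: y' => y1' y2' [/= h1 h2] [/= h1' h2'] [e1 e2].
by rewrite (st_inj h1 h1' e1) (st_inj h2 h2' e2).
Qed.

Lemma count0 fuel d l s : step d l s = None -> count fuel d l s = 0%N.
Proof. by case: fuel => //= n ->. Qed.

(** If e acted on the right factor, then eps there would exceed phi >= 0, so the result could not be
    zero. *)
Lemma tensE_left l u : tensE l u = None -> E l u.1 = None.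
Proof.
rewrite /tensE; case: leqP => h; first by case: (E l u.1).
case e: (E l u.2) => [//|] _; move: h; rewrite epsE count0 //.
by rewrite -stE e.
Qed.

(** The certificate lives on states; injectivity of [st] on linked elements turns its equalities
    into equalities of elements. The last clause says that raising x and y leads to elements again
    reached by a common word, which is what path independence rests on. *)
Lemma local_transport c u : (forall l, E l c = None) -> (forall l, tensE l u = None) ->
  Z.add (PQ (st u.1)).1 (PQ (st u.2)).1 = (PQ (st c)).1 ->
  Z.add (PQ (st u.1)).2 (PQ (st u.2)).2 = (PQ (st c)).2 ->
  forall w x, Frun c w = Some x -> exists y, [/\ tensFrun u w = Some y,
    forall l, (tensF l y = None <-> F l x = None) /\ (tensE l y = None <-> E l x = None) &
    forall l x1, E l x = Some x1 -> exists2 w1, Frun c w1 = Some x1 &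
      tensE l y = tensFrun u w1].
Proof.
move=> Ec Eu hP hQ.
have [cert] : exists L, certificate m rj rk B L (st c) (st2 u).
  apply: pair_ok_certificate => //; last by move=> l; rewrite -st2E Eu.
  have hl x : (forall l, E l x = None) -> highest m rj rk B (st x).
    by move=> Ex; rewrite /highest -!stE !Ex.
  apply: check_pair_ok => //; try exact: st_states; first exact: hl.
  by apply: hl => l; exact: tensE_left.
case/andP=> init /allP good.
pose inL s v := has (fun e : entry => (e.1.2 == s) && (e.2 == v)) cert.
have inLP s v : inL s v -> [/\ exists2 w, run (st c) w = Some s & tensor_run (st2 u) w = Some v,
    forall l, matched cert (step (Zpos xH) l s) (tensor_step (Zpos xH) l v) &
    forall l, matched cert (step (Zneg xH) l s) (tensor_step (Zneg xH) l v)].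
  case/hasP=> e eL /andP[/eqP es /eqP ev].
  have /and3P[/eqP h1 /eqP h2 /and3P[/andP[h3 h3'] /andP[h4 h4'] _]] := good _ eL.
  rewrite es ev in h1 h2 h3 h3' h4 h4'; split.
  - by exists e.1.1.
  - by case.
  by case.
have main w x : Frun c w = Some x -> exists2 y, tensFrun u w = Some y & inL (st x) (st2 y).
  elim: w x => [|l w IH] x /=; first by case=> <-; exists u.
  case e: (Frun c w) => [x0|//] /= hx.
  have [y0 -> /inLP[_ /(_ l) + _]] := IH _ e; rewrite -stF -st2F hx /=.
  by case: (tensF l y0) => // y /= hy; exists y.
move=> w x hx; have [y hy xy] := main w x hx; have [_ mF mE] := inLP _ _ xy.
exists y; split=> //.
- move=> l; have := mF l; have := mE l; rewrite -stF -st2F -stE -st2E.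
  by case: (F l x) => [?|]; case: (E l x) => [?|]; case: (tensF l y) => [?|];
    case: (tensE l y) => [?|] //=.
move=> l x1 Ex; have := mE l; rewrite -stE -st2E Ex /=.
case Ey: (tensE l y) => [y1|//] /= /inLP[[w1 r1 r2] _ _].
exists w1.
  have := st_Frun c w1; rewrite r1; case h: (Frun c w1) => [x2|//] /= [e]; congr Some.
  by apply: st_inj (Frun_linked h) (linked_E (Frun_linked hx) Ex) e.
have := st2_Frun u w1; rewrite r2; case h: (tensFrun u w1) => [y2|//] /= [e1 e2]; congr Some.
apply: esym; apply: st2_inj (tensFrun_linked h) (tensE_linked (tensFrun_linked hy) Ey) _.
by rewrite /st2 e1 e2.
Qed.

End LocalTransport.

Lemma Z_of_int_mod (a : int) (m : nat) : (0 < m)%N ->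
  Z.modulo (Z_of_int a) (Z.of_nat m) = Z_of_int (a %% m%:Z)%Z.
Proof.
move=> m0; have h1 := divz_eq a m%:Z; have h2 : 0 <= (a %% m%:Z)%Z by rewrite modz_ge0 //; lia.
have h3 : (a %% m%:Z)%Z < m%:Z by rewrite ltz_pmod.
move: h1 h2 h3; move: (a %% _)%Z (a %/ _)%Z => c d h1 h2 h3.
apply/esym; apply: (Z.mod_unique _ _ (Z_of_int d)); first by left; lia.
by rewrite h1; lia.
Qed.

Lemma dvdz_residues (m p x y a : int) : (m %| p - 2 * x - a * y)%Z ->
  (m %| p - 2 * (x %% m)%Z - a * (y %% m)%Z)%Z.
Proof.
move=> h.
have -> : p - 2 * (x %% m)%Z - a * (y %% m)%Z =
    (p - 2 * x - a * y) + (2 * (x %/ m)%Z + a * (y %/ m)%Z) * m.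
  have := divz_eq x m; have := divz_eq y m.
  by move: (x %/ m)%Z (x %% m)%Z (y %/ m)%Z (y %% m)%Z => a1 b1 a2 b2 -> ->; ring.
by apply: rpredD => //; exact: dvdz_mull.
Qed.

(** * The state of a root, and the range of its entries *)

Section LocalState.
Variables (n : nat) (A : 'M[int]_n) (r : 'I_n -> nat) (m : nat) (th : 'rV[int]_n).
Hypothesis D : root_datum A r m th.
Variables (j k : 'I_n).
Hypothesis jk : j != k.
Local Notation gram := (gram A r).
Local Notation pairz := (pairz A).
Local Notation is_root := (is_root A r m).
Let A_diag := rd_diag D.
Let A_sym := rd_sym D.

Definition zm := Z.of_nat m.
Definition zj := Z.of_nat (r j).
Definition zk := Z.of_nat (r k).
Definition zB := Z_of_int ((r j)%:Z * A j k).
Local Notation step := (step zm zj zk zB).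
Local Notation shift := (shift zm zj zk zB).
Local Notation root_state := (root_state zm zj zk zB).
Local Notation states := (states zm zj zk zB).

Definition others_div (v : 'rV[int]_n) : bool :=
  [forall l, (l != j) ==> (l != k) ==> (m%:Z %| (r l)%:Z * v 0%R l)%Z].

Definition vec_state (v : 'rV[int]_n) : state :=
  SX (Z_of_int (gram v v)) (Z_of_int ((r j)%:Z * pairz j v)) (Z_of_int ((r k)%:Z * pairz k v))
    (others_div v) (Z_of_int (((r j)%:Z * v 0%R j) %% m%:Z)%Z)
    (Z_of_int (((r k)%:Z * v 0%R k) %% m%:Z)%Z).

Definition lin (a b : int) : 'rV[int]_n := a *: simple j + b *: simple k.

Lemma gram_lin v a b : gram (v - lin a b) (v - lin a b) =
  gram v v - 2 * a * ((r j)%:Z * pairz j v) - 2 * b * ((r k)%:Z * pairz k v)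
  + 2 * (r j)%:Z * (a * a) + 2 * (r k)%:Z * (b * b) + 2 * ((r j)%:Z * A j k) * (a * b).
Proof.
rewrite /lin !(gramDl A_sym) !gramDr !(gramNl A_sym) !gramNr !(gramDl A_sym) !gramDr.
rewrite !(gramZl A_sym) !gramZr ![gram v (simple _)](gram_sym A_sym) !gram_simple.
by rewrite !pairz_simple !A_diag -(A_sym j k); ring.
Qed.

Lemma norm_at_lin v a b : norm_at zj zk zB (Z_of_int (gram v v))
    (Z_of_int ((r j)%:Z * pairz j v)) (Z_of_int ((r k)%:Z * pairz k v)) (Z_of_int a) (Z_of_int b)
  = Z_of_int (gram (v - lin a b) (v - lin a b)).
Proof. by rewrite gram_lin /norm_at /zj /zk /zB; lia. Qed.

Lemma coord_lin v a b l : (v - lin a b) 0 l = v 0 l - a * (l == j)%:R - b * (l == k)%:R.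
Proof. by rewrite !mxE /= opprD addrA. Qed.

Lemma m_range : (0 < m)%N. Proof. by case/andP: (rd_m D). Qed.

Lemma vec_state_lin v a b : vec_state (v - lin a b) =
  shift (Z_of_int (gram v v))
    (Z_of_int ((r j)%:Z * pairz j v)) (Z_of_int ((r k)%:Z * pairz k v))
    (others_div v) (Z_of_int (((r j)%:Z * v 0%R j) %% m%:Z)%Z)
    (Z_of_int (((r k)%:Z * v 0%R k) %% m%:Z)%Z) (Z_of_int a) (Z_of_int b).
Proof.
rewrite /Submission.shift norm_at_lin /vec_state.
have ek : (r k)%:Z * A k j = (r j)%:Z * A j k by rewrite A_sym.
congr SX.
- rewrite pairzD pairzN /lin pairzD !pairzZ !pairz_simple A_diag /zj /zB.
  by move: (A j k) => x; lia.
- rewrite pairzD pairzN /lin pairzD !pairzZ !pairz_simple A_diag /zk /zB -ek.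
  by move: (A k j) => x; lia.
- apply: eq_forallb => l; rewrite coord_lin.
  by case: (l == j) => //=; case: (l == k) => //=; rewrite !mulr0 !subr0.
- rewrite coord_lin eqxx (negbTE jk) mulr1 mulr0 subr0.
  have -> : Z.sub (Z_of_int (((r j)%:Z * v 0%R j) %% m%:Z)%Z) (Z.mul zj (Z_of_int a)) =
      Z_of_int ((((r j)%:Z * v 0%R j) %% m%:Z)%Z - (r j)%:Z * a) by rewrite /zj; lia.
  by rewrite /zm Z_of_int_mod ?m_range // mulrBr [in RHS]modzDml.
rewrite coord_lin eqxx eq_sym (negbTE jk) mulr1 mulr0 subr0.
have -> : Z.sub (Z_of_int (((r k)%:Z * v 0%R k) %% m%:Z)%Z) (Z.mul zk (Z_of_int b)) =
    Z_of_int ((((r k)%:Z * v 0%R k) %% m%:Z)%Z - (r k)%:Z * b) by rewrite /zk; lia.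
by rewrite /zm Z_of_int_mod ?m_range // mulrBr [in RHS]modzDml.
Qed.

Lemma others_div_lin a b : others_div (lin a b).
Proof.
apply/forallP => l; apply/implyP => lj; apply/implyP => lk.
by rewrite !mxE /= (negbTE lj) (negbTE lk) !mulr0 dvdz0.
Qed.

Lemma vec_state_root_state a b : vec_state (lin a b) = root_state (Z_of_int a) (Z_of_int b).
Proof.
have ek : (r k)%:Z * A k j = (r j)%:Z * A j k by rewrite A_sym.
rewrite /vec_state /Submission.root_state others_div_lin; congr SX.
- have := gram_lin 0 a b; rewrite !pairz0 !mulr0 sub0r (gramNl A_sym) gramNr opprK.
  by rewrite (gram00 A r) /zj /zk /zB; lia.
- by rewrite /lin pairzD !pairzZ !pairz_simple A_diag /zj /zB; move: (A j k) => x; lia.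
- by rewrite /lin pairzD !pairzZ !pairz_simple A_diag /zk /zB -ek; move: (A k j) => x; lia.
- rewrite !mxE /= eqxx (negbTE jk) mulr1 mulr0 addr0 -Z_of_int_mod ?m_range //.
  by rewrite /zj; congr Z.modulo; lia.
rewrite !mxE /= eqxx [k == j]eq_sym (negbTE jk) mulr1 mulr0 add0r -Z_of_int_mod ?m_range //.
by rewrite /zk; congr Z.modulo; lia.
Qed.

Lemma long_divE v : long_div r m v <->
  [/\ others_div v, (m%:Z %| (r j)%:Z * v 0%R j)%Z & (m%:Z %| (r k)%:Z * v 0%R k)%Z].
Proof.
split=> [h|[/forallP h1 h2 h3] l].
  by split=> //; apply/forallP => l; rewrite (h l) !implybT.
have [->|lj] := eqVneq l j; first exact: h2.
have [->|lk] := eqVneq l k; first exact: h3.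
by have := h1 l; rewrite lj lk.
Qed.

Lemma vec_state_is_root v : state_is_root zm (vec_state v) <-> is_root v.
Proof.
rewrite /state_is_root /vec_state /Submission.is_root long_divE /zm; move: (gram v v) => N; split.
  case/orP=> [/Z.eqb_eq h|/and4P[/Z.eqb_eq h1 h2 /Z.eqb_eq h3 /Z.eqb_eq h4]]; [left|right].
    by lia.
  split; first by lia.
  by split=> //; apply/dvdz_mod0P; move: h3 h4; move: (_ %% _)%Z (_ %% _)%Z => a b; lia.
case=> [h|[h1 [h2 /dvdz_mod0P h3 /dvdz_mod0P h4]]]; apply/orP; [left|right].
  by rewrite h.
by rewrite h3 h4 h2 !andbT; apply/Z.eqb_eq; lia.
Qed.

Definition node_of (l : bool) : 'I_n := if l then j else k.

Definition sgn_lin (d : int) (l : bool) : 'rV[int]_n :=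
  lin (if l then d else 0) (if l then 0 else d).

Lemma sgn_linE d l : sgn_lin d l = d *: simple (node_of l).
Proof. by case: l; rewrite /sgn_lin /lin scale0r ?addr0 ?add0r. Qed.

(** The model tests whether a norm is zero, the crystal whether v is plus or minus a simple root;
    positive definiteness identifies the two. *)
Lemma step_vec_state (d : int) l v : step (Z_of_int d) l (vec_state v) =
  if v == d *: simple (node_of l) then Some (SY l)
  else if state_is_root zm (vec_state (v - d *: simple (node_of l)))
  then Some (vec_state (v - d *: simple (node_of l))) else None.
Proof.
rewrite -sgn_linE /sgn_lin vec_state_lin {1}/vec_state /Submission.step.
have -> : (if l then Z_of_int d else Z0) = Z_of_int (if l then d else 0) by case: l.
have -> : (if l then Z0 else Z_of_int d) = Z_of_int (if l then 0 else d) by case: l.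
rewrite norm_at_lin; congr (if _ then _ else _).
apply/idP/eqP => [/Z.eqb_eq h|->].
  apply/eqP; rewrite -subr_eq0; apply/eqP/(gram_eq0z D).
  by have := congr1 int_of_Z h; rewrite Z_of_intK.
by rewrite subrr (gram00 A r).
Qed.

Lemma vec_state_simple d l :
  vec_state (d *: simple (node_of l)) =
  if l then root_state (Z_of_int d) Z0 else root_state Z0 (Z_of_int d).
Proof. by rewrite -sgn_linE /sgn_lin vec_state_root_state; case: l. Qed.

Lemma in_box N P Q z p q : (N == 2) || (N == 2 * m%:Z) -> `|P| <= 6 -> `|Q| <= 6 ->
  0 <= p <= 2 -> 0 <= q <= 2 ->
  SX (Z_of_int N) (Z_of_int P) (Z_of_int Q) z (Z_of_int p) (Z_of_int q) \in box zm.
Proof.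
move=> hN hP hQ hp hq.
have six (x : int) : `|x| <= 6 -> Z_of_int x \in
   [:: Zneg 6; Zneg 5; Zneg 4; Zneg 3; Zneg 2; Zneg 1; Z0;
       Zpos 1; Zpos 2; Zpos 3; Zpos 4; Zpos 5; Zpos 6].
  by case: x => e hx; do 7 (try (case: e hx => [|e] hx; first by [])); lia.
have two (x : int) : 0 <= x <= 2 -> Z_of_int x \in [:: Z0; Zpos 1; Zpos 2].
  by case: x => e hx; do 3 (try (case: e hx => [|e] hx; first by [])); lia.
have hz : z \in [:: true; false] by case: z.
have hN' : Z_of_int N \in [:: Zpos 2; Z.mul (Zpos 2) zm].
  by case/orP: hN => /eqP ->; rewrite !inE ?eqxx // orbC; apply/orP; left; apply/eqP; rewrite /zm; lia.
rewrite /box; do 3 (rewrite in_cons; apply/orP; right).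
apply/flatten_mapP; exists (Z_of_int N) => //.
apply/flatten_mapP; exists (Z_of_int P); first exact: six.
apply/flatten_mapP; exists (Z_of_int Q); first exact: six.
apply/flatten_mapP; exists z => //.
apply/flatten_mapP; exists (Z_of_int p); first exact: two.
by apply: map_f; exact: two.
Qed.

(** The norms of v + alpha_i and v - alpha_i are nonnegative, so the absolute value is at most m +
    r_i <= 6. *)
Lemma pair_bound i v : is_root v -> `|(r i)%:Z * pairz i v| <= 6.
Proof.
move=> rv; have e c : gram (v + c *: simple i) (v + c *: simple i) =
    gram v v + 2 * c * ((r i)%:Z * pairz i v) + 2 * c ^+ 2 * (r i)%:Z.
  rewrite (gramDl A_sym) !gramDr (gramZl A_sym) !gramZr [gram v (simple _)](gram_sym A_sym).
  by rewrite (gramZl A_sym) !gram_simple pairz_simple A_diag; ring.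
have := gram_ge0z D (v + 1 *: simple i); have := gram_ge0z D (v + (-1) *: simple i).
rewrite !e !expr2; have := rd_r D i; have := rd_m D.
have : gram v v <= 2 * m%:Z by case: rv => [->|[->]] //; have := m_range; lia.
by move: (gram v v) (_ * pairz i v) => N P; lia.
Qed.

(** Modulo m the product (v, alpha_i) only sees the coordinates j and k, since all other r_l v_l are
    divisible by m. This is the congruence tested in [valid]. *)
Lemma pair_others i v : others_div v -> i = j \/ i = k ->
  (m%:Z %| (r i)%:Z * pairz i v - A j i * ((r j)%:Z * v 0%R j) - A k i * ((r k)%:Z * v 0%R k))%Z.
Proof.
move=> /forallP hv hi; rewrite /Submission.pairz mulr_sumr (bigD1 j) //= (bigD1 k) 1?eq_sym //=.
have -> : (r i)%:Z * (A i j * v 0 j) = A j i * ((r j)%:Z * v 0 j).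
  by rewrite mulrA A_sym; ring.
have -> : (r i)%:Z * (A i k * v 0 k) = A k i * ((r k)%:Z * v 0 k).
  by rewrite mulrA A_sym; ring.
rewrite [X in (_ %| X)%Z](_ : _ = \sum_(l | (l != j) && (l != k)) (r i)%:Z * (A i l * v 0 l));
  last by ring.
apply: rpred_sum => l /andP[lj lk].
have -> : (r i)%:Z * (A i l * v 0 l) = (r l)%:Z * v 0 l * A l i.
  by rewrite mulrA A_sym; ring.
by apply: dvdz_mulr; have := hv l; rewrite lj lk.
Qed.

Lemma valid_vec_state v : is_root v -> valid zm zj zk zB (vec_state v).
Proof.
move=> rv; have rs := proj2 (vec_state_is_root v) rv.
have m0 := m_range.
have mz : m%:Z != 0 by rewrite -lt0n.
have rpos i := proj1 (andP (rd_r D i)).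
rewrite /valid /vec_state -/(vec_state v) rs.
rewrite ifT; last first.
  have modP (x : int) : Z.modulo (Z_of_int x) zm = Z0 <-> (m%:Z %| x)%Z.
    rewrite /zm Z_of_int_mod //; split=> [h|/dvdz_mod0P -> //].
    by apply/dvdz_mod0P; have := congr1 int_of_Z h; rewrite Z_of_intK.
  have modP2 (p x y a : int) : (m%:Z %| p - 2 * (x %% m%:Z)%Z - a * (y %% m%:Z)%Z)%Z ->
      Z.modulo (Z.sub (Z.sub (Z_of_int p) (Z.mul 2 (Z_of_int (x %% m%:Z)%Z)))
        (Z.mul (Z_of_int a) (Z_of_int (y %% m%:Z)%Z))) zm = Z0.
    move=> h; rewrite (_ : Z.sub _ _ = Z_of_int (p - 2 * (x %% m%:Z)%Z - a * (y %% m%:Z)%Z)).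
      exact/modP.
    by move: (_ %% _)%Z (_ %% _)%Z => c d; lia.
  have lt (x : int) : Z.ltb (Z_of_int (x %% m%:Z)%Z) zm.
    apply/Z.ltb_lt; have := ltz_pmod x (m0 : 0 < m%:Z); rewrite /zm.
    by move: (x %% _)%Z => y; lia.
  have rmod i (x : int) : Z.eqb (Z.modulo (Z_of_int ((r i)%:Z * x)) (Z.of_nat (r i))) Z0.
    apply/Z.eqb_eq; rewrite Z_of_int_mod ?rpos //.
    by have /dvdz_mod0P -> : ((r i)%:Z %| (r i)%:Z * x)%Z by exact: dvdz_mulr.
  have zero i (x : int) : Z.eqb (Z.of_nat (r i)) zm ->
      Z.eqb (Z_of_int (((r i)%:Z * x) %% m%:Z)%Z) Z0.
    move=> /Z.eqb_eq h; have -> : r i = m by move: h; rewrite /zm; lia.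
    by rewrite modzMr.
  rewrite !lt /zj /zk !rmod !andTb; apply/and4P; split.
  - by apply/implyP => h; exact: zero.
  - by apply/implyP => h; exact: zero.
  - apply/implyP => hz; apply/andP; split; apply/Z.eqb_eq.
      have h := pair_others hz (or_introl erefl).
      have -> : Z.div zB (Z.of_nat (r k)) = Z_of_int (A k j).
        rewrite /zB A_sym; apply/esym/Z.div_unique_exact; first by have := rpos k; lia.
        by move: (A k j) => x; lia.
      apply: modP2; move: h; rewrite A_diag; exact: dvdz_residues.
    have h := pair_others hz (or_intror erefl).
    have -> : Z.div zB (Z.of_nat (r j)) = Z_of_int (A j k).
      rewrite /zB; apply/esym/Z.div_unique_exact; first by have := rpos j; lia.
      by move: (A j k) => x; lia.
    apply: modP2; move: h; rewrite A_diag => h; apply: dvdz_residues.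
    by rewrite addrAC.
  apply/implyP => /and3P[hz /Z.eqb_eq h1 /Z.eqb_eq h2]; apply/Z.eqb_eq.
  have ld : long_div r m v.
    apply/long_divE; split=> //; apply/dvdz_mod0P.
      by have := congr1 int_of_Z h1; rewrite Z_of_intK.
    by have := congr1 int_of_Z h2; rewrite Z_of_intK.
  have := gram_ge_div D (root_neq0 D rv) ld; rewrite /zm.
  by case: rv => [->|[-> _]]; lia.
apply/allP => a _; apply/allP => b _.
rewrite -(int_of_ZK a) -(int_of_ZK b) norm_at_lin.
move: (int_of_Z a) (int_of_Z b) => {}a {}b.
apply/andP; split.
  by apply/Z.leb_le; have := gram_ge0z D (v - lin a b); move: (gram _ _) => x; lia.
apply/implyP => /Z.eqb_eq h.
have vE : v = lin a b.
  apply/eqP; rewrite -subr_eq0; apply/eqP/(gram_eq0z D).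
  by have := congr1 int_of_Z h; rewrite Z_of_intK.
apply/andP; split; last by rewrite vE vec_state_root_state.
have ej : v 0 j = a by rewrite vE !mxE /= eqxx (negbTE jk) mulr1 mulr0 addr0.
have ek : v 0 k = b by rewrite vE !mxE /= eqxx [k == j]eq_sym (negbTE jk) mulr1 mulr0 add0r.
(* A root a alpha_j + b alpha_k has coordinates of one sign, so a b >= 0. *)
apply/Z.leb_le; case: (root_sign D rv) => hs; have := hs j; have := hs k; rewrite ej ek.
  by move=> a0 b0; nia.
by move=> a0 b0; nia.
Qed.

Lemma vec_state_states v : is_root v -> vec_state v \in states.
Proof.
move=> rv; rewrite mem_undup mem_filter valid_vec_state //.
have md (x : int) : 0 <= (x %% m%:Z)%Z <= 2.
  have := modz_ge0 x (lt0r_neq0 (m_range : 0 < m%:Z)).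
  have := ltz_pmod x (m_range : 0 < m%:Z); have := rd_m D.
  by move: (x %% _)%Z => y; lia.
apply: in_box => //; try exact: pair_bound.
by case: rv => [->|[-> _]]; rewrite eqxx ?orbT.
Qed.

Lemma SY_states l : is_root (simple (node_of l)) -> SY l \in states.
Proof.
move=> rl; rewrite mem_undup mem_filter; apply/andP; split; last first.
  by rewrite /box 3!in_cons; case: l {rl}.
rewrite /valid; have : (r (node_of l) == 1%N) || (r (node_of l) == m).
  by move: rl; rewrite /Submission.is_root (gram_simple_simple _ A_diag) => -[|[]]; lia.
by rewrite /zj /zk /zm; case: l {rl} => /=; case/orP=> /eqP ->; rewrite Z.eqb_refl ?orbT.
Qed.

Lemma SO_states : SO \in states.
Proof. by rewrite mem_undup mem_filter /box; apply/andP; split=> //; exact: mem_head. Qed.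

Lemma local_check : check zm zj zk zB.
Proof.
have pos : 0 < gram (simple j + simple k) (simple j + simple k).
  apply: (rd_pos D); apply/eqP => /(congr1 (fun x : 'rV[int]_n => x 0 j)).
  by rewrite !mxE !eqxx /= (negbTE jk).
have e1 : gram (simple j + simple k) (simple j + simple k) =
    2 * (r j)%:Z + 2 * (r k)%:Z + 2 * ((r j)%:Z * A j k).
  rewrite (gramDl A_sym) !gramDr !gram_simple !pairz_simple !A_diag.
  by rewrite [(r k)%:Z * A k j]A_sym; ring.
have e2 := A_sym j k; have o1 := rd_off D jk; have m0 := m_range.
have o2 : A k j <= 0 by apply: (rd_off D); rewrite eq_sym.
have rj := rd_r D j; have rk := rd_r D k; have rm := rd_m D.
rewrite e1 in pos; rewrite /zm /zj /zk /zB; apply: check_good.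
(* Positivity of the norm of alpha_j + alpha_k and symmetry leave few values of (alpha_j, alpha_k);
   the second case is G_2. *)
case: (rd_pair D jk) => [|[h1 h2 h3]].
  move: pos e2 o1 o2 m0 rj rk; rewrite !geq_max.
  move: (r j) (r k) (A j k) (A k j) => a b x y pos e2 o1 o2 m0 a0 b0 ab.
  have ha : a = 1%N \/ a = 2%N by lia.
  have hb : b = 1%N \/ b = 2%N by lia.
  have hm : m = 1%N \/ m = 2%N by lia.
  have hx : a%:Z * x = 0 \/ (a%:Z * x = -1 /\ a = 1%N /\ b = 1%N) \/
      (a%:Z * x = -2 /\ (a = 2%N \/ b = 2%N)).
    by move: pos e2; case: ha => ->; case: hb => ->; lia.
  case: hx => [->|[[-> [-> ->]]|[-> hab]]].
  - by case: hm => ->; case: ha => ->; case: hb => ->.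
  - by case: hm => ->.
  by case: ha hab => ->; case: hb => ->; case: hm => ->; case.
have hm : m = 1%N \/ m = 3%N by lia.
move: pos e2 o1 o2 h1 h3; move: (r j) (r k) (A j k) (A k j) => a b x y pos e2 o1 o2 h1 h3.
have hx : a%:Z * x = -3.
  by case/orP: h1 => /andP[/eqP ea /eqP eb]; move: pos e2 h3; rewrite ea eb; lia.
by rewrite hx; case: hm => ->; case/orP: h1 => /andP[/eqP -> /eqP ->].
Qed.

End LocalState.

(** * The two-colour states of crystal elements *)

Lemma string_lengthE (C : choiceType) (g : C -> option C) (c : C) (K : nat) :
  (forall i, (iter i (obind g) (Some c) <> None) <-> (i <= K)%N) -> string_length g c = K.
Proof.
move=> h; rewrite /string_length; apply: xget_unique.
  by split=> [|i]; rewrite ?h // => /h.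
move=> K' [/h K'K hK']; apply/eqP; rewrite eqn_leq K'K /=; apply: hK'.
exact/h.
Qed.

Lemma iter_obind_None (C : Type) (g : C -> option C) i : iter i (obind g) None = None.
Proof. by elim: i => //= i ->. Qed.

Section CrystalState.
Variables (n : nat) (A : 'M[int]_n) (r : 'I_n -> nat) (m : nat) (th : 'rV[int]_n).
Hypothesis D : root_datum A r m th.
Variables (B : crystal 'I_n 'rV[rat]_n) (node : B -> 'rV[int]_n * option 'I_n).
Hypothesis RC : root_crystal A r m node.
Local Notation is_root := (is_root A r m).
Local Notation gram := (gram A r).
Local Notation pairz := (pairz A).

Lemma f_e i (b c : B) : f_ i b = Some c <-> e_ i c = Some b.
Proof. by rewrite (rc_f RC) (rc_e RC). Qed.

Lemma nodeE (b : B) : node b = ((node b).1, (node b).2). Proof. by case: (node b). Qed.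

Section Pair.
Variables (j k : 'I_n).
Hypothesis jk : j != k.
Local Notation idx := (node_of j k).
Local Notation zm := (zm m).
Local Notation zj := (zj r j).
Local Notation zk := (zk r k).
Local Notation zB := (zB A r j k).
Local Notation step := (step zm zj zk zB).
Local Notation vec_state := (vec_state A r m j k).
Local Notation states := (states zm zj zk zB).

Definition node_state (nd : 'rV[int]_n * option 'I_n) : state :=
  match nd.2 with
  | None => vec_state nd.1
  | Some l => if l == j then SY true else if l == k then SY false else SO
  end.

Lemma node_state_idx l v : node_state (v, Some (idx l)) = SY l.
Proof.
by case: l; rewrite /node_state /= ?eqxx // eq_sym (negbTE jk).
Qed.

Lemma idx_cases i : (exists l, i = idx l) \/ (forall l, i != idx l).
Proof.
have [->|ij] := eqVneq i j; first by left; exists true.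
have [->|ik] := eqVneq i k; first by left; exists false.
by right; case.
Qed.

Lemma node_state_other i v : (forall l, i != idx l) -> node_state (v, Some i) = SO.
Proof. by move=> h; rewrite /node_state /= (negbTE (h true)) (negbTE (h false)). Qed.

Lemma idx_inj : injective idx.
Proof. by case=> -[] //= e; move: jk; rewrite e eqxx. Qed.

Lemma step_SY d l l' : step d l (SY l') =
  if l == l' then Some (if l then root_state zm zj zk zB (Z.opp d) Z0
                        else root_state zm zj zk zB Z0 (Z.opp d)) else None.
Proof. by case: l; case: l'. Qed.

Lemma state_f l (b : B) : omap (node_state \o node) (f_ (idx l) b) = step (Zpos 1) l (node_state (node b)).
Proof.
have out c : f_ (idx l) b = Some c <-> node_arrow (idx l) (node b) (node c) := rc_f RC _ _ _.
case tb: (node b).2 => [i|].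
  have [vb _] := rc_simple RC tb; have nb : node b = (0, Some i) by rewrite nodeE tb vb.
  have [[l' il]|hi] := idx_cases i; last first.
    rewrite nb (node_state_other _ hi) /=; case e: (f_ _ b) => [c|//].
    by move/out: e; rewrite nb => -[[]|[]|[[e]]] //; have := hi l; rewrite e eqxx.
  rewrite nb il node_state_idx step_SY; have [ll|ll] := eqVneq l l'; last first.
    case e: (f_ _ b) => [c|//]; move/out: e; rewrite nb => -[[]|[]|[[e]]] //.
    by move: e; rewrite il => /idx_inj e; rewrite e eqxx in ll.
  subst l' i; have [_ rl] := rc_simple RC tb.
  have [c nc] := rc_x RC (root_opp D rl).
  have -> : f_ (idx l) b = Some c by apply/out; rewrite nb nc; apply: Or33.
  rewrite /= nc /node_state /= -scaleN1r (vec_state_simple D jk).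
  by case: (l).
have rb := rc_root RC tb; have nb : node b = ((node b).1, None) by rewrite nodeE tb.
have -> : node_state (node b) = vec_state (node b).1 by rewrite /node_state tb.
rewrite (_ : Zpos 1 = Z_of_int 1) // (step_vec_state D jk) !scale1r.
case: eqP => [vb|vb].
  have [c nc] := rc_y RC (eq_ind _ is_root rb _ vb).
  have -> : f_ (idx l) b = Some c by apply/out; rewrite nb nc; apply: Or32.
  by rewrite /= nc node_state_idx.
case: ifP => hr.
  have [c nc] := rc_x RC (proj1 (vec_state_is_root A r m jk _) hr).
  have -> : f_ (idx l) b = Some c by apply/out; rewrite nb nc; apply: Or31.
  by rewrite /= nc.
case e: (f_ _ b) => [c|//]; move/out: e; rewrite nb => -[[_ /= c2 c1]|[_ /= e]|[]] //.
by have := rc_root RC c2; rewrite c1 => /(vec_state_is_root A r m jk); rewrite hr.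
Qed.

Lemma state_e l (b : B) : omap (node_state \o node) (e_ (idx l) b) = step (Zneg 1) l (node_state (node b)).
Proof.
have out c : e_ (idx l) b = Some c <-> node_arrow (idx l) (node c) (node b) := rc_e RC _ _ _.
case tb: (node b).2 => [i|].
  have [vb _] := rc_simple RC tb; have nb : node b = (0, Some i) by rewrite nodeE tb vb.
  have [[l' il]|hi] := idx_cases i; last first.
    rewrite nb (node_state_other _ hi) /=; case e: (e_ _ b) => [c|//].
    by move/out: e; rewrite nb => -[[]|[_ _ [e]]|[]] //; have := hi l; rewrite e eqxx.
  rewrite nb il node_state_idx step_SY; have [ll|ll] := eqVneq l l'; last first.
    case e: (e_ _ b) => [c|//]; move/out: e; rewrite nb => -[[]|[_ _ [e]]|[]] //.
    by move: e; rewrite il => /idx_inj e; rewrite e eqxx in ll.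
  subst l' i; have [_ rl] := rc_simple RC tb.
  have [c nc] := rc_x RC rl.
  have -> : e_ (idx l) b = Some c by apply/out; rewrite nb nc; apply: Or32.
  rewrite /= nc /node_state /= -[simple _]scale1r (vec_state_simple D jk).
  by case: (l).
have rb := rc_root RC tb; have nb : node b = ((node b).1, None) by rewrite nodeE tb.
have -> : node_state (node b) = vec_state (node b).1 by rewrite /node_state tb.
rewrite (_ : Zneg 1 = Z_of_int (-1)) // (step_vec_state D jk) !scaleN1r opprK.
case: eqP => [vb|vb].
  have rs : is_root (simple (idx l)) by rewrite -[simple _]opprK -vb; exact: (root_opp D).
  have [c nc] := rc_y RC rs.
  have -> : e_ (idx l) b = Some c by apply/out; rewrite nb nc; apply: Or33.
  by rewrite /= nc node_state_idx.
case: ifP => hr.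
  have [c nc] := rc_x RC (proj1 (vec_state_is_root A r m jk _) hr).
  have -> : e_ (idx l) b = Some c by apply/out; rewrite nb nc; apply: Or31; rewrite /= addrK.
  by rewrite /= nc.
case e: (e_ _ b) => [c|//]; move/out: e; rewrite nb => -[[/= c2 _ c1]|[]|[_ _ /= e]] //.
have := rc_root RC c2; rewrite -[(node c).1](subrK (simple (idx l))) -c1.
by move=> /(vec_state_is_root A r m jk); rewrite hr.
Qed.

Lemma state_states (b : B) : node_state (node b) \in states.
Proof.
rewrite nodeE /node_state /=; case tb: (node b).2 => [i|].
  have [_ ri] := rc_simple RC tb.
  case: (idx_cases i) => [[l il]|hi].
    by have := @node_state_idx l 0; rewrite /node_state /= -il => ->; apply: (SY_states D jk); rewrite -il.
  by have := @node_state_other i 0 hi; rewrite /node_state /= => ->; exact: SO_states.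
exact: (vec_state_states D jk (rc_root RC tb)).
Qed.

Lemma iter_count (d : Z) (l : bool) (g : B -> option B) fuel (b : B) :
  (forall c, omap (node_state \o node) (g c) = step d l (node_state (node c))) ->
  (count zm zj zk zB fuel d l (node_state (node b)) < fuel)%N ->
  forall i, (iter i (obind g) (Some b) <> None) <->
    (i <= count zm zj zk zB fuel d l (node_state (node b)))%N.
Proof.
move=> hg; elim: fuel b => // fuel IH b; rewrite /= -hg.
case e: (g b) => [c|] /= hc [|i] //=.
- rewrite -iterS iterSr /= e; exact: IH.
rewrite -iterS iterSr /= e iter_obind_None; by split.
Qed.

Lemma eps_count l (b : B) : eps (idx l) b = count zm zj zk zB 6 (Zneg 1) l (node_state (node b)).
Proof.
apply: string_lengthE; apply: iter_count; first exact: state_e.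
by case: (check_count l (local_check D jk) (state_states b)).
Qed.

Lemma phi_count l (b : B) : phi (idx l) b = count zm zj zk zB 6 (Zpos 1) l (node_state (node b)).
Proof.
apply: string_lengthE; apply: iter_count; first exact: state_f.
by case: (check_count l (local_check D jk) (state_states b)).
Qed.

Lemma arrow_vec i (b c : B) : node_arrow i (node b) (node c) -> (node c).1 = (node b).1 - simple i.
Proof.
by case=> [[_ _ //]|[_ -> ->]|[-> _ ->]] /=; rewrite ?subrr ?sub0r.
Qed.

Local Notation linkedB := (linked (fun l => f_ (idx l)) (fun l => e_ (idx l))).

Lemma linked_vec (c x : B) : linkedB c x -> exists a b, (node x).1 - (node c).1 = lin j k a b.
Proof.
have linD a b a' b' : lin j k a b + lin j k a' b' = lin j k (a + a') (b + b').
  by rewrite /lin addrACA -!scalerDl.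
elim=> [|l y z _ [a [b h]] /(rc_f RC)/arrow_vec ->|l y z _ [a [b h]] /(rc_e RC)/arrow_vec e].
- by exists 0, 0; rewrite /lin !scale0r addr0 subrr.
- rewrite addrAC h -[- simple _]scaleN1r -(sgn_linE j k (-1) l) /sgn_lin linD.
  by do 2 eexists.
have -> : (node z).1 - (node c).1 = (node y).1 - (node c).1 + 1 *: simple (idx l).
  by rewrite e scale1r addrAC subrK.
by rewrite h -sgn_linE /sgn_lin linD; do 2 eexists.
Qed.

(** A y_l with l other than j and k has no arrows of these colours, so it can only be linked to
    itself. This is why one state [SO] suffices for all of them. *)
Lemma linked_tag (c x : B) : linkedB c x ->
  x = c \/ (forall i, (node x).2 = Some i -> exists l, i = idx l).
Proof.
elim=> [|l y z _ _ /(rc_f RC) h|l y z _ _ /(rc_e RC) h]; first by left.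
  right=> i; case: h => [[_ -> //]|[_ _ ->] /= [<-]|[_ -> //]]; by exists l.
right=> i; case: h => [[-> //]|[-> //]|[-> _ _] /= [<-]]; by exists l.
Qed.

(** Two linked x's differ by a combination w of alpha_j and alpha_k. Equal states give (w, alpha_j)
    = (w, alpha_k) = 0, hence (w,w) = 0 and w = 0. *)
Lemma state_inj (c x x' : B) : linkedB c x -> linkedB c x' ->
  node_state (node x) = node_state (node x') -> x = x'.
Proof.
have main (y y' : B) : (forall i, (node y).2 = Some i -> exists l, i = idx l) ->
    node_state (node y) = node_state (node y') -> (node y).2 <> None -> y = y'.
  move=> hy; case ty: (node y).2 => [i|//]; have [l il] := hy _ ty.
  have [vy _] := rc_simple RC ty; move=> + _; rewrite (nodeE y) ty il vy node_state_idx.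
  rewrite (nodeE y'); case ty': (node y').2 => [i'|] //.
  have [vy' _] := rc_simple RC ty'.
  have [[l' il']|hi] := idx_cases i'; last by rewrite (node_state_other _ hi).
  rewrite il' node_state_idx => -[ll]; apply: (rc_inj RC).
  by rewrite (nodeE y) (nodeE y') ty ty' vy vy' il il' ll.
move=> hx hx' e.
case tx: (node x).2 => [i|].
  case: (linked_tag hx) => [xc|h]; last by apply: (main x x' h e); rewrite tx.
  case: (linked_tag hx') => [->|h']; first by [].
  apply/esym; apply: (main x' x h' (esym e)) => tx'.
  move: e; rewrite /node_state tx tx'; case: ifP => //; case: ifP => //.
case tx': (node x').2 => [i|].
  by move: e; rewrite /node_state tx tx'; case: ifP => //; case: ifP.
apply: (rc_inj RC); rewrite (nodeE x) (nodeE x') tx tx'; congr (_, _).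
apply/eqP; rewrite -subr_eq0; apply/eqP/(gram_eq0z D).
have [a [b h]] := linked_vec hx; have [a' [b' h']] := linked_vec hx'.
have dE : (node x).1 - (node x').1 = lin j k (a - a') (b - b').
  rewrite -[(node x).1](subrK (node c).1) -[(node x').1](subrK (node c).1) h h'.
  by rewrite opprD addrACA subrr addr0 /lin opprD addrACA -!scaleNr -!scalerDl.
move: e; rewrite /node_state tx tx' => -[_ eP eQ _ _ _].
have {}eP := congr1 int_of_Z eP; have {}eQ := congr1 int_of_Z eQ.
rewrite !Z_of_intK in eP eQ.
rewrite {1}dE /lin (gramDl (rd_sym D)) !(gramZl (rd_sym D)) !gramDr !gramNr.
by rewrite !gram_simple eP eQ !subrr !mulr0.
Qed.

Lemma PQ_node (b : B) : PQ (node_state (node b)) =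
  (Z_of_int ((r j)%:Z * pairz j (node b).1), Z_of_int ((r k)%:Z * pairz k (node b).1)).
Proof.
rewrite /node_state; case tb: (node b).2 => [i|] //.
have [-> _] := rc_simple RC tb; rewrite !pairz0 !mulr0.
by case: ifP => // _; case: ifP.
Qed.

End Pair.
End CrystalState.

(** * Gluing *)

Lemma iter_obind_downward (C : Type) (g : C -> option C) (c : C) (s t : nat) : (s <= t)%N ->
  iter t (obind g) (Some c) <> None -> iter s (obind g) (Some c) <> None.
Proof. by move=> st h e; apply: h; rewrite -(subnK st) iterD e iter_obind_None. Qed.

Lemma string_length_spec (C : choiceType) (g : C -> option C) (c : C) (N : nat) :
  (forall t, iter t (obind g) (Some c) <> None -> (t <= N)%N) ->
  forall t, iter t (obind g) (Some c) <> None <-> (t <= string_length g c)%N.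
Proof.
move=> bound; have ex : exists t, `[< iter t (obind g) (Some c) <> None >].
  by exists 0%N; apply/asboolP.
have bnd t : `[< iter t (obind g) (Some c) <> None >] -> (t <= N)%N by move/asboolP/bound.
case: (ex_maxnP ex bnd) => K /asboolP hK maxK.
have spec t : iter t (obind g) (Some c) <> None <-> (t <= K)%N.
  by split=> [h|tK]; [apply/maxK/asboolP | exact: iter_obind_downward hK].
by rewrite (string_lengthE spec).
Qed.

Lemma string_length_morph (C C' : choiceType) (h : C -> C') g g' (c : C) :
  (forall x, g' (h x) = omap h (g x)) -> string_length g' (h c) = string_length g c.
Proof.
move=> hg; have e t : iter t (obind g') (Some (h c)) = omap h (iter t (obind g) (Some c)).
  by elim: t => //= t ->; case: (iter t _ _) => //= x; rewrite hg.
rewrite /string_length; congr (xget 0%N _).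
have d t : (iter t (obind g') (Some (h c)) <> None) = (iter t (obind g) (Some c) <> None).
  by rewrite e; apply/propext; case: (iter t _ _).
apply/seteqP; split=> t /=.
  by rewrite d => -[h1 h2]; split=> // t'; rewrite -d; exact: h2.
by rewrite d => -[h1 h2]; split=> // t'; rewrite d; exact: h2.
Qed.

Section Tensor.
Variables (I : Type) (P : zmodType) (B : crystal I P).
Hypothesis fe : forall i (b c : B), f_ i b = Some c <-> e_ i c = Some b.
Hypothesis finite_e : forall i (b : B), exists N, forall t,
  iter t (obind (e_ i)) (Some b) <> None -> (t <= N)%N.
Hypothesis finite_f : forall i (b : B), exists N, forall t,
  iter t (obind (f_ i)) (Some b) <> None -> (t <= N)%N.

Lemma eps_spec i (b : B) t : iter t (obind (e_ i)) (Some b) <> None <-> (t <= eps i b)%N.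
Proof. by have [N hN] := finite_e i b; exact: string_length_spec hN t. Qed.

Lemma phi_spec i (b : B) t : iter t (obind (f_ i)) (Some b) <> None <-> (t <= phi i b)%N.
Proof. by have [N hN] := finite_f i b; exact: string_length_spec hN t. Qed.

Lemma eps_e i (b c : B) : e_ i c = Some b -> eps i c = (eps i b).+1.
Proof.
move=> e; apply/eqP; rewrite eqn_leq; apply/andP; split.
  have := proj2 (eps_spec i c (eps i c)) (leqnn _).
  by case: (eps i c) => // t; rewrite iterSr /= e => /eps_spec.
by apply/eps_spec; rewrite iterSr /= e; apply/eps_spec.
Qed.

Lemma phi_f i (b c : B) : f_ i b = Some c -> phi i b = (phi i c).+1.
Proof.
move=> e; apply/eqP; rewrite eqn_leq; apply/andP; split.
  have := proj2 (phi_spec i b (phi i b)) (leqnn _).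
  by case: (phi i b) => // t; rewrite iterSr /= e => /phi_spec.
by apply/phi_spec; rewrite iterSr /= e; apply/phi_spec.
Qed.

Lemma eps_eq0 i (b : B) : e_ i b = None -> eps i b = 0%N.
Proof.
move=> e; case h: (eps i b) => [//|t].
by have := proj2 (eps_spec i b 1); rewrite h /= e => /(_ isT).
Qed.

Lemma phi_eq0 i (b : B) : f_ i b = None -> phi i b = 0%N.
Proof.
move=> e; case h: (phi i b) => [//|t].
by have := proj2 (phi_spec i b 1); rewrite h /= e => /(_ isT).
Qed.

(** Applying f on the left lowers phi by one, turning the strict inequality of the f-rule into the
    weak one of the e-rule; on the right, eps grows by one. *)
Lemma tensor_f_e i (u v : tensor B B) : f_ i u = Some v <-> e_ i v = Some u.
Proof.
case: u => u1 u2; case: v => v1 v2 /=; split.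
  case: ltnP => h.
    case e: (f_ i u1) => [c|] // -[<- <-]; have := phi_f e => ph.
    by rewrite -ltnS -ph h (proj1 (fe _ _ _) e).
  case e: (f_ i u2) => [c|] // -[<- <-]; have ec := proj1 (fe _ _ _) e.
  by rewrite (eps_e ec) ltnNge h /= ec.
case: (leqP (eps i v2) (phi i v1)) => h.
  case e: (e_ i v1) => [c|] // -[<- <-]; have fc := proj2 (fe _ _ _) e.
  by rewrite (phi_f fc) ltnS h fc.
case e: (e_ i v2) => [c|] // -[<- <-]; have fc := proj2 (fe _ _ _) e.
by move: h; rewrite (eps_e e) ltnS leqNgt => /negbTE ->; rewrite fc.
Qed.

End Tensor.

Section Transfer.
Variables (I : eqType) (P : zmodType) (B : crystal I P).
Hypothesis fe : forall i (b c : B), f_ i b = Some c <-> e_ i c = Some b.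
Local Notation T := (tensor B B).
Hypothesis feT : forall i (u v : T), f_ i u = Some v <-> e_ i v = Some u.
Variables (x0 : B) (u0 : T).
Hypothesis x0_top : forall i, e_ i x0 = None.
Hypothesis x0_only : forall b : B, (forall i, e_ i b = None) -> b = x0.
Variable depth : B -> nat.
Hypothesis depth_e : forall i (b c : B), e_ i b = Some c -> (depth c < depth b)%N.

(* A word of f's leads from x0 to b and from u0 to u. *)
Inductive paired : B -> T -> Prop :=
| paired0 : paired x0 u0
| pairedS i b u b' u' : paired b u -> f_ i b = Some b' -> f_ i u = Some u' -> paired b' u'.

Definition well_paired (b : B) : Prop := exists u : T,
  [/\ paired b u, forall u', paired b u' -> u' = u, wt u = wt b &
      forall i, (f_ i u = None <-> f_ i b = None) /\ (e_ i u = None <-> e_ i b = None)].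

Lemma exists_raise b : b <> x0 -> exists i c, e_ i b = Some c.
Proof.
move=> bx; apply: contrapT => h; apply: bx; apply: x0_only => i.
by case e: (e_ i b) => [c|//]; case: h; exists i, c.
Qed.

Section Local.
Hypothesis another : forall j : I, exists k, k != j.
Hypothesis wt_u0 : wt u0 = wt x0.
Hypothesis u0_top : forall i, e_ i u0 = None.
Variable al : I -> P.
Hypothesis wt_f : forall i (b c : B), f_ i b = Some c -> wt c = wt b - al i.

Local Notation runB j k := (Frun (fun l => @f_ _ _ B (if l then j else k))).
Local Notation runT j k := (Frun (fun l => @f_ _ _ T (if l then j else k))).

Hypothesis local : forall j k, j != k -> forall (c : B) (u : T),
  (forall l, e_ (if l then j else k) c = None) -> (forall l, e_ (if l then j else k) u = None) ->
  wt u = wt c ->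
  forall w x, runB j k c w = Some x -> exists y, [/\ runT j k u w = Some y,
    forall l, (f_ (if l then j else k) y = None <-> f_ (if l then j else k) x = None) /\
              (e_ (if l then j else k) y = None <-> e_ (if l then j else k) x = None) &
    forall l x1, e_ (if l then j else k) x = Some x1 ->
      exists2 w1, runB j k c w1 = Some x1 & e_ (if l then j else k) y = runT j k u w1].

Lemma wt_f_tensor i (u v : T) : f_ i u = Some v -> wt v = wt u - al i.
Proof.
case: u => u1 u2 /=; case: ifP => _.
  by case e: (f_ i u1) => [c|//] [<-] /=; rewrite (wt_f e) addrAC.
by case e: (f_ i u2) => [c|//] [<-] /=; rewrite (wt_f e) addrA.
Qed.

Lemma paired_run j k c u w x y : paired c u -> runB j k c w = Some x ->
  runT j k u w = Some y -> paired x y.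
Proof.
move=> cu; elim: w x y => [|l w IH] x y /=; first by move=> [<-] [<-].
case e: (runB j k c w) => [x'|//]; case e': (runT j k u w) => [y'|//].
exact: pairedS (IH _ _ e e').
Qed.

Lemma climb j k b : exists c w, [/\ (depth c <= depth b)%N,
  forall l, e_ (if l then j else k) c = None & runB j k c w = Some b].
Proof.
have [d] := ubnP (depth b); elim: d b => // d IH b; rewrite ltnS => hd.
case: (pselect (forall l, e_ (if l then j else k) b = None)) => [h|h].
  by exists b, [::].
have [l [b' eb]] : exists l b', e_ (if l then j else k) b = Some b'.
  apply: contrapT => h'; apply: h => l.
  by case e: (e_ _ b) => [b'|//]; case: h'; exists l, b'.
have [c [w [dc tc rc]]] := IH b' (leq_trans (depth_e eb) hd).
exists c, (l :: w); split=> //; first exact: leq_trans dc (ltnW (depth_e eb)).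
by rewrite /= rc; exact/fe.
Qed.

(** Induction on the depth. Take an arrow b' -> b of colour j and let u be f_j of the partner of b'.
    For each k the local statement is applied at a {j,k}-highest element above b'; it always returns
    this same u, so u has the right arrows of every colour. *)
Lemma all_well_paired b : well_paired b.
Proof.
have [d] := ubnP (depth b); elim: d b => // d IH b; rewrite ltnS => hd.
case: (pselect (b = x0)) => [->|/exists_raise[j [b' eb]]].
  exists u0; split=> //; first exact: paired0.
    move=> u' h; inversion h => //; subst.
    by move/fe: H0; rewrite x0_top.
  move=> i; have [k ki] := another i; rewrite eq_sym in ki.
  (* The empty word compares the arrows at x0 and u0 themselves. *)
  have [||y [[<-] /(_ true) h _]] := local ki (c := x0) (u := u0) _ _ wt_u0 (w := [::]) erefl.
  - by move=> l; exact: x0_top.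
  - by move=> l; exact: u0_top.
  exact: h.
have fb := proj2 (fe _ _ _) eb; have hd' := leq_trans (depth_e eb) hd.
have [u' [pu' uniq' wu' top']] := IH b' hd'.
have [u fu] : exists u, f_ j u' = Some u.
  case e: (f_ j u') => [u|]; first by exists u.
  by move: fb; rewrite (proj1 (proj1 (top' j)) e).
have pair k : j != k -> forall l,
    [/\ f_ (if l then j else k) u = None <-> f_ (if l then j else k) b = None,
        e_ (if l then j else k) u = None <-> e_ (if l then j else k) b = None &
        forall x1, e_ (if l then j else k) b = Some x1 ->
          exists2 y1, e_ (if l then j else k) u = Some y1 & paired x1 y1].
  move=> jk; have [c [w [dc tc rc]]] := climb j k b'.
  have [uc [puc _ wuc topc]] := IH c (leq_ltn_trans dc hd').
  have tuc l : e_ (if l then j else k) uc = None by apply/(proj2 (topc _)).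
  have loc := local jk tc tuc wuc.
  have [y' [ry' _ _]] := loc _ _ rc.
  (* Uniqueness of the partner of b' makes the outcome independent of k. *)
  have yu : y' = u' by apply: uniq'; exact: paired_run puc rc ry'.
  subst y'.
  have rb : runB j k c (true :: w) = Some b by rewrite /= rc.
  have [y [ry hy hy']] := loc _ _ rb.
  have yu : y = u by move: ry; rewrite [runT _ _ _ _]/(obind _ (runT j k uc w)) ry' => /(etrans (esym fu))[].
  subst y => l; have [h1 h2] := hy l; split=> // x1 ex1.
  have [w1 r1 r2] := hy' _ _ ex1; have [y1 [ry1 _ _]] := loc _ _ r1.
  by exists y1; [rewrite r2 | exact: paired_run puc r1 ry1].
have {}pair i : [/\ f_ i u = None <-> f_ i b = None, e_ i u = None <-> e_ i b = None &
    forall x1, e_ i b = Some x1 -> exists2 y1, e_ i u = Some y1 & paired x1 y1].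
  have [ij|ij] := eqVneq j i; last exact: pair ij false.
  by have [k] := another j; rewrite eq_sym => /pair/(_ true); rewrite ij.
exists u; split.
- exact: pairedS pu' fb fu.
(* Another path to b ends with some b2 -> b of colour i, with partner v2 of b2. By the last clause
   of [pair], e_i u is a partner of b2 as well, so it equals v2, and v = f_i v2 = u. *)
- move=> v h; inversion h as [|i b2 v2 b3 v3 pv fb2 fv2]; subst.
    by move: eb; rewrite x0_top.
  have eb2 := proj1 (fe _ _ _) fb2.
  have [_ _ /(_ _ eb2)[y1 ey1 py1]] := pair i.
  have [v0 [_ uniq _ _]] := IH b2 (leq_trans (depth_e eb2) hd).
  have yv : y1 = v2 by rewrite (uniq _ py1) (uniq _ pv).
  by subst y1; move/feT: ey1; rewrite fv2 => -[].
- by rewrite (wt_f_tensor fu) wu' (wt_f fb).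
by move=> i; have [h1 h2 _] := pair i.
Qed.

End Local.

Hypothesis all_paired : forall b, well_paired b.

Definition transfer (b : B) : T := projT1 (cid (all_paired b)).

Lemma transferP b : [/\ paired b (transfer b), forall u', paired b u' -> u' = transfer b,
  wt (transfer b) = wt b &
  forall i, (f_ i (transfer b) = None <-> f_ i b = None) /\
            (e_ i (transfer b) = None <-> e_ i b = None)].
Proof. by rewrite /transfer; case: cid. Qed.

Lemma transfer_f i b : f_ i (transfer b) = omap transfer (f_ i b).
Proof.
have [h1 _ _ /(_ i)[h4 _]] := transferP b.
case e: (f_ i b) => [c|] /=; last exact/h4.
case e': (f_ i (transfer b)) => [v|]; last by move: e; rewrite (proj1 h4 e').
have [_ uniq _ _] := transferP c; rewrite -(uniq v) //; exact: pairedS h1 e e'.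
Qed.

Lemma transfer_e i b : e_ i (transfer b) = omap transfer (e_ i b).
Proof.
have [_ _ _ /(_ i)[_ h4]] := transferP b.
case e: (e_ i b) => [c|] /=; last exact/h4.
by apply/feT; rewrite transfer_f (proj2 (fe _ _ _) e).
Qed.

Lemma transfer_x0 : transfer x0 = u0.
Proof. by have [_ uniq _ _] := transferP x0; rewrite (uniq _ paired0). Qed.

(** Elements with the same image admit the same raising operators, so both can be raised together
    until one, and hence the other, is x0. *)
Lemma transfer_inj : injective transfer.
Proof.
move=> b; have [d] := ubnP (depth b); elim: d b => // d IH b; rewrite ltnS => hd b' e.
have key i : (e_ i b = None <-> e_ i b' = None).
  have [_ _ _ /(_ i)[_ <-]] := transferP b; have [_ _ _ /(_ i)[_ <-]] := transferP b'.
  by rewrite e.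
case: (pselect (b = x0)) => [bx|/exists_raise[i [c ec]]].
  by rewrite bx; apply/esym/x0_only => i; apply/key; rewrite bx.
case ec': (e_ i b') => [c'|]; last by move: ec; rewrite (proj2 (key i) ec').
have : transfer c = transfer c'.
  have h1 := transfer_e i b; have h2 := transfer_e i b'.
  by move: h2; rewrite -e h1 ec ec' => -[].
move=> /(IH c (leq_trans (depth_e ec) hd)) cc; subst c'.
by have := proj2 (fe _ _ _) ec; rewrite (proj2 (fe _ _ _) ec') => -[].
Qed.

Lemma connected_transfer b : connected u0 (transfer b).
Proof.
have [d] := ubnP (depth b); elim: d b => // d IH b; rewrite ltnS => hd.
case: (pselect (b = x0)) => [->|/exists_raise[i [c ec]]].
  by rewrite transfer_x0; exact: rst_refl.
apply: rst_trans (IH c (leq_trans (depth_e ec) hd)) _; apply: rst_step; exists i.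
by rewrite transfer_f (proj2 (fe _ _ _) ec).
Qed.

Lemma transfer_connected v : connected u0 v -> exists b, v = transfer b.
Proof.
have key u w : connected u w -> (exists b, u = transfer b) <-> (exists b, w = transfer b).
  elim=> [{}u {}w [i e]|//|? ? _ [h1 h2]|? ? ? _ [h1 h2] _ [h3 h4]]; last 2 first.
  - by split.
  - by split=> h; auto.
  split=> -[b eb].
    by move: e; rewrite eb transfer_f; case: (f_ i b) => // c [<-]; exists c.
  by move/feT: e; rewrite eb transfer_e; case: (e_ i b) => // c [<-]; exists c.
move=> /key [h _]; apply: h; exists x0; exact/esym/transfer_x0.
Qed.

Theorem transfer_isomorphic : crystal_isomorphic B (component (C := T) u0).
Proof.
pose S : set T := [set c | connected u0 c]%classic.
have hS b : transfer b \in S by apply/mem_set/connected_transfer.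
pose h (b : B) : component (C := T) u0 := exist _ (transfer b) (hS b).
have insubS b : insub (transfer b) = Some (h b) :> option (component (C := T) u0).
  rewrite (insubT (fun c => c \in S) (hS b)); congr (Some _); exact: val_inj.
have he i b : e_ i (h b) = omap h (e_ i b).
  have -> : e_ i (h b) = obind insub (e_ i (transfer b)) by [].
  by rewrite transfer_e; case: (e_ i b) => //= c; rewrite insubS.
have hf i b : f_ i (h b) = omap h (f_ i b).
  have -> : f_ i (h b) = obind insub (f_ i (transfer b)) by [].
  by rewrite transfer_f; case: (f_ i b) => //= c; rewrite insubS.
exists h; split.
  have surj (v : component (C := T) u0) : exists b, h b = v.
    have [b eb] := transfer_connected (set_mem (valP v)); exists b; exact/val_inj/esym.
  pose g v := projT1 (cid (surj v)); have hg v : h (g v) = v by rewrite /g; case: cid.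
  exists g => // b; apply: transfer_inj.
  by have /(congr1 val) := hg (h b).
move=> b; split; first by have [_ _ + _] := transferP b.
move=> i; split=> //; exact: string_length_morph.
Qed.

End Transfer.

(** * The component of x_theta (x) y_i *)

Section Component.
Variables (n : nat) (A : 'M[int]_n) (r : 'I_n -> nat) (m : nat) (th : 'rV[int]_n).
Hypothesis D : root_datum A r m th.
Variable L : 'rV[int]_n -> Prop.
Hypothesis W : weight_set A th L.
Variables (B : crystal 'I_n 'rV[rat]_n) (node : B -> 'rV[int]_n * option 'I_n).
Hypothesis RC : root_crystal A r m node.
Local Notation is_root := (is_root A r m).
Local Notation T := (tensor B B).
Local Notation vec b := (node b).1.

Let fe := f_e RC.

Lemma root_le v i : is_root v -> v 0 i <= th 0 i.
Proof. by move=> rv; apply: (ws_le W); exact: (proj2 (L_iff D W (root_neq0 D rv)) rv). Qed.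

Lemma vec_bounds (b : B) i : - th 0 i <= vec b 0 i <= th 0 i.
Proof.
case tb: (node b).2 => [j|].
  have [-> _] := rc_simple RC tb; have := rd_thpos D i; rewrite mxE.
  by move: (th 0 i) => a; lia.
have rb := rc_root RC tb; have := root_le i rb; have := root_le i (root_opp D rb).
by rewrite mxE lerNl => -> ->.
Qed.

Lemma height_bounds (b : B) : - height th <= height (vec b) <= height th.
Proof.
by rewrite -sumrN; apply/andP; split; apply: ler_sum => i _; have /andP[] := vec_bounds b i.
Qed.

Lemma height_e i (b c : B) : e_ i b = Some c -> height (vec c) = height (vec b) + 1.
Proof.
move/(rc_e RC)/arrow_vec => ->; rewrite /height -[in RHS](_ : \sum_k simple i 0 k = 1).
  by rewrite -big_split; apply: eq_bigr => k _; rewrite mxE [in RHS]mxE /= -addrA addNr addr0.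
by rewrite (bigD1 i) //= big1 => [|k ki]; rewrite mxE ?eqxx //= (negbTE ki).
Qed.

Lemma finite_e i (b : B) : exists N, forall t,
  iter t (obind (e_ i)) (Some b) <> None -> (t <= N)%N.
Proof.
exists `|2 * height th : int|%N => t.
have key c : iter t (obind (e_ i)) (Some b) = Some c -> height (vec c) = height (vec b) + t%:Z.
  elim: t c => [|t IH] c /=; first by move=> [->]; rewrite addr0.
  case e: (iter t _ _) => [d|] //= /height_e ->; rewrite (IH _ e); lia.
case e: (iter t _ _) => [c|] // _; have := key _ e.
by have := height_bounds b; have := height_bounds c; lia.
Qed.

Lemma finite_f i (b : B) : exists N, forall t,
  iter t (obind (f_ i)) (Some b) <> None -> (t <= N)%N.
Proof.
exists `|2 * height th : int|%N => t.
have key c : iter t (obind (f_ i)) (Some b) = Some c -> height (vec b) = height (vec c) + t%:Z.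
  elim: t c => [|t IH] c /=; first by move=> [->]; rewrite addr0.
  case e: (iter t _ _) => [d|] //= /fe/height_e h; rewrite (IH _ e) h; lia.
case e: (iter t _ _) => [c|] // _; have := key _ e.
by have := height_bounds b; have := height_bounds c; lia.
Qed.

Let feT := tensor_f_e fe finite_e finite_f.
Let depth (b : B) := `|height th - height (vec b)|%N.

Lemma depth_e i (b c : B) : e_ i b = Some c -> (depth c < depth b)%N.
Proof. by move/height_e; rewrite /depth; have := height_bounds c; lia. Qed.

Variables (x0 : B) (i0 : 'I_n) (y0 : B).
Hypothesis node_x0 : node x0 = (th, None).
Hypothesis node_y0 : node y0 = (0, Some i0).
Hypothesis th_i0 : 0 < pairz A i0 th.
Local Notation u0 := ((x0, y0) : T).

Lemma x0_top i : e_ i x0 = None.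
Proof.
case e: (e_ i x0) => [c|//]; have := height_e e.
by rewrite node_x0 /=; have := height_bounds c; lia.
Qed.

Lemma root_i0 : is_root (simple i0).
Proof. by have := @rc_simple _ _ _ _ _ _ RC y0 i0; rewrite node_y0 => -[]. Qed.

Lemma x0_only (b : B) : (forall i, e_ i b = None) -> b = x0.
Proof.
move=> h; have bad i c : ~ node_arrow i (node c) (node b).
  by move/(rc_e RC); rewrite h.
case tb: (node b).2 => [j|].
  have [vb rj] := rc_simple RC tb; have [c nc] := rc_x RC rj.
  by case: (bad j c); apply: Or32; rewrite nc (nodeE node b) tb vb.
have rb := rc_root RC tb; have [vb|vb] := eqVneq (vec b) th.
  by apply: (rc_inj RC); rewrite node_x0 (nodeE node b) vb tb.
have [i [e|ri]] := root_raise D W rb vb.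
  have ri : is_root (simple i) by rewrite -[simple i]opprK -e; exact: (root_opp D rb).
  by have [c nc] := rc_y RC ri; case: (bad i c); apply: Or33; rewrite nc tb e.
by have [c nc] := rc_x RC ri; case: (bad i c); apply: Or31; rewrite nc tb /= addrK.
Qed.

Lemma f_x0 : f_ i0 x0 <> None.
Proof.
have [e|ne] := eqVneq th (simple i0).
  have -> : f_ i0 x0 = Some y0 by apply/(rc_f RC); apply: Or32; rewrite node_x0 node_y0.
  by [].
have Lt : L (th - 1 *: simple i0) by apply: (ws_down (t := 1) W (ws_th W)).
rewrite scale1r in Lt; have [|c nc] := rc_x RC (L_root D W Lt _); first by rewrite subr_eq0.
have -> : f_ i0 x0 = Some c by apply/(rc_f RC); apply: Or31; rewrite node_x0 nc.
by [].
Qed.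

Lemma eps_y0 : eps i0 y0 = 1%N.
Proof.
have [c nc] := rc_x RC root_i0.
have e : e_ i0 y0 = Some c by apply/(rc_e RC); apply: Or32; rewrite nc node_y0.
rewrite (eps_e finite_e e) (eps_eq0 finite_e) //.
case e': (e_ i0 c) => [d|//]; move/(rc_e RC): e'; rewrite nc.
case=> [[td _ /= vd]|[_ _ []//]|[_ _ /= e']].
  (* An arrow into x_{alpha_i} from an x would make 2 alpha_i a root, but its norm 8 r_i exceeds 2m
     <= 6. *)
  have := rc_root RC td; rewrite -[vec d](subrK (simple i0)) -vd /Submission.is_root -mulr2n -scaler_nat.
  rewrite (gramZl (rd_sym D)) gramZr gram_simple_simple; last exact: rd_diag D.
  by have := rd_r D i0; have := rd_m D; lia.
by have := congr1 (fun v : 'rV_n => v 0 i0) e'; rewrite !mxE !eqxx.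
Qed.

(** For i = i0, phi of x_theta is at least 1, which is eps of y_{i0}; the tensor rule therefore
    applies e to x_theta, where it gives zero. *)
Lemma u0_top i : e_ i u0 = None.
Proof.
rewrite /= x0_top; case: ifP => // h; case e: (e_ i y0) => [c|//].
move/(rc_e RC): e; rewrite node_y0 => -[[_ //]|[_ _ [ii]]|[_ //]].
move: h; rewrite -ii eps_y0; case e: (f_ i0 x0) => [d|]; last by case: f_x0.
by rewrite (phi_f finite_f e).
Qed.

Lemma wt_u0 : wt u0 = wt x0.
Proof. by rewrite /= !(rc_wt RC) node_x0 node_y0 /= ratv0 addr0. Qed.

Lemma wt_f_simple i (b c : B) : f_ i b = Some c -> wt c = wt b - ratv (simple i).
Proof. by move/(rc_f RC)/arrow_vec => e; rewrite !(rc_wt RC) e ratvD ratvN. Qed.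

Lemma transport_pair j k : j != k -> forall (c : B) (u : T),
  (forall l, e_ (node_of j k l) c = None) -> (forall l, e_ (node_of j k l) u = None) ->
  wt u = wt c ->
  forall w x, Frun (fun l => @f_ _ _ B (node_of j k l)) c w = Some x -> exists y,
  [/\ Frun (fun l => @f_ _ _ T (node_of j k l)) u w = Some y,
    forall l, (f_ (node_of j k l) y = None <-> f_ (node_of j k l) x = None) /\
              (e_ (node_of j k l) y = None <-> e_ (node_of j k l) x = None) &
    forall l x1, e_ (node_of j k l) x = Some x1 ->
      exists2 w1, Frun (fun l => @f_ _ _ B (node_of j k l)) c w1 = Some x1 &
        e_ (node_of j k l) y = Frun (fun l => @f_ _ _ T (node_of j k l)) u w1].
Proof.
move=> jk c u tc tu wu w x hx.
have vu : vec c = vec u.1 + vec u.2.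
  by apply: ratv_inj; rewrite ratvD -!(rc_wt RC) -wu.
have PQu a : Z.add (Z_of_int ((r a)%:Z * pairz A a (vec u.1)))
    (Z_of_int ((r a)%:Z * pairz A a (vec u.2))) = Z_of_int ((r a)%:Z * pairz A a (vec c)).
  by rewrite vu pairzD mulrDr; lia.
have [||y [h1 h2 h3]] := local_transport (local_check D jk) (state_f D RC jk) (state_e D RC jk)
  (state_states D RC jk) (eps_count D RC jk) (phi_count D RC jk)
  (fun c x x' => @state_inj _ _ _ _ _ D _ _ RC _ _ jk c x x') tc tu _ _ hx.
- by rewrite !(PQ_node RC); exact: PQu.
- by rewrite !(PQ_node RC); exact: PQu.
by exists y.
Qed.

(** The strings are x -> y -> z and (x,y) -> (y,y) -> (y,z), with z of weight - alpha_{i0}. *)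
Lemma well_paired_single : (forall j, j = i0) -> forall b, well_paired x0 u0 b.
Proof.
move=> single; have vE (v : 'rV[int]_n) : v = v 0 i0 *: simple i0.
  by apply/rowP => j; rewrite (single j) !mxE !eqxx mulr1.
have gE a : gram A r (a *: simple i0) (a *: simple i0) = a * a * (2 * (r i0)%:Z).
  by rewrite (gramZl (rd_sym D)) gramZr (gram_simple_simple _ (rd_diag D)) mulrA.
have th1 : th 0 i0 = 1.
  (* From t^2 k = l with k and l between 1 and 3, t = 2 would already require l >= 4. *)
  have sq (t : int) (k l : nat) : 0 < t -> t * t * (2 * k%:Z) = 2 * l%:Z ->
      (0 < k <= 3)%N -> (0 < l <= 3)%N -> t = 1 by nia.
  have e := rd_norm D; rewrite (vE th) gE in e.
  exact: sq (rd_thpos D i0) e (rd_r D i0) (rd_m D).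
have nx0 : node x0 = (simple i0, None) by rewrite node_x0 (vE th) th1 scale1r.
have [z0 nz0] := rc_x RC (root_opp D root_i0).
have fx : f_ i0 x0 = Some y0 by apply/(rc_f RC); rewrite nx0 node_y0; apply: Or32.
have fy : f_ i0 y0 = Some z0 by apply/(rc_f RC); rewrite node_y0 nz0; apply: Or33.
have fz : f_ i0 z0 = None.
  case e: (f_ i0 z0) => [c|//]; move/(rc_f RC)/arrow_vec: e; rewrite nz0 /= => vc.
  by have /andP[] := vec_bounds c i0; rewrite vc th1 !mxE !eqxx.
have [ey ez] := (proj1 (fe _ _ _) fx, proj1 (fe _ _ _) fy).
have [epx epy epz] : [/\ eps i0 x0 = 0, eps i0 y0 = 1 & eps i0 z0 = 2]%N.
  by split; rewrite ?(eps_e finite_e ez) ?eps_y0 // (eps_eq0 finite_e) ?x0_top.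
have [phx phy phz] : [/\ phi i0 x0 = 2, phi i0 y0 = 1 & phi i0 z0 = 0]%N.
  have h := phi_eq0 finite_f fz.
  by rewrite (phi_f finite_f fx) (phi_f finite_f fy) h.
have cases b : [\/ b = x0, b = y0 | b = z0].
  case tb: (node b).2 => [j|].
    apply: Or32; apply: (rc_inj RC); rewrite (nodeE node b) tb (single j) node_y0.
    by have [-> _] := rc_simple RC tb.
  have rb := root_neq0 D (rc_root RC tb); have := vec_bounds b i0; rewrite th1 => hb.
  have : (vec b 0 i0 == 1) || (vec b 0 i0 == -1).
    have unit (a : int) : - 1 <= a <= 1 -> a != 0 -> (a == 1) || (a == -1) by lia.
    by apply: unit hb _; apply: contra rb => /eqP e; rewrite (vE (vec b)) e scale0r.
  case/orP=> /eqP e; [apply: Or31|apply: Or33]; apply: (rc_inj RC);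
    by rewrite (nodeE node b) tb (vE (vec b)) e ?nx0 ?nz0 ?scale1r ?scaleN1r.
have fu0 : f_ i0 u0 = Some (y0, y0) by rewrite /= epy phx fx.
have fu1 : f_ i0 ((y0, y0) : T) = Some (y0, z0) by rewrite /= epy phy fy.
have fu2 : f_ i0 ((y0, z0) : T) = None by rewrite /= epz phy fz.
have eu1 : e_ i0 ((y0, y0) : T) = Some u0 by apply/feT.
have eu2 : e_ i0 ((y0, z0) : T) = Some (y0, y0) by apply/feT.
have px : paired x0 u0 x0 u0 by exact: paired0.
have py : paired x0 u0 y0 (y0, y0) by exact: pairedS px fx fu0.
have pz : paired x0 u0 z0 (y0, z0) by exact: pairedS py fy fu1.
have shape b u : paired x0 u0 b u -> [\/ b = x0 /\ u = u0, b = y0 /\ u = (y0, y0) |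
    b = z0 /\ u = (y0, z0)].
  elim=> [|i {}b {}u b' u' _ IH]; first by apply: Or31.
  rewrite (single i); case: IH => -[-> ->].
  - by rewrite fx fu0 => -[<-] [<-]; apply: Or32.
  - by rewrite fy fu1 => -[<-] [<-]; apply: Or33.
  by rewrite fz.
have wy := wt_f_simple fx; have wz := wt_f_simple fy.
have xy : x0 <> y0 by move=> e; have := node_x0; rewrite e node_y0.
have xz : x0 <> z0 by move=> e; move: epz; rewrite -e epx.
have yz : y0 <> z0 by move=> e; move: epz; rewrite -e epy.
move=> b; case: (cases b) => ->.
- exists u0; split=> //; last by move=> i; rewrite (single i) fx fu0 u0_top x0_top.
    by move=> u /shape[[_ ->] //|[/xy //]|[/xz //]].
  exact: wt_u0.
- exists (y0, y0); split=> //; last by move=> i; rewrite (single i) fy fu1 ey eu1.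
    by move=> u /shape[[/esym/xy //]|[_ ->] //|[/yz //]].
  by rewrite (wt_f_tensor wt_f_simple fu0) wt_u0 -wy.
exists (y0, z0); split=> //; last by move=> i; rewrite (single i) fz fu2 ez eu2.
  by move=> u /shape[[/esym/xz //]|[/esym/yz //]|[_ ->] //].
by rewrite (wt_f_tensor wt_f_simple fu1) (wt_f_tensor wt_f_simple fu0) wt_u0 -wy -wz.
Qed.

Theorem component_isomorphic : crystal_isomorphic B (component (C := T) u0).
Proof.
apply: (transfer_isomorphic fe feT x0_top x0_only depth_e).
case: (pselect (forall j : 'I_n, exists k, k != j)) => [another|single].
  exact: (all_well_paired fe feT x0_top x0_only depth_e another wt_u0 u0_top wt_f_simple
    transport_pair).
apply: well_paired_single => j; apply: contrapT => ji; apply: single => k.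
have [->|ki] := eqVneq k i0; last by exists i0; rewrite eq_sym.
by exists j; apply/eqP.
Qed.

End Component.

Theorem proposition5p3
    (X : affine_type) (hX : in_range X)
    (s : 'I_(rank X) -> nat) (hs : symmetrizer (finite_cartan X) s)
    (V : lmodType Qq) (M : uq_module (finite_cartan X) s V)
    (irrM : irreducible M) (hwM : has_highest_weight M (theta X))
    (i : 'I_(rank X)) (adj_i : affine_cartan X ord0 (lift ord0 i) != 0)
    (hi : Lambda_pos M (alpha i)) :
  let x_theta := x_ (or_introl (theta_Lambda_pos hX hwM)) in
  crystal_isomorphic (B_crystal M)
    (component (C := tensor (B_crystal M) (B_crystal M)) (x_theta, y_ hi)).
Proof.
have hA : ~~ is_Aeven2 X by case: (hi) => Li _ _; exact: (Lambda_not_Aeven2 hX irrM hwM Li).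
apply: (component_isomorphic (affine_root_datum hX hA) (module_weight_set hX hs irrM hwM hA)
  (B_root_crystal hX hs irrM hwM hA) (i0 := i)).
- exact: (B_node_x _ (theta_ratv hA)).
- by [].
(* The adjacency hypothesis concerns a_{0i}; symmetrizability carries it over to a_{i0}, and <h_i,
   theta> = - a_{i0} d_0. *)
have ci : cartan_entry X i.+1 0 != 0.
  move: adj_i; rewrite mxE; apply: contra => /eqP e.
  have := cartan_sym 0 i.+1 hX; rewrite e mulr0 => /eqP.
  rewrite mulf_eq0 => /orP[/eqP h|//]; have := rd_m (affine_root_datum hX hA).
  by rewrite (_ : sqlen X 0 = 0%N) //; case: h.
have := cartan_offdiag X (isT : i.+1 != 0)%N; rewrite (pairz_theta i hX) mulNr oppr_gt0 => h.
by rewrite pmulr_llt0 ?ltz_nat ?marks_gt0 // lt_neqAle ci.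
Qed.
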